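(* Let $2<r<r^*$ and let $\mathbf{X}=\{X_j : j\in\mathbb{Z}\}$ be a stationary and positive associated process of real random variables with $\mathbb{E}\{|X_1|^{r^*}\}<+\infty$. For $n\geq 0$ let $$u(n)=\sum_{j\in\mathbb{Z}:\,|j|\geq n}\mathrm{cov}(X_0,X_j),$$ and assume that there are constants $C_1>0$ and $$\theta>\frac{r^*(r-2)}{2(r^*-r)}$$ such that $u(n)\leq C_1 n^{-\theta}$ for all $n\geq 1$. Assume moreover that $$\sigma^2:=\mathrm{var}(X_1)+2\sum_{j\geq 2}\mathrm{cov}(X_1,X_j)$$ satisfies $0<\sigma^2<+\infty$. For $k\in\mathbb{Z}$ and $n\geq 1$ let $S_{[k,k+n)}=\sum_{j=k}^{k+n-1}X_j$, $$V_{[k,k+n)}=\frac{S_{[k,k+n)}-n\,\mathbb{E}(X_1)}{\sqrt{n}\,\sigma},$$ and let $F_{[k,k+n)}$ be the distribution function of $V_{[k,k+n)}$. Let $Z$ be a standard normal $\mathrm{N}(0,1)$ random variable with distribution function $\Phi$. Then, for every $k\in\mathbb{Z}$, as $n\to\infty$, $$d_r(F_{[k,k+n)},\Phi)\to 0\quad\text{and}\quad \mathbb{E}\big(|V_{[k,k+n)}|^r\big)\to\mathbb{E}\big(|Z|^r\big).$$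
   Context: All random variables $X_j$ are real-valued and defined on a common probability space $(\Omega,\mathscr{F},\mathbb{P})$. Stationary: for all $m\geq 1$, all $i_1,\dots,i_m\in\mathbb{Z}$ and all $l\in\mathbb{Z}$, the vectors $(X_{i_1},\dots,X_{i_m})$ and $(X_{i_1+l},\dots,X_{i_m+l})$ have the same distribution. Positive associated: for every $n\geq 1$, all $j_1,\dots,j_n\in\mathbb{Z}$ and all coordinatewise non-decreasing functions $f,g:\mathbb{R}^n\to\mathbb{R}$, one has $\mathrm{cov}\big(f(X_{j_1},\dots,X_{j_n}),g(X_{j_1},\dots,X_{j_n})\big)\geq 0$ whenever this covariance exists. Here $f$ is coordinatewise non-decreasing if $f(x_1,\dots,x_n)\leq f(y_1,\dots,y_n)$ whenever $x_i\leq y_i$ for all $i$. Mallows $r$-distance: for $r>0$ and distribution functions $F,G$ on $\mathbb{R}$, $d_r(F,G)=\inf_{(X,Y)}\big\{\mathbb{E}(|X-Y|^r)\big\}^{1/r}$, where the infimum is over all random vectors $(X,Y)$ whose marginal distribution functions are $F$ and $G$ respectively. $\sigma$ denotes the positive square root of $\sigma^2$. *)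

(* Defs.v *)
From HB Require Import structures.
From mathcomp Require Import all_boot all_order all_algebra.
From mathcomp Require Import all_classical all_reals all_analysis.
From mathcomp Require Import measurable_realfun.

Set Implicit Arguments.
Unset Strict Implicit.
Unset Printing Implicit Defensive.

Import Order.TTheory GRing.Theory Num.Theory.
Import numFieldNormedType.Exports.

Local Open Scope classical_set_scope.
Local Open Scope ring_scope.

Section process.
Context (d : measure_display) (T : measurableType d) (R : realType).
Variables (P : probability T R) (X : int -> {RV P >-> R}).

Definition subvector (m : nat) (i : 'I_m -> int) (w : T) : m.-tuple R :=
  [tuple X (i j) w | j < m].

Definition stationary : Prop :=
  forall (m : nat) (i : 'I_m -> int) (l : int), (0 < m)%N ->
  forall B : set (m.-tuple R), measurable B ->
    pushforward P (subvector i) B =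
    pushforward P (subvector (fun j => i j + l)) B.

Definition coordinatewise_nondecreasing (n : nat) (f : n.-tuple R -> R) : Prop :=
  forall x y : n.-tuple R,
    (forall i : 'I_n, tnth x i <= tnth y i) -> f x <= f y.

(* Monotone functions of several variables need not be Borel, so existence of
   the covariance includes measurability of both compositions; this is part of
   membership in [Lfun P 1]. *)
Definition positive_associated : Prop :=
  forall (n : nat) (j : 'I_n -> int) (f g : n.-tuple R -> R), (0 < n)%N ->
    coordinatewise_nondecreasing f -> coordinatewise_nondecreasing g ->
    let fX := f \o subvector j in
    let gX := g \o subvector j in
    fX \in Lfun P 1 -> gX \in Lfun P 1 -> (fX * gX) \in Lfun P 1 ->
    (0 <= covariance P fX gX)%E.

(* [esum] is a supremum of finite sums, meaningful for nonnegative terms only;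
   a signed family is summed by splitting it into positive and negative parts. *)
Definition cov_tail (n : nat) : \bar R :=
  let c := fun j : int => covariance P (X 0) (X j) in
  let D := [set j : int | (n <= `|j|)%N] in
  (\esum_(j in D) c^\+ j - \esum_(j in D) c^\- j)%E.

Definition long_run_variance : \bar R :=
  ('V_P[X 1] + 2%:E * \sum_(2 <= j <oo) covariance P (X 1) (X j%:Z))%E.

Definition block_sum (k : int) (n : nat) (w : T) : R :=
  \sum_(i < n) X (k + i%:Z) w.

Definition normalized_block_sum (k : int) (n : nat) (w : T) : R :=
  (block_sum k n w - n%:R * fine 'E_P[X 1]) /
  (Num.sqrt n%:R * Num.sqrt (fine long_run_variance)).

Lemma measurable_normalized_block_sum (k : int) (n : nat) :
  measurable_fun [set: T] (normalized_block_sum k n).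
Proof.
apply: measurable_funM => //; apply: measurable_funB => //.
by apply: measurable_sum => i; exact: measurable_funP.
Qed.

HB.instance Definition _ (k : int) (n : nat) :=
  isMeasurableFun.Build _ _ _ _ (normalized_block_sum k n)
    (measurable_normalized_block_sum k n).

End process.

Definition mallows_distance (R : realType) (r : R) (F G : R -> \bar R) : \bar R :=
  ereal_inf [set z : \bar R |
    exists (d : measure_display) (T : measurableType d) (Q : probability T R)
           (U V : {RV Q >-> R}),
      [/\ cdf U = F, cdf V = G &
          z = ('E_Q[(fun w => `|U w - V w| `^ r)%R] `^ r^-1)%E]].

(* Main.v *)
(* The process satisfies a central limit theorem and its normalized sums are
   bounded in L^p for some p > r; hence they converge to the normal law in L^r
   once realized on one probability space.

   Moments: S_n = S + G + S' with S, S' of length m and a gap G of length about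
   eps n.  Expanding |S + S'|^p, the mixed term |S| |S'|^(p-1) is truncated at a
   level M; Newman's inequality bounds the covariance of |S| with the truncated
   power by M^(p-2) n u(eps n), the moment of order rstar bounds the remainder,
   and the balance of the two is what the condition on theta allows for some
   p > r.  This gives a contracting recursion for E|S_n|^p / n^(p/2).

   Central limit theorem: Lindeberg replacement, one block of length l at a
   time, of S_n by independent normal variables; association turns the
   dependence on the past into the covariance of the block with the past,
   which is o(l).

   Coupling: U_n = F_n^{-1}(Phi(Z)) lives on the space of Z, has the law of the
   normalized sum, and tends to Z everywhere since Phi is strictly increasing. *)
Require Import Defs.
From HB Require Import structures.
From mathcomp Require Import all_boot all_order all_algebra.
From mathcomp Require Import all_classical all_reals all_analysis.
From mathcomp Require Import measurable_realfun ring lra zify.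

Set Implicit Arguments.
Unset Strict Implicit.
Unset Printing Implicit Defensive.

Import Order.TTheory GRing.Theory Num.Theory.
Import numFieldNormedType.Exports.

Local Open Scope classical_set_scope.
Local Open Scope ring_scope.

(** * Real-valued expectations and covariances *)

(** Apart from the sign of covariances, association enters only through Newman's inequality, that
    is, through Lipschitz functions; [|y| ^ (p - 1)] is not Lipschitz, hence the truncation at [M].

    The recursion contracts because [p > 2]: two halves contribute [2 (n / 2) ^ (p / 2)], which is
    [2 ^ (1 - p / 2) < 1] times [n ^ (p / 2)]. Thanks to the gap, the covariances of one variable
    with the whole other half sum to at most [u(eps n)]; for adjacent halves the bound would be the
    sum of [j ^ (-theta)] over [j <= n], which does not decrease in [n].

    The covariance term permits [M = n ^ (1 / 2 + theta / (p - 2))]. With [q = rstar], the remainder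
    [M ^ (p - q) n ^ q] is then of order at most [n ^ (p / 2)] exactly when
    [q (p - 2) <= 2 theta (q - p)]. The hypothesis on [theta] is the strict inequality at [p = r],
    so some [p > r] is still allowed, and boundedness in L^p gives the uniform integrability of
    [|V| ^ r].

    No independent normal variables are constructed: adding one is a convolution of the test
    function, and the addition of variances is a semigroup property of that operator. *)

Section expectation_layer.
Context (d : measure_display) (T : measurableType d) (R : realType).
Variable P : probability T R.
Implicit Types f g : T -> R.

Definition integ f : Prop := P.-integrable setT (EFin \o f).
Definition Ex f : R := \int[P]_x f x.

Lemma integ_measurable f : integ f -> measurable_fun setT f.
Proof. by move=> /integrableP[/measurable_EFinP]. Qed.

Lemma integ_le f g : measurable_fun setT f -> integ g ->
  (forall x, `|f x| <= `|g x|) -> integ f.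
Proof.
move=> mf ig h; apply: le_integrable ig => //; first exact/measurable_EFinP.
by move=> x _ /=; rewrite lee_fin.
Qed.

Lemma integ_cst c : integ (fun=> c).
Proof. exact: finite_measure_integrable_cst. Qed.

Lemma integD f g : integ f -> integ g -> integ (fun x => f x + g x).
Proof.
move=> hf hg; have := @integrableD _ _ _ P setT measurableT _ _ hf hg.
by apply: eq_integrable.
Qed.

Lemma integZ c f : integ f -> integ (fun x => c * f x).
Proof.
move=> hf; have := @integrableZl _ _ _ P setT measurableT c _ hf.
by apply: eq_integrable.
Qed.

Lemma integN f : integ f -> integ (fun x => - f x).
Proof.
by move=> hf; have := integZ (-1) hf; congr integ; apply/funext => x; rewrite mulN1r.
Qed.

Lemma integB f g : integ f -> integ g -> integ (fun x => f x - g x).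
Proof. by move=> hf hg; apply: integD => //; apply: integN. Qed.

Lemma integ_sum (I : Type) (s : seq I) (F : I -> T -> R) :
  (forall i, integ (F i)) -> integ (fun x => \sum_(i <- s) F i x).
Proof.
move=> h; elim: s => [|i s ih].
  by rewrite (_ : (fun _ => _) = fun=> 0); [exact: integ_cst|apply/funext=> x; rewrite big_nil].
rewrite (_ : (fun _ => _) = fun x => F i x + \sum_(j <- s) F j x); last first.
  by apply/funext=> x; rewrite big_cons.
exact: integD.
Qed.

Lemma integ_norm f : integ f -> integ (fun x => `|f x|).
Proof.
move=> hf; apply: (integ_le _ hf).
  by apply: measurableT_comp => //; exact: integ_measurable hf.
by move=> x; rewrite normr_id.
Qed.

Lemma integ_bounded f B : measurable_fun setT f -> (forall x, `|f x| <= B) -> integ f.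
Proof.
move=> mf h; apply: (integ_le mf (integ_cst B)) => x.
by apply: le_trans (h x) _; rewrite ler_norm.
Qed.

Lemma integ_mulb f g B : measurable_fun setT f -> (forall x, `|f x| <= B) ->
  integ g -> integ (fun x => f x * g x).
Proof.
move=> mf h ig; apply: (@integ_le _ (fun x => B * g x)); last 1 first.
- move=> x; rewrite !normrM ler_wpM2r//.
  by apply: le_trans (h x) _; rewrite ler_norm.
- by apply: measurable_funM => //; exact: integ_measurable.
- exact: integZ.
Qed.

Lemma integ_mul2 f g : measurable_fun setT f -> measurable_fun setT g ->
  integ (fun x => f x ^+ 2) -> integ (fun x => g x ^+ 2) ->
  integ (fun x => f x * g x).
Proof.
move=> mf mg hf hg; apply: (@integ_le _ (fun x => f x ^+ 2 + g x ^+ 2)).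
- exact: measurable_funM.
- exact: integD.
- move=> x; rewrite [leRHS]ger0_norm ?addr_ge0 ?sqr_ge0//.
  rewrite normrM -(real_normK (num_real (f x))) -(real_normK (num_real (g x))).
  by have := sqr_ge0 (`|f x| - `|g x|); have := sqr_ge0 (`|f x| + `|g x|); nra.
Qed.

Lemma ExD f g : integ f -> integ g -> Ex (fun x => f x + g x) = Ex f + Ex g.
Proof. by move=> hf hg; rewrite /Ex RintegralD. Qed.

Lemma ExB f g : integ f -> integ g -> Ex (fun x => f x - g x) = Ex f - Ex g.
Proof. by move=> hf hg; rewrite /Ex RintegralB. Qed.

Lemma ExZ c f : integ f -> Ex (fun x => c * f x) = c * Ex f.
Proof. by move=> hf; rewrite /Ex RintegralZl. Qed.

Lemma Ex_cst c : Ex (fun=> c) = c.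
Proof.
rewrite /Ex Rintegral_cst// -[RHS]mulr1; congr (_ * _).
rewrite -[RHS]/(fine 1%E); congr fine; exact: probability_setT.
Qed.

Lemma Ex_le f g : integ f -> integ g -> (forall x, f x <= g x) -> Ex f <= Ex g.
Proof. by move=> hf hg h; rewrite /Ex le_Rintegral. Qed.

Lemma Ex_ge0 f : (forall x, 0 <= f x) -> 0 <= Ex f.
Proof. by move=> h; rewrite /Ex Rintegral_ge0. Qed.

Lemma Ex_norm f : integ f -> `|Ex f| <= Ex (fun x => `|f x|).
Proof. by move=> h; rewrite /Ex le_normr_Rintegral. Qed.

Lemma Ex_sum (I : Type) (s : seq I) (F : I -> T -> R) :
  (forall i, integ (F i)) ->
  Ex (fun x => \sum_(i <- s) F i x) = \sum_(i <- s) Ex (F i).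
Proof.
move=> h; elim: s => [|i s ih].
  rewrite big_nil (_ : (fun _ => _) = fun=> 0) ?Ex_cst//.
  by apply/funext=> x; rewrite big_nil.
rewrite big_cons -ih -ExD//; last exact: integ_sum.
by congr Ex; apply/funext=> x; rewrite big_cons.
Qed.

Lemma Ex_norm_le f g : integ f -> integ g -> (forall x, `|f x| <= g x) ->
  `|Ex f| <= Ex g.
Proof.
by move=> hf hg h; apply: le_trans (Ex_norm hf) _; apply: Ex_le => //; exact: integ_norm.
Qed.

Lemma Ex_norm_cst f c : integ f -> (forall x, `|f x| <= c) -> `|Ex f| <= c.
Proof. by move=> hf h; rewrite -(Ex_cst c) Ex_norm_le//; exact: integ_cst. Qed.

Lemma Ex_EFin f : integ f -> ('E_P[f] = (Ex f)%:E)%E.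
Proof.
move=> hf; rewrite unlock /Ex /Rintegral fineK//.
exact: integrable_fin_num.
Qed.

Lemma integ_Lfun1 f : integ f <-> f \in Lfun P 1.
Proof. by rewrite Lfun1_integrable. Qed.

Lemma cov_EFin f g : integ f -> integ g -> integ (fun x => f x * g x) ->
  covariance P f g = (Ex (fun x => f x * g x) - Ex f * Ex g)%:E.
Proof.
move=> hf hg hfg; rewrite covarianceE; [|exact/integ_Lfun1..].
by rewrite !Ex_EFin// EFinB EFinM.
Qed.

(** The variance of [|f|] is nonnegative; [|f|] is integrable because [|f| <= 1 + f ^ 2]. *)
Lemma Ex_sq_le f : measurable_fun setT f -> integ (fun x => f x ^+ 2) ->
  Ex (fun x => `|f x|) ^+ 2 <= Ex (fun x => f x ^+ 2).
Proof.
move=> mf h2.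
have i1 : integ (fun x => `|f x|).
  apply: (@integ_le _ (fun x => 1 + f x ^+ 2)).
  - exact: measurableT_comp.
  - by apply: integD => //; exact: integ_cst.
  - move=> x; rewrite normr_id [leRHS]ger0_norm ?addr_ge0 ?sqr_ge0//.
    rewrite -(real_normK (num_real (f x))); have := sqr_ge0 (`|f x| - 1); have := sqr_ge0 (`|f x|); nra.
set m := Ex _.
have : 0 <= Ex (fun x => (`|f x| - m) ^+ 2) by apply: Ex_ge0 => x; exact: sqr_ge0.
rewrite (_ : (fun x => _) = fun x => f x ^+ 2 + ((- 2 * m) * `|f x| + m ^+ 2)); last first.
  by apply/funext => x; rewrite -[f x ^+ 2](real_normK (num_real (f x))); ring.
rewrite ExD//; last by apply: integD; [exact: integZ|exact: integ_cst].
rewrite ExD//; [|exact: integZ|exact: integ_cst].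
rewrite ExZ// Ex_cst -/m; nra.
Qed.

End expectation_layer.

(** * Lipschitz functions and Newman's covariance inequality *)

Definition lipschitz_real (R : realType) (L : R) (f : R -> R) : Prop :=
  forall x y, `|f x - f y| <= L * `|x - y|.

Section lipschitz_real.
Context (R : realType).
Implicit Types (f : R -> R) (L : R).

Lemma lipschitz_ge0 L f : lipschitz_real L f -> 0 <= L.
Proof.
by move=> /(_ 1 0); rewrite subr0 normr1 mulr1; apply: le_trans; exact: normr_ge0.
Qed.

Lemma lipschitzN L f : lipschitz_real L f -> lipschitz_real L (fun x => - f x).
Proof. by move=> h x y; rewrite -opprD normrN. Qed.

Lemma lipschitz_homo L f : lipschitz_real L f ->
  {homo (fun x => L * x + f x) : x y / x <= y}.
Proof.
move=> h x y xy; have := h x y.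
rewrite (distrC x) [`|y - x|]ger0_norm ?subr_ge0// => H.
by have := ler_norm (f x - f y); lra.
Qed.

(** [f] is the difference of the nondecreasing functions [L * x + f x] and [L * x], and monotone
    functions of one variable are Borel. *)
Lemma lipschitz_measurable L f : lipschitz_real L f -> measurable_fun setT f.
Proof.
move=> h.
rewrite (_ : f = (fun x => L * x + f x) \- (fun x => L * x)); last first.
  by apply/funext => x /=; ring.
apply: measurable_funB; apply: nondecreasing_measurable => //.
  exact: lipschitz_homo.
by move=> x y xy; rewrite ler_wpM2l// (lipschitz_ge0 h).
Qed.

End lipschitz_real.

Section square_integrable.
Context (d : measure_display) (T : measurableType d) (R : realType).
Variable P : probability T R.
Implicit Types f g h A B : T -> R.

Definition sqinteg f : Prop :=
  measurable_fun setT f /\ integ P (fun x => f x ^+ 2).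

Definition Cv f g : R := Ex P (fun x => f x * g x) - Ex P f * Ex P g.

Lemma sqinteg_integ f : sqinteg f -> integ P f.
Proof.
move=> [mf h]; apply: (@integ_le _ _ _ _ _ (fun x => 1 + f x ^+ 2)) => //.
  by apply: integD => //; exact: integ_cst.
move=> x; rewrite [leRHS]ger0_norm ?addr_ge0 ?sqr_ge0//.
rewrite -(real_normK (num_real (f x))).
by have := sqr_ge0 (`|f x| - 1); have := sqr_ge0 (`|f x|); nra.
Qed.

Lemma sqinteg_mul f g : sqinteg f -> sqinteg g -> integ P (fun x => f x * g x).
Proof. by move=> [? ?] [? ?]; exact: integ_mul2. Qed.

Lemma sqinteg_le f g : measurable_fun setT f -> sqinteg g ->
  (forall x, `|f x| <= `|g x|) -> sqinteg f.
Proof.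
move=> mf [mg g2] h; split => //; apply: (integ_le _ g2).
  exact: measurable_funX.
by move=> x; rewrite !normrX lerXn2r ?nnegrE.
Qed.

Lemma sqintegD f g : sqinteg f -> sqinteg g -> sqinteg (fun x => f x + g x).
Proof.
move=> hf hg; have [mf f2] := hf; have [mg g2] := hg; split.
  exact: measurable_funD.
rewrite (_ : (fun x => _) = fun x => f x ^+ 2 + (2 * (f x * g x) + g x ^+ 2)); last first.
  by apply/funext => x; ring.
by apply: integD => //; apply: integD => //; apply: integZ; exact: sqinteg_mul.
Qed.

Lemma sqintegZ c f : sqinteg f -> sqinteg (fun x => c * f x).
Proof.
move=> [mf f2]; split; first exact: measurable_funM.
rewrite (_ : (fun x => _) = fun x => c ^+ 2 * f x ^+ 2); first exact: integZ.
by apply/funext => x; rewrite exprMn.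
Qed.

Lemma sqinteg_cst c : sqinteg (fun=> c).
Proof. by split; [exact: measurable_cst|exact: integ_cst]. Qed.

Lemma sqinteg_sum (I : Type) (s : seq I) (F : I -> T -> R) :
  (forall i, sqinteg (F i)) -> sqinteg (fun x => \sum_(i <- s) F i x).
Proof.
move=> h; elim: s => [|i s ih].
  by rewrite (_ : (fun _ => _) = fun=> 0); [exact: sqinteg_cst|apply/funext=> x; rewrite big_nil].
rewrite (_ : (fun _ => _) = fun x => F i x + \sum_(j <- s) F j x); last first.
  by apply/funext=> x; rewrite big_cons.
exact: sqintegD.
Qed.

Lemma sqinteg_lipschitz L (f : R -> R) A : lipschitz_real L f -> sqinteg A ->
  sqinteg (fun x => f (A x)).
Proof.
move=> lf hA; apply: (@sqinteg_le _ (fun x => `|f 0| + L * `|A x|)).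
- by apply: measurableT_comp; [exact: lipschitz_measurable lf|exact: hA.1].
- apply: sqintegD; first exact: sqinteg_cst.
  apply: sqintegZ; apply: (@sqinteg_le _ A) => //.
    by apply: measurableT_comp => //; exact: hA.1.
  by move=> x; rewrite normr_id.
- move=> x; rewrite [leRHS]ger0_norm; last first.
    by rewrite addr_ge0// mulr_ge0// (lipschitz_ge0 lf).
  have := lf (A x) 0; rewrite subr0 => h.
  rewrite -[f (A x)](subrK (f 0)) addrC; apply: le_trans (ler_normD _ _) _.
  by rewrite lerD2l.
Qed.

Lemma CvC f g : Cv f g = Cv g f.
Proof.
rewrite /Cv mulrC; congr (_ - _); congr Ex; apply/funext => x; exact: mulrC.
Qed.

Lemma CvDl f g h : sqinteg f -> sqinteg g -> sqinteg h ->
  Cv (fun x => f x + g x) h = Cv f h + Cv g h.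
Proof.
move=> hf hg hh; rewrite /Cv ExD; [|exact: sqinteg_integ..].
rewrite (_ : (fun x => (f x + g x) * h x) = fun x => f x * h x + g x * h x).
  rewrite ExD; [ring|exact: sqinteg_mul..].
by apply/funext => x; rewrite mulrDl.
Qed.

Lemma CvZl c f g : sqinteg f -> sqinteg g -> Cv (fun x => c * f x) g = c * Cv f g.
Proof.
move=> hf hg; rewrite /Cv ExZ; last exact: sqinteg_integ.
rewrite (_ : (fun x => c * f x * g x) = fun x => c * (f x * g x)).
  rewrite ExZ; [ring|exact: sqinteg_mul].
by apply/funext => x; rewrite mulrA.
Qed.

Lemma CvDr f g h : sqinteg f -> sqinteg g -> sqinteg h ->
  Cv h (fun x => f x + g x) = Cv h f + Cv h g.
Proof. by move=> *; rewrite CvC CvDl// !(CvC h). Qed.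

Lemma CvZr c f g : sqinteg f -> sqinteg g -> Cv g (fun x => c * f x) = c * Cv g f.
Proof. by move=> *; rewrite CvC CvZl// (CvC g). Qed.

Lemma Cv_sqD f g : sqinteg f -> sqinteg g ->
  Cv (fun x => f x + g x) (fun x => f x + g x) = Cv f f + 2 * Cv f g + Cv g g.
Proof.
move=> hf hg; rewrite CvDl//; last exact: sqintegD.
rewrite !CvDr// (CvC g f); ring.
Qed.

Lemma Cv_suml (I : Type) (s : seq I) (F : I -> T -> R) g :
  (forall i, sqinteg (F i)) -> sqinteg g ->
  Cv (fun x => \sum_(i <- s) F i x) g = \sum_(i <- s) Cv (F i) g.
Proof.
move=> hF hg; elim: s => [|i s ih].
  rewrite (_ : (fun _ => _) = fun=> 0); last by apply/funext=> x; rewrite big_nil.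
  rewrite big_nil /Cv (_ : (fun _ => _) = fun=> 0) ?Ex_cst; first by rewrite mul0r subr0.
  by apply/funext=> x; rewrite mul0r.
rewrite big_cons -ih -CvDl//; last exact: sqinteg_sum.
by congr Cv; apply/funext=> x; rewrite big_cons.
Qed.

Lemma Cv_sumr (I : Type) (s : seq I) (F : I -> T -> R) g :
  (forall i, sqinteg (F i)) -> sqinteg g ->
  Cv g (fun x => \sum_(i <- s) F i x) = \sum_(i <- s) Cv g (F i).
Proof.
by move=> hF hg; rewrite CvC Cv_suml//; apply: eq_bigr => i _; rewrite CvC.
Qed.

(** The form in which two block sums inherit association from the process: one monotone function of
    each. Square integrability makes [Cv] a true covariance. *)
Definition assoc_pair A B : Prop := forall f g : R -> R,
  {homo f : x y / x <= y} -> {homo g : x y / x <= y} ->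
  sqinteg (fun x => f (A x)) -> sqinteg (fun x => g (B x)) ->
  0 <= Cv (fun x => f (A x)) (fun x => g (B x)).

Lemma assoc_pair_scale A B a b : 0 <= a -> 0 <= b -> assoc_pair A B ->
  assoc_pair (fun x => a * A x) (fun x => b * B x).
Proof.
move=> a0 b0 h f g hf hg fA gB; apply: (h (fun t => f (a * t)) (fun t => g (b * t))) => //.
- by move=> x y xy; apply: hf; rewrite ler_wpM2l.
- by move=> x y xy; apply: hg; rewrite ler_wpM2l.
Qed.

Let newman_le A B Lf Lg (f g : R -> R) :
  assoc_pair A B -> sqinteg A -> sqinteg B ->
  lipschitz_real Lf f -> lipschitz_real Lg g ->
  Cv (fun x => f (A x)) (fun x => g (B x)) <= Lf * Lg * Cv A B.
Proof.
move=> hAB hA hB lf lg.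
have fA := sqinteg_lipschitz lf hA; have gB := sqinteg_lipschitz lg hB.
have expand c e : Cv (fun x => Lf * A x + c * f (A x)) (fun x => Lg * B x + e * g (B x)) =
    Lf * Lg * Cv A B + Lf * e * Cv A (fun x => g (B x)) + c * Lg * Cv (fun x => f (A x)) B
    + c * e * Cv (fun x => f (A x)) (fun x => g (B x)).
  have h1 := sqintegZ Lf hA; have h2 := sqintegZ Lg hB.
  have h3 := sqintegZ c fA; have h4 := sqintegZ e gB.
  rewrite CvDl//; last exact: sqintegD.
  rewrite !CvDr// !CvZl// !CvZr//; ring.
have key c e : c \in [:: 1; -1] -> e \in [:: 1; -1] ->
    0 <= Cv (fun x => Lf * A x + c * f (A x)) (fun x => Lg * B x + e * g (B x)).
  move=> hc he; apply: (hAB (fun t => Lf * t + c * f t) (fun t => Lg * t + e * g t)).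
  - move: hc; rewrite !inE => /orP[|] /eqP ->.
      by under [X in {homo X : _ _ / _}]eq_fun do rewrite mul1r; exact: lipschitz_homo.
    under [X in {homo X : _ _ / _}]eq_fun do rewrite mulN1r.
    exact: lipschitz_homo (lipschitzN lf).
  - move: he; rewrite !inE => /orP[|] /eqP ->.
      by under [X in {homo X : _ _ / _}]eq_fun do rewrite mul1r; exact: lipschitz_homo.
    under [X in {homo X : _ _ / _}]eq_fun do rewrite mulN1r.
    exact: lipschitz_homo (lipschitzN lg).
  - by apply: sqintegD; exact: sqintegZ.
  - by apply: sqintegD; exact: sqintegZ.
(* In the sum of the two inequalities with opposite signs the cross terms [Cv A (g B)] and
   [Cv (f A) B] cancel, leaving twice the claim. *)
have := key 1 (-1); have := key (-1) 1; rewrite !expand !inE !eqxx !orbT.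
by move=> /(_ isT isT) k1 /(_ isT isT) k2; lra.
Qed.

(* Newman's covariance inequality, without Hoeffding's formula: both
   [x |-> L x + f x] and [x |-> L x - f x] are nondecreasing when [f] is
   [L]-Lipschitz. *)
Lemma newman_ineq A B Lf Lg (f g : R -> R) :
  assoc_pair A B -> sqinteg A -> sqinteg B ->
  lipschitz_real Lf f -> lipschitz_real Lg g ->
  `|Cv (fun x => f (A x)) (fun x => g (B x))| <= Lf * Lg * Cv A B.
Proof.
move=> hAB hA hB lf lg; rewrite ler_norml (newman_le hAB)// andbT.
have := newman_le hAB hA hB (lipschitzN lf) lg.
rewrite (_ : (fun x => - f (A x)) = fun x => -1 * f (A x)); last first.
  by apply/funext => x; rewrite mulN1r.
by rewrite CvZl; [lra|exact: sqinteg_lipschitz lf hA|exact: sqinteg_lipschitz lg hB].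
Qed.

End square_integrable.

(** * Centered sums of a stationary associated process *)

Section equidistributed.
Context (d1 d2 d : measure_display) (T1 : measurableType d1)
  (T2 : measurableType d2) (U : measurableType d) (R : realType).
Variables (P1 : probability T1 R) (P2 : probability T2 R).
Variables (f : T1 -> U) (g : T2 -> U).
Hypothesis mf : measurable_fun setT f.
Hypothesis mg : measurable_fun setT g.
Hypothesis fg : forall B, measurable B -> P1 (f @^-1` B) = P2 (g @^-1` B).

Lemma eq_dist_ge0_integral (h : U -> \bar R) : measurable_fun setT h ->
  (forall x, 0 <= h x)%E -> (\int[P1]_x h (f x) = \int[P2]_x h (g x))%E.
Proof.
move=> mh h0.
pose F : {RV P1 >-> U} := HB.pack f (isMeasurableFun.Build _ _ _ _ f mf).
pose G : {RV P2 >-> U} := HB.pack g (isMeasurableFun.Build _ _ _ _ g mg).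
have e1 := @ge0_integral_distribution _ _ _ _ _ P1 F h mh h0.
have e2 := @ge0_integral_distribution _ _ _ _ _ P2 G h mh h0.
rewrite [LHS](_ : _ = \int[P1]_x (h \o F) x)%E// -e1.
rewrite [RHS](_ : _ = \int[P2]_x (h \o G) x)%E// -e2.
by apply: eq_measure_integral => A mA _; exact: fg.
Qed.

Lemma eq_dist_integral (h : U -> \bar R) : measurable_fun setT h ->
  (\int[P1]_x h (f x) = \int[P2]_x h (g x))%E.
Proof.
move=> mh; rewrite integralE [RHS]integralE; congr (_ - _)%E.
  have := @eq_dist_ge0_integral (h^\+)%E (measurable_funepos mh).
  move=> /(_ (funepos_ge0 _)) e.
  under eq_integral do rewrite funeposE -funeposE.
  by under [RHS]eq_integral do rewrite funeposE -funeposE.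
have := @eq_dist_ge0_integral (h^\-)%E (measurable_funeneg mh).
move=> /(_ (funeneg_ge0 _)) e.
under eq_integral do rewrite funenegE -funenegE.
by under [RHS]eq_integral do rewrite funenegE -funenegE.
Qed.

Lemma eq_dist_Ex (h : U -> R) : measurable_fun setT h ->
  Ex P1 (fun x => h (f x)) = Ex P2 (fun x => h (g x)).
Proof.
move=> mh; rewrite /Ex /Rintegral; congr fine.
by apply: (@eq_dist_integral (EFin \o h)); exact/measurable_EFinP.
Qed.

Lemma eq_dist_integ (h : U -> R) : measurable_fun setT h ->
  integ P1 (fun x => h (f x)) -> integ P2 (fun x => h (g x)).
Proof.
move=> mh /integrableP[_ hi]; apply/integrableP; split.
  by apply/measurable_EFinP; exact: measurableT_comp.
rewrite -(@eq_dist_ge0_integral (fun x => `|(h x)%:E|%E))//.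
by apply: measurableT_comp => //; exact/measurable_EFinP.
Qed.

End equidistributed.

Section process.
Context (d : measure_display) (T : measurableType d) (R : realType).
Variables (P : probability T R) (X : int -> {RV P >-> R}).
Hypothesis Xstat : stationary X.
Hypothesis Xassoc : positive_associated X.

Lemma measurable_subvector m (i : 'I_m -> int) :
  measurable_fun setT (subvector X i).
Proof.
apply/measurable_fun_tnthP => j.
rewrite (_ : _ \o _ = X (i j)); first exact: measurable_funP.
by apply/funext => w /=; rewrite tnth_mktuple.
Qed.

Lemma subvector_dist m (i i' : 'I_m -> int) (l : int) : (0 < m)%N ->
  (forall j, i' j = i j + l) -> forall B, measurable B ->
  P (subvector X i @^-1` B) = P (subvector X i' @^-1` B).
Proof.
move=> m0 ii B mB; have := Xstat i l m0 mB; rewrite /pushforward => ->.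
by congr (P (subvector X _ @^-1` B)); apply/funext => j.
Qed.

Hypothesis X2 : sqinteg P (X 1).

Let mu := Ex P (X 1).
Definition cX (i : int) (w : T) : R := X i w - Ex P (X 1).

Lemma X_dist i j B : measurable B -> P (X i @^-1` B) = P (X j @^-1` B).
Proof.
move=> mB.
have h := @subvector_dist 1 (fun=> i) (fun=> j) (j - i) isT.
have {}h := h (fun=> esym (subrKC _ _)) ((fun t : 1.-tuple R => tnth t ord0) @^-1` B).
have hB : measurable ((fun t : 1.-tuple R => tnth t ord0) @^-1` B).
  by rewrite -[X in measurable X]setTI; exact: measurable_tnth.
have {h} := h hB.
rewrite /preimage /=; congr (P _ = P _); apply/seteqP; split => w /=; rewrite ?tnth_mktuple//.
Qed.

Lemma X_integ (h : R -> R) i j : measurable_fun setT h ->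
  integ P (fun w => h (X i w)) -> integ P (fun w => h (X j w)).
Proof.
move=> mh; apply: eq_dist_integ => //; [exact: measurable_funP..|].
by move=> B mB; exact: X_dist.
Qed.

Lemma X_Ex (h : R -> R) i j : measurable_fun setT h ->
  Ex P (fun w => h (X i w)) = Ex P (fun w => h (X j w)).
Proof.
move=> mh; apply: eq_dist_Ex => //; [exact: measurable_funP..|].
by move=> B mB; exact: X_dist.
Qed.

Lemma X_sqinteg i : sqinteg P (X i).
Proof.
split; first exact: measurable_funP.
by apply: (@X_integ (fun x => x ^+ 2) 1) => //; exact: X2.2.
Qed.

Lemma cX_sqinteg i : sqinteg P (cX i).
Proof.
apply: sqintegD; first exact: X_sqinteg.
exact: sqinteg_cst.
Qed.

Lemma Ex_cX i : Ex P (cX i) = 0.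
Proof.
rewrite /cX ExB; [|exact: sqinteg_integ (X_sqinteg i)|exact: integ_cst].
by rewrite Ex_cst (@X_Ex id i 1)// subrr.
Qed.

Definition gam (i : int) : R := Cv P (X 0) (X i).

Lemma Cv_shift f g c e : sqinteg P f -> sqinteg P g ->
  Cv P (fun w => f w - c) (fun w => g w - e) = Cv P f g.
Proof.
move=> hf hg.
have cst0 h a : sqinteg P h -> Cv P h (fun=> a) = 0.
  move=> hh; rewrite /Cv Ex_cst (_ : (fun x => h x * a) = fun x => a * h x).
    by rewrite ExZ ?(mulrC a) ?subrr//; exact: sqinteg_integ.
  by apply/funext => x; rewrite mulrC.
have hc := sqinteg_cst P (- c); have he := sqinteg_cst P (- e).
rewrite CvDl//; last exact: sqintegD.
rewrite CvDr// CvDr// (cst0 f (- e))// (cst0 _ (- e))// (CvC P (fun=> - c)) (cst0 g (- c))//; lra.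
Qed.

(** Stationarity of the pairs: the index vector [(i, j)] is shifted by [- i]. *)
Lemma Cv_cX i j : Cv P (cX i) (cX j) = gam (j - i).
Proof.
rewrite /cX Cv_shift; [|exact: X_sqinteg..].
rewrite /gam /Cv (@X_Ex id i 0)// (@X_Ex id j (j - i))//; congr (_ - _).
pose ix a b : 'I_2 -> int := fun k => if k == ord0 then a else b.
pose h (t : 2.-tuple R) := tnth t ord0 * tnth t ord_max.
have mh : measurable_fun setT h.
  by apply: measurable_funM; exact: measurable_tnth.
have E a b : (fun w => X a w * X b w) = fun w => h (subvector X (ix a b) w).
  by apply/funext => w; rewrite /h !tnth_mktuple.
rewrite !E; apply: eq_dist_Ex => //; [exact: measurable_subvector..|].
apply: (@subvector_dist _ _ _ (- i)) => // k.
by rewrite /ix; case: ifP => _ //; rewrite addrN.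
Qed.

Definition csum (a : int) (n : nat) (w : T) : R := \sum_(i < n) cX (a + i%:Z) w.

Lemma csum_sqinteg a n : sqinteg P (csum a n).
Proof. by apply: sqinteg_sum => i; exact: cX_sqinteg. Qed.

Lemma Ex_csum a n : Ex P (csum a n) = 0.
Proof.
rewrite Ex_sum; last by move=> i; exact: sqinteg_integ (cX_sqinteg _).
by rewrite big1// => i _; exact: Ex_cX.
Qed.

Lemma csum0 a w : csum a 0 w = 0.
Proof. by rewrite /csum big_ord0. Qed.

Lemma csumD a m n w : csum a (m + n)%N w = csum a m w + csum (a + m%:Z) n w.
Proof.
rewrite /csum big_split_ord/=; congr (_ + _); apply: eq_bigr => i _.
by congr cX; rewrite PoszD addrA.
Qed.

Lemma csum_dist a b n B : measurable B ->
  P (csum a n @^-1` B) = P (csum b n @^-1` B).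
Proof.
case: n => [|n] mB.
  by congr (P _); apply/seteqP; split => w /=; rewrite !csum0.
pose h (t : n.+1.-tuple R) := \sum_(i < n.+1) (tnth t i - mu).
have mh : measurable_fun setT h.
  by apply: measurable_sum => i; apply: measurable_funB => //; exact: measurable_tnth.
have E c : csum c n.+1 = h \o subvector X (fun i : 'I_n.+1 => c + (i : nat)%:Z).
  by apply/funext => w; rewrite /h /csum /=; apply: eq_bigr => i _; rewrite tnth_mktuple.
rewrite !E; apply: (@subvector_dist _ _ _ (b - a) _ _ (h @^-1` B)) => //.
  by move=> j; ring.
by rewrite -[X in measurable X]setTI; exact: mh.
Qed.

Lemma csum_integ (h : R -> R) a b n : measurable_fun setT h ->
  integ P (fun w => h (csum a n w)) -> integ P (fun w => h (csum b n w)).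
Proof.
move=> mh; apply: eq_dist_integ => //; [exact: (csum_sqinteg _ _).1..|].
by move=> B mB; exact: csum_dist.
Qed.

Lemma csum_Ex (h : R -> R) a b n : measurable_fun setT h ->
  Ex P (fun w => h (csum a n w)) = Ex P (fun w => h (csum b n w)).
Proof.
move=> mh; apply: eq_dist_Ex => //; [exact: (csum_sqinteg _ _).1..|].
by move=> B mB; exact: csum_dist.
Qed.

(** Association is applied to the concatenated index vector, whose first part feeds [f] and whose
    second part feeds [g]; indices may repeat, so the blocks may overlap. An empty first block is
    treated apart, since association is stated for a positive number of variables. *)
Lemma csum_assoc a m b n : assoc_pair P (csum a m) (csum b n).
Proof.
case: m => [|m].
  move=> f g _ _ _ hg; rewrite (_ : (fun _ => _) = fun=> f 0); last first.
    by apply/funext => w; rewrite csum0.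
  by rewrite /Cv Ex_cst ExZ ?subrr//; exact: sqinteg_integ.
move=> f g hf hg sf sg.
pose ix (k : 'I_(m.+1 + n)) : int :=
  match fintype.split k with inl i => a + (i : nat)%:Z | inr i => b + (i : nat)%:Z end.
pose F (t : (m.+1 + n).-tuple R) := f (\sum_(i < m.+1) (tnth t (lshift n i) - mu)).
pose G (t : (m.+1 + n).-tuple R) := g (\sum_(i < n) (tnth t (rshift m.+1 i) - mu)).
have hF : coordinatewise_nondecreasing F.
  by move=> x y xy; apply: hf; apply: ler_sum => i _; rewrite lerD2r.
have hG : coordinatewise_nondecreasing G.
  by move=> x y xy; apply: hg; apply: ler_sum => i _; rewrite lerD2r.
have EF : F \o subvector X ix = fun w => f (csum a m.+1 w).
  apply/funext => w /=; rewrite /F /csum; congr f; apply: eq_bigr => i _.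
  rewrite tnth_mktuple /ix.
  by case: split_ordP => k /eqP; rewrite ?eq_lshift ?eq_lrshift// => /eqP <-.
have EG : G \o subvector X ix = fun w => g (csum b n w).
  apply/funext => w /=; rewrite /G /csum; congr g; apply: eq_bigr => i _.
  rewrite tnth_mktuple /ix.
  by case: split_ordP => k /eqP; rewrite ?eq_rshift ?eq_rlshift// => /eqP <-.
have := @Xassoc _ ix F G isT hF hG; rewrite /= EF EG.
have iF := sqinteg_integ sf; have iG := sqinteg_integ sg.
have iFG := sqinteg_mul sf sg.
move=> /(_ (proj1 (integ_Lfun1 P _) iF) (proj1 (integ_Lfun1 P _) iG) (proj1 (integ_Lfun1 P _) iFG)).
by rewrite cov_EFin// lee_fin.
Qed.

Lemma cX_csum i : cX i = csum i 1.
Proof. by apply/funext => w; rewrite /csum big_ord1 addr0. Qed.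

Lemma gam_ge0 i : 0 <= gam i.
Proof.
have := @csum_assoc 0 1 i 1 id id.
rewrite -!cX_csum Cv_cX subr0; apply => //; exact: cX_sqinteg.
Qed.

End process.

(** * Decay of covariances and the variance of sums *)

Lemma sum_from2 (R : realType) (F : nat -> \bar R) l :
  (\sum_(2 <= i < l + 2) F i = \sum_(i < l) F (i + 2)%N)%E.
Proof. by rewrite -{1}[2%N]add0n big_addn addnK big_mkord. Qed.

Section covariances.
Context (d : measure_display) (T : measurableType d) (R : realType).
Variables (P : probability T R) (X : int -> {RV P >-> R}).
Variables (C1 theta : R).
Hypothesis Xstat : stationary X.
Hypothesis Xassoc : positive_associated X.
Hypothesis X2 : sqinteg P (X 1).
Hypothesis C1_gt0 : 0 < C1.
Hypothesis theta_gt0 : 0 < theta.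
Hypothesis u_le : forall n : nat, (1 <= n)%N ->
    (cov_tail X n <= (C1 * n%:R `^ (- theta))%:E)%E.

Definition acov (k : nat) : R := gam X k%:Z.

Local Notation g := acov.

Lemma covariance_gam i j : covariance P (X i) (X j) = (gam X (j - i))%:E.
Proof.
have h k : sqinteg P (X k) by exact: X_sqinteg.
rewrite cov_EFin; [|exact: sqinteg_integ (h _)..|exact: sqinteg_mul (h _) (h _)].
by rewrite -[in RHS](Cv_cX Xstat X2) /cX Cv_shift.
Qed.

Definition tailb (k : nat) : R := C1 * k%:R `^ (- theta).

Lemma tailb_le k l : (0 < k)%N -> (k <= l)%N -> tailb l <= tailb k.
Proof.
move=> k0 kl; have l0 := leq_trans k0 kl.
rewrite /tailb ler_wpM2l ?(ltW C1_gt0)// !powRN lef_pV2 ?posrE ?powR_gt0 ?ltr0n//.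
by apply: ge0_ler_powR; rewrite ?nnegrE ?(ltW theta_gt0)// ler_nat.
Qed.

(** All covariances are nonnegative, so the negative part of [cov_tail] vanishes and the sum over
    the finitely many indices [p + i] is below the whole. *)
Lemma acov_tail p K : (0 < p)%N -> \sum_(i < K) g (p + i)%N <= tailb p.
Proof.
move=> p0; rewrite -lee_fin; apply: le_trans (u_le p0).
rewrite /cov_tail.
have cE j : covariance P (X 0) (X j) = (gam X j)%:E by rewrite covariance_gam subr0.
have c0 j : (0 <= covariance P (X 0) (X j))%E by rewrite cE lee_fin gam_ge0.
rewrite [X in (_ - X)%E]esum1; last first.
  by move=> j _; rewrite funenegE; apply/max_idPr; rewrite leeNl oppe0.
rewrite sube0; apply: esum_ge.
pose e (i : nat) : int := (p + i)%N%:Z.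
have einj : injective e by move=> i j [] /addnI.
have einj' : set_inj `I_K e by move=> i j _ _ /einj.
exists (e @` `I_K).
  split; first exact/finite_image/finite_II.
  by move=> _ [i _ <-] /=; exact: leq_addr.
rewrite -esum_fset; last 2 first.
  - exact/finite_image/finite_II.
  - by move=> i _; exact: funepos_ge0.
rewrite esum_image// esum_fset; last 2 first.
  - exact: finite_II.
  - by move=> i _; exact: funepos_ge0.
rewrite -fsbig_ord -sumEFin lee_sum// => i _.
by rewrite funeposE cE /e le_max lexx.
Qed.

(** Bounds the covariance of a block of length [l] with any block that ends where it starts: its
    [j]-th variable, counted from 0, is at distance at least [j.+1] from that past. *)
Definition tailsum (l : nat) : R := \sum_(j < l) tailb j.+1.

(** A Cesaro argument: [tailb] tends to 0, so all but the first [N] terms are at most [eps / 2], and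
    those [N] terms are at most [C1]. For [theta <= 1] the sums themselves are unbounded. *)
Lemma tailsum_small (eps : R) : 0 < eps ->
  exists l0 : nat, forall l, (l0 <= l)%N -> tailsum l <= eps * l%:R.
Proof.
move=> eps0.
have e20 : 0 < eps / 2 by rewrite divr_gt0.
have tailb1 j : tailb j.+1 <= C1.
  rewrite /tailb ler_piMr ?(ltW C1_gt0)// powRN invf_le1 ?powR_gt0//.
  by rewrite -[leLHS](powRr0 j.+1%:R) ler_powR ?(ltW theta_gt0)// ler1n.
pose N := Num.truncn ((C1 / (eps / 2)) `^ (theta^-1)) .
have small j : (N < j)%N -> tailb j <= eps / 2.
  move=> Nj; have j0 : 0 < (j%:R : R) by rewrite ltr0n (leq_trans _ Nj).
  rewrite /tailb powRN ler_pdivrMr ?powR_gt0// mulrC -ler_pdivrMr//.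
  have h : (C1 / (eps / 2)) `^ (theta^-1) <= j%:R.
    by rewrite ltW// (lt_le_trans (truncnS_gt _))// ler_nat.
  have -> : C1 / (eps / 2) = ((C1 / (eps / 2)) `^ theta^-1) `^ theta.
    by rewrite -powRrM mulVf ?gt_eqF// powRr1// divr_ge0// ltW.
  by apply: ge0_ler_powR; rewrite ?nnegrE ?powR_ge0 ?(ltW theta_gt0) ?(ltW j0).
pose l0 := (Num.truncn (N%:R * C1 / (eps / 2))).+1.
exists l0 => l ll0.
have hl : N%:R * C1 <= eps / 2 * l%:R.
  rewrite mulrC -ler_pdivrMl// mulrC.
  rewrite [leLHS](_ : _ = N%:R * C1 / (eps / 2)); last by ring.
  by rewrite ltW// (lt_le_trans (truncnS_gt _))// ler_nat.
have bnd j : tailb j.+1 <= eps / 2 + (if (j < N)%N then C1 else 0).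
  case: ltnP => [jN|Nj]; first by rewrite (le_trans (tailb1 _))// lerDr ltW.
  by rewrite addr0 small.
apply: (@le_trans _ _ (\sum_(j < l) (eps / 2 + (if (j < N)%N then C1 else 0)))).
  by apply: ler_sum => j _.
rewrite big_split/= sumr_const card_ord -mulr_natr.
have count k : \sum_(j < k) (if (j < N)%N then C1 else 0) = (minn k N)%:R * C1.
  elim: k => [|k ih]; first by rewrite big_ord0 min0n mul0r.
  rewrite big_ord_recr/= ih; case: ltnP => kN.
    by rewrite (minn_idPl kN) -natr1; ring.
  by rewrite (minn_idPr (leqW kN)) addr0.
have : (minn l N)%:R * C1 <= N%:R * C1.
  by rewrite ler_wpM2r ?(ltW C1_gt0)// ler_nat geq_minr.
rewrite count; lra.
Qed.

(** Reading the left block backwards, its covariances with the [j]-th variable of the right block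
    become consecutive values of [acov] starting at [(p + j).+1]. *)
Lemma cov_blocks a m p n :
  Cv P (csum X a m) (csum X (a + (m + p)%N%:Z) n) <= \sum_(j < n) tailb (p + j).+1.
Proof.
rewrite /csum Cv_sumr; [|by move=> i; exact: cX_sqinteg|by apply: sqinteg_sum => i; exact: cX_sqinteg].
apply: ler_sum => j _.
rewrite Cv_suml; [|by move=> i; exact: cX_sqinteg|exact: cX_sqinteg].
apply: le_trans (@acov_tail (p + j).+1 m isT).
rewrite (reindex_inj rev_ord_inj)/=; apply: ler_sum => i _.
rewrite Cv_cX// /acov; have im := ltn_ord i.
by rewrite le_eqVlt; apply/orP; left; apply/eqP; congr gam; lia.
Qed.

Definition varsum (l : nat) : R := Cv P (csum X 0 l) (csum X 0 l).

Lemma varsumS l : varsum l.+1 = varsum l + (g 0 + 2 * \sum_(i < l) g i.+1).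
Proof.
have h n : sqinteg P (csum X 0 n) by exact: csum_sqinteg.
have hx : sqinteg P (cX X l%:Z) by exact: cX_sqinteg.
have E : csum X 0 l.+1 = fun w => csum X 0 l w + cX X l%:Z w.
  by apply/funext => w; rewrite /csum big_ord_recr/= add0r.
rewrite /varsum E Cv_sqD// (Cv_cX Xstat X2 l l) subrr -addrA; congr (_ + _).
rewrite /csum Cv_suml//; last by move=> i; exact: cX_sqinteg.
have -> : \sum_(i < l) Cv P (cX X (0 + (i : nat)%:Z)) (cX X l%:Z) = \sum_(i < l) g i.+1.
  rewrite (reindex_inj rev_ord_inj)/=; apply: eq_bigr => i _; rewrite Cv_cX// /acov.
  by congr gam; have := ltn_ord i; lia.
rewrite /acov; ring.
Qed.

Lemma varsum0 : varsum 0 = 0.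
Proof.
rewrite /varsum (_ : csum X 0 0 = fun=> 0); last by apply/funext => w; rewrite csum0.
by rewrite /Cv !Ex_cst; ring.
Qed.

Hypothesis sigma2_fin : (long_run_variance X < +oo)%E.

Let s2 := fine (long_run_variance X).

Lemma long_run_varianceE : long_run_variance X = s2%:E.
Proof.
rewrite fineK// ge0_fin_numE//.
rewrite /long_run_variance adde_ge0 ?variance_ge0// mule_ge0// nneseries_ge0// => n _ _.
by rewrite covariance_gam lee_fin gam_ge0.
Qed.

Lemma partial_var_le l : g 0 + 2 * \sum_(i < l) g i.+1 <= s2.
Proof.
rewrite -lee_fin -long_run_varianceE /long_run_variance EFinD leeD//.
  by rewrite /variance covariance_gam subrr.
rewrite EFinM lee_wpmul2l//.
under eq_eseriesr do rewrite covariance_gam.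
apply: le_trans; last first.
  by apply: (nneseries_lim_ge (l + 2)%N) => n _ _; rewrite lee_fin gam_ge0.
rewrite -sumEFin sum_from2.
rewrite lee_sum// => i _; rewrite /acov lee_fin le_eqVlt; apply/orP; left; apply/eqP.
by congr gam; lia.
Qed.

(** The terms of the series beyond the first [l] are covariances at distance [l.+1] or more, hence
    bounded by [u(l + 1)]. *)
Lemma partial_var_ge l : s2 <= g 0 + 2 * \sum_(i < l) g i.+1 + 2 * tailb l.+1.
Proof.
rewrite -addrA -mulrDr -lee_fin -long_run_varianceE /long_run_variance.
rewrite [leRHS]EFinD leeD//.
  by rewrite /variance covariance_gam subrr.
rewrite EFinM lee_wpmul2l//.
under eq_eseriesr do rewrite covariance_gam.
apply: lime_le.
  by apply: is_cvg_nneseries => n _ _; rewrite lee_fin gam_ge0.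
exists (l + 2)%N => //= n /= nl.
rewrite (_ : n = ((n - 2 - l) + l + 2)%N); last by lia.
move: (n - 2 - l)%N => k {nl n}.
rewrite sum_from2 sumEFin lee_fin.
rewrite (eq_bigr (fun i : 'I_(k + l) => g i.+1)); last first.
  by move=> i _; rewrite /acov; congr gam; lia.
rewrite (addnC k l) big_split_ord/= lerD2l.
exact: (@acov_tail l.+1 k isT).
Qed.

Lemma varsum_le l : varsum l <= l%:R * s2.
Proof.
elim: l => [|l ih]; first by rewrite varsum0 mul0r.
by rewrite varsumS -(natr1 l); have := partial_var_le l; lra.
Qed.

(** Each increment of the variance is within [2 * tailb l.+1] of the long-run variance. As
    [tailsum l] is [o(l)], this makes the variance of a block asymptotically linear with the right
    slope. *)
Lemma varsum_ge l : l%:R * s2 - 2 * tailsum l <= varsum l.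
Proof.
elim: l => [|l ih]; first by rewrite varsum0 /tailsum big_ord0 mul0r mulr0 subr0.
rewrite varsumS /tailsum big_ord_recr/= -/(tailsum l) -(natr1 l).
by have := partial_var_ge l; lra.
Qed.

Lemma csum_sq a l : Ex P (fun w => csum X a l w ^+ 2) = varsum l.
Proof.
rewrite (@csum_Ex _ _ _ P X Xstat X2 (fun x => x ^+ 2) a 0)//.
by rewrite /varsum /Cv Ex_csum// mulr0 subr0; congr Ex; apply/funext => w; rewrite expr2.
Qed.

End covariances.

(** * Moment bound for sums *)

Section power_inequalities.
Context (R : realType).
Implicit Types x y r q p : R.

Lemma le_powR r x y : 0 <= r -> 0 <= x -> x <= y -> x `^ r <= y `^ r.
Proof.
by move=> r0 x0 xy; apply: ge0_ler_powR; rewrite ?nnegrE// (le_trans x0).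
Qed.

Lemma powRS r x : 0 <= x -> 1 < r -> x `^ r = x * x `^ (r - 1).
Proof. by move=> x0 r1; rewrite mulr_powRB1// (lt_trans _ r1). Qed.

Lemma powR_split_small r (del : R) : 0 < r -> 0 < del ->
  exists2 eta : R, 0 < eta < 1 & (1 + eta) `^ r <= 1 + del.
Proof.
move=> r0 d0; pose e := (1 + del) `^ r^-1.
have e1 : 1 < e.
  have h : (1 : R) `^ r^-1 < e.
    by apply: gt0_ltr_powR; rewrite ?invr_gt0 ?nnegrE//; lra.
  by rewrite powR1 in h.
exists (Num.min (1 / 2) (e - 1)).
  by rewrite lt_min gt_min; apply/andP; split; [apply/andP; split; lra|apply/orP; left; lra].
have -> : 1 + del = e `^ r by rewrite /e -powRrM mulVf ?gt_eqF// powRr1//; lra.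
apply: le_powR; [exact: ltW| |].
  by rewrite addr_ge0// le_min; apply/andP; split; lra.
have : Num.min (1 / 2) (e - 1) <= e - 1 by rewrite ge_min lexx orbT.
lra.
Qed.

(** Either [y <= eta * x], and the sum costs only the factor [(1 + eta) ^ r], or [x < y / eta], and
    everything is charged to [y]. *)
Lemma powRD_le_gap r (del : R) : 1 < r -> 0 < del ->
  exists2 C : R, 0 < C & forall x y, 0 <= x -> 0 <= y ->
    (x + y) `^ r <= (1 + del) * x `^ r + C * y `^ r.
Proof.
move=> r1 d0; have r0 : 0 < r by lra.
have [eta /andP[e0 _] he] := powR_split_small r0 d0.
exists ((1 + eta^-1) `^ r); first by rewrite powR_gt0// addr_gt0// invr_gt0.
move=> x y x0 y0; have [yx|xy] := leP y (eta * x).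
  apply: (@le_trans _ _ (((1 + eta) * x) `^ r)).
    by apply: le_powR; lra.
  rewrite powRM; [|lra..].
  apply: (@le_trans _ _ ((1 + del) * x `^ r)); first by rewrite ler_wpM2r// powR_ge0.
  by rewrite lerDl mulr_ge0// powR_ge0.
apply: (@le_trans _ _ (((1 + eta^-1) * y) `^ r)).
  apply: le_powR; [lra..|].
  rewrite mulrDl mul1r addrC lerD2l -ler_pdivrMl ?invr_gt0// invrK; exact: ltW.
rewrite powRM//; last by rewrite addr_ge0// invr_ge0 ltW.
by rewrite lerDr mulr_ge0 ?powR_ge0//; lra.
Qed.

Let powRD_le_mixed_le r (del eta : R) x y : 1 < r -> 0 < eta ->
  (1 + eta) `^ r <= 1 + del -> 0 <= y -> y <= x ->
  (x + y) `^ r <= (1 + del) * x `^ r + 2 `^ r / eta * (x `^ (r - 1) * y).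
Proof.
move=> r1 e0 he y0 yx; have r0 : 0 < r by lra.
have x0 : 0 <= x by lra.
have [h|h] := leP y (eta * x).
  apply: (@le_trans _ _ (((1 + eta) * x) `^ r)).
    by apply: le_powR; lra.
  rewrite powRM; [|lra..].
  apply: (@le_trans _ _ ((1 + del) * x `^ r)); first by rewrite ler_wpM2r// powR_ge0.
  by rewrite lerDl !mulr_ge0 ?powR_ge0// invr_ge0 ltW.
apply: (@le_trans _ _ ((2 * x) `^ r)); first by apply: le_powR; lra.
rewrite powRM; [|lra..].
apply: (@le_trans _ _ (2 `^ r / eta * (x `^ (r - 1) * y))); last first.
  have : 0 <= (1 + eta) `^ r by exact: powR_ge0.
  by move=> ?; rewrite lerDr mulr_ge0 ?powR_ge0//; lra.
have -> : 2 `^ r / eta * (x `^ (r - 1) * y) = 2 `^ r * (y / eta * x `^ (r - 1)) by ring.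
rewrite ler_wpM2l ?powR_ge0// powRS// ler_wpM2r ?powR_ge0//.
by rewrite ler_pdivlMr// mulrC ltW.
Qed.

(** Take [y <= x]. If [y <= eta * x], the factor [(1 + eta) ^ r] suffices; otherwise [x < y / eta]
    and [(2 x) ^ r] is at most a multiple of [y * x ^ (r - 1)]. The pure powers keep a coefficient
    near 1, as the contraction requires. *)
Lemma powRD_le_mixed r (del : R) : 1 < r -> 0 < del ->
  exists2 C : R, 0 < C & forall x y, 0 <= x -> 0 <= y ->
    (x + y) `^ r <= (1 + del) * (x `^ r + y `^ r) +
                    C * (x * y `^ (r - 1) + y * x `^ (r - 1)).
Proof.
move=> r1 d0; have r0 : 0 < r by lra.
have [eta /andP[e0 _] he] := powR_split_small r0 d0.
have C0 : 0 < 2 `^ r / eta by rewrite divr_gt0// powR_gt0.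
exists (2 `^ r / eta) => // x y x0 y0.
have hx := powR_ge0 x r; have hy := powR_ge0 y r.
have hx1 := powR_ge0 x (r - 1); have hy1 := powR_ge0 y (r - 1).
have [yx|/ltW xy] := leP y x.
  apply: le_trans (powRD_le_mixed_le r1 e0 he y0 yx) _.
  rewrite (mulrC y) [x * _]mulrC.
  set u := 2 `^ r / eta in C0 *.
  have h1 : 0 <= u * (y `^ (r - 1) * x) by rewrite mulr_ge0 ?(ltW C0)// mulr_ge0.
  have h2 : 0 <= (1 + del) * y `^ r by rewrite mulr_ge0//; lra.
  by lra.
rewrite addrC; apply: le_trans (powRD_le_mixed_le r1 e0 he x0 xy) _.
rewrite (mulrC y) [x * _]mulrC.
set u := 2 `^ r / eta in C0 *.
have h1 : 0 <= u * (x `^ (r - 1) * y) by rewrite mulr_ge0 ?(ltW C0)// mulr_ge0.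
have h2 : 0 <= (1 + del) * x `^ r by rewrite mulr_ge0//; lra.
by lra.
Qed.

(** A form of Young's inequality, by cases on [u <= eta * y]. The small coefficient falls on the
    power of [y], which the recursion will absorb. *)
Lemma young_powR r (eta u y : R) : 1 < r -> 0 < eta -> 0 <= u -> 0 <= y ->
  u * y `^ (r - 1) <= eta * y `^ r + eta `^ (1 - r) * u `^ r.
Proof.
move=> r1 e0 u0 y0; have [h|h] := leP u (eta * y).
  rewrite (@powRS r y)// mulrA (le_trans (ler_wpM2r (powR_ge0 _ _) h))//.
  by rewrite lerDl mulr_ge0// powR_ge0.
apply: (@le_trans _ _ (u * (u / eta) `^ (r - 1))).
  rewrite ler_wpM2l//; apply: le_powR; [lra|lra|].
  by rewrite ler_pdivlMr// mulrC ltW.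
have -> : u * (u / eta) `^ (r - 1) = eta `^ (1 - r) * u `^ r.
  rewrite powRM ?invr_ge0 ?(ltW e0)// (@powRS r u)//.
  have -> : eta^-1 = eta `^ (-1) by rewrite powR_inv1// ltW.
  by rewrite -powRrM mulN1r opprB; ring.
by rewrite lerDr mulr_ge0 ?powR_ge0// ltW.
Qed.

(** Truncation matters only for [y > M]; then [m = max x y] exceeds [M], and [x * y ^ (r - 1) <= m ^
    r <= M ^ (r - q) * m ^ q]. *)
Lemma powR_trunc_le r q (M x y : R) : 1 < r -> r < q -> 0 < M -> 0 <= x -> 0 <= y ->
  x * y `^ (r - 1) <= x * Num.min y M `^ (r - 1) + M `^ (r - q) * (x `^ q + y `^ q).
Proof.
move=> r1 rq M0 x0 y0; have [yM|My] := leP y M.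
  by rewrite lerDl mulr_ge0 ?addr_ge0 ?powR_ge0.
apply: (@le_trans _ _ (M `^ (r - q) * (x `^ q + y `^ q))); last first.
  by rewrite lerDr mulr_ge0// powR_ge0.
pose m := Num.max x y.
have ym : y <= m by rewrite le_max lexx orbT.
have xm : x <= m by rewrite le_max lexx.
have m0 : 0 < m by lra.
apply: (@le_trans _ _ (m `^ r)).
  rewrite (@powRS r m) ?(ltW m0)//; apply: ler_pM => //; first exact: powR_ge0.
  by apply: le_powR; lra.
apply: (@le_trans _ _ (M `^ (r - q) * m `^ q)).
  have -> : m `^ r = m `^ (r - q) * m `^ q.
    by rewrite -powRD ?subrK// (gt_eqF m0) implybT.
  rewrite ler_wpM2r ?powR_ge0//.
  rewrite -[r - q]opprB !powRN lef_pV2 ?posrE ?powR_gt0//.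
  by apply: le_powR; lra.
rewrite ler_wpM2l ?powR_ge0// /m; case: (leP x y) => _.
  by rewrite lerDr powR_ge0.
by rewrite lerDl powR_ge0.
Qed.

Lemma bernoulli_le (t : R) k : 0 <= t <= 1 -> 1 - t ^+ k <= k%:R * (1 - t).
Proof.
move=> /andP[t0 t1]; elim: k => [|k ih]; first by rewrite expr0 subrr mul0r.
rewrite exprS -natr1.
have : t * (1 - t ^+ k) <= k%:R * (1 - t).
  have h : 0 <= 1 - t ^+ k by rewrite subr_ge0 exprn_ile1.
  by apply: le_trans ih; nra.
by nra.
Qed.

(** With [t = a / b] in the unit interval, [1 - t ^ p <= 1 - t ^ k <= k (1 - t)]: an integer
    [k >= p] lets Bernoulli's inequality stand in for differentiation of a real power. *)
Lemma powR_sub_le p (M a b : R) k : 1 <= p -> p <= k%:R -> 0 <= a -> a <= b -> b <= M ->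
  b `^ p - a `^ p <= k%:R * M `^ (p - 1) * (b - a).
Proof.
move=> p1 pk a0 ab bM; have [b0|b0] := leP b 0.
  have -> : b = 0 by lra.
  have -> : a = 0 by lra.
  by rewrite !subrr mulr0.
have t01 : 0 <= a / b <= 1 by rewrite divr_ge0 ?(ltW b0)//= ler_pdivrMr// mul1r.
have tpk : (a / b) ^+ k <= (a / b) `^ p.
  have [->|tn] := eqVneq (a / b) 0.
    rewrite powR0; last by rewrite gt_eqF//; lra.
    case: k pk => [|k _]; last by rewrite expr0n.
    by move=> ?; lra.
  rewrite -powR_mulrn; last by case/andP: t01.
  by apply: ger_powR => //; case/andP: t01 => h ->; rewrite lt_neqAle eq_sym tn h.
have e : a `^ p = (a / b) `^ p * b `^ p.
  by rewrite -powRM ?divfK ?gt_eqF//; [case/andP: t01|exact: ltW].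
rewrite e.
have {}e : b `^ p = b * b `^ (p - 1) by rewrite mulr_powRB1 ?(ltW b0)//; lra.
apply: (@le_trans _ _ (b `^ p * (1 - (a / b) ^+ k))).
  have := powR_ge0 b p; nra.
apply: (@le_trans _ _ (b `^ p * (k%:R * (1 - a / b)))).
  by rewrite ler_wpM2l ?powR_ge0// bernoulli_le.
rewrite e [leLHS](_ : _ = k%:R * b `^ (p - 1) * (b - a)); last first.
  by field; rewrite gt_eqF.
rewrite ler_wpM2r ?subr_ge0// ler_wpM2l//.
by apply: le_powR; lra.
Qed.

Lemma lipschitz_trunc_powR p (M : R) k : 1 <= p -> p <= k%:R -> 0 < M ->
  lipschitz_real (k%:R * M `^ (p - 1)) (fun y => Num.min `|y| M `^ p).
Proof.
move=> p1 pk M0.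
have L0 : 0 <= k%:R * M `^ (p - 1) by rewrite mulr_ge0// powR_ge0.
suff h x y : `|x| <= `|y| -> `|Num.min `|x| M `^ p - Num.min `|y| M `^ p| <=
    k%:R * M `^ (p - 1) * `|x - y|.
  move=> x y; have [xy|/ltW xy] := leP `|x| `|y|; first exact: h.
  by rewrite distrC (distrC x); exact: h.
move=> xy; rewrite distrC.
have mle : Num.min `|x| M <= Num.min `|y| M by rewrite le_min ge_min xy ge_min lexx orbT.
have m0 : 0 <= Num.min `|x| M by rewrite le_min normr_ge0 ltW.
rewrite ger0_norm; last by rewrite subr_ge0 le_powR//; lra.
have mM : Num.min `|y| M <= M by rewrite ge_min lexx orbT.
apply: le_trans (powR_sub_le p1 pk m0 mle mM) _.
rewrite ler_wpM2l//.
apply: (@le_trans _ _ (`|y| - `|x|)); last by rewrite distrC lerB_dist.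
by case: (leP `|x| M) => ?; case: (leP `|y| M) => ?; lra.
Qed.

(** The convex function [t ^ q] lies above its tangent at [c]; obtained from Young's inequality with
    conjugate exponents [q] and [q / (q - 1)]. *)
Lemma powR_tangent q (t c : R) : 1 < q -> 0 <= t -> 0 <= c ->
  q * (t * c `^ (q - 1)) <= t `^ q + (q - 1) * c `^ q.
Proof.
move=> q1 t0 c0.
have q0 : 0 < q by lra.
have q10 : 0 < q / (q - 1) by rewrite divr_gt0//; lra.
have := @conjugate_powR R t (c `^ (q - 1)) q (q / (q - 1)) t0 (powR_ge0 _ _) q0 q10.
have -> : q^-1 + (q / (q - 1))^-1 = 1 by field; lra.
move=> /(_ erefl); rewrite -powRrM.
have -> : (q - 1) * (q / (q - 1)) = q by field; lra.
move=> h.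
have := ler_wpM2l (ltW q0) h.
rewrite [X in _ <= X -> _](_ : _ = t `^ q + (q - 1) * c `^ q)//.
by field; lra.
Qed.

(** Jensen's inequality: the tangent inequality at the mean [c] of the [|x i|], summed over [i]. *)
Lemma powR_sum_le q n (x : 'I_n -> R) : 1 < q ->
  `|\sum_(i < n) x i| `^ q <= n%:R `^ (q - 1) * \sum_(i < n) `|x i| `^ q.
Proof.
move=> q1; case: n => [|n] in x *.
  by rewrite !big_ord0 normr0 powR0 ?mulr0// gt_eqF//; lra.
pose s := \sum_(i < n.+1) `|x i|.
have s0 : 0 <= s by exact: sumr_ge0.
have N0 : 0 < n.+1%:R :> R by rewrite ltr0n.
pose c : R := s / n.+1%:R.
have c0 : 0 <= c by rewrite divr_ge0// ltW.
apply: (@le_trans _ _ (s `^ q)); first by apply: le_powR => //; [lra|exact: ler_norm_sum].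
have : \sum_(i < n.+1) (q * (`|x i| * c `^ (q - 1))) <=
       \sum_(i < n.+1) (`|x i| `^ q + (q - 1) * c `^ q).
  by apply: ler_sum => i _; exact: powR_tangent.
have -> : \sum_(i < n.+1) (`|x i| `^ q + (q - 1) * c `^ q) =
    \sum_(i < n.+1) `|x i| `^ q + n.+1%:R * ((q - 1) * c `^ q).
  by rewrite big_split/= sumr_const card_ord mulr_natl.
rewrite -mulr_sumr -mulr_suml -/s.
have -> : s = n.+1%:R * c by rewrite /c mulrC divfK ?gt_eqF.
rewrite -mulrA mulr_powRB1//; last by lra.
move=> h.
rewrite powRM ?(ltW N0)//.
have -> : n.+1%:R `^ q = n.+1%:R `^ (q - 1) * n.+1%:R :> R.
  by rewrite mulrC mulr_powRB1 ?(ltW N0)//; lra.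
rewrite -mulrA ler_wpM2l ?powR_ge0//; nra.
Qed.

Lemma powR_le_1D r q x : 0 <= r -> r <= q -> 0 <= x -> x `^ r <= 1 + x `^ q.
Proof.
move=> r0 rq x0; have [x1|x1] := leP x 1.
  apply: (@le_trans _ _ 1); last by rewrite lerDl powR_ge0.
  have : x `^ r <= 1 `^ r by exact: le_powR.
  by rewrite powR1.
apply: (@le_trans _ _ (x `^ q)); last by rewrite lerDr.
by apply: ler_powR => //; exact: ltW.
Qed.

End power_inequalities.

Lemma measurable_norm_powR d (T : measurableType d) (R : realType) (f : T -> R) p :
  measurable_fun setT f -> measurable_fun setT (fun x => `|f x| `^ p).
Proof.
move=> mf; apply: (@measurableT_comp _ _ _ _ _ _ (@powR R ^~ p)).
  exact: measurable_powR.
exact: measurableT_comp.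
Qed.

Lemma integ_powR_le d (T : measurableType d) (R : realType) (P : probability T R)
  (f : T -> R) p q : measurable_fun setT f -> 0 <= p -> p <= q ->
  integ P (fun x => `|f x| `^ q) -> integ P (fun x => `|f x| `^ p).
Proof.
move=> mf p0 pq hq; apply: (@integ_le _ _ _ _ _ (fun x => 1 + `|f x| `^ q)).
- exact: measurable_norm_powR.
- by apply: integD => //; exact: integ_cst.
- move=> x; rewrite [leLHS]ger0_norm ?powR_ge0// [leRHS]ger0_norm ?addr_ge0 ?powR_ge0//.
  exact: powR_le_1D.
Qed.

Lemma mixed_combine (R : realType) (x y e a u v z D1 D2 K : R) :
  x <= e * a + u + D2 * z + v -> y <= e * a + u + D2 * z + v ->
  u <= D1 * z -> v <= 2 * K * z ->
  x + y <= 2 * e * a + 2 * (D1 + D2 + 2 * K) * z.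
Proof. by move=> *; lra. Qed.

Lemma recursion_combine (R : realType) (an am ap x kap del Cm Cg C two z : R) :
  an <= (1 + del) * ((1 + del) * (am + am) + Cm * x) + Cg * ap ->
  x <= kap * two / (8 * ((1 + del) * Cm)) * am + C * z ->
  0 < Cm -> 0 < del -> 0 < two ->
  an <= ((1 + del) * (1 + del) * (2 / two) + kap / 8) * two * am + Cg * ap +
        (1 + del) * Cm * C * z.
Proof.
move=> h1 h2 Cm0 d0 two0; apply: (le_trans h1).
have dC0 : 0 < (1 + del) * Cm by apply: mulr_gt0 => //; lra.
have := ler_wpM2l (ltW dC0) h2.
have -> : (1 + del) * Cm * (kap * two / (8 * ((1 + del) * Cm)) * am + C * z) =
   kap / 8 * two * am + (1 + del) * Cm * C * z by field; lra.
have -> : ((1 + del) * (1 + del) * (2 / two) + kap / 8) * two * am =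
   (1 + del) * (1 + del) * 2 * am + kap / 8 * two * am by field; rewrite gt_eqF.
lra.
Qed.

(** * The recursion for moments of block sums *)

Section moment_recursion.
Context (d : measure_display) (T : measurableType d) (R : realType).
Variables (P : probability T R) (X : int -> {RV P >-> R}).
Variables (C1 theta r q s2 : R).
Hypothesis Xstat : stationary X.
Hypothesis Xassoc : positive_associated X.
Hypothesis X2 : sqinteg P (X 1).
Hypothesis C1_gt0 : 0 < C1.
Hypothesis theta_gt0 : 0 < theta.
Hypothesis var_le : forall l, varsum X l <= l%:R * s2.
Hypothesis cov_le : forall m p n,
  Cv P (csum X 0 m) (csum X (m + p)%N%:Z n) <= \sum_(j < n) tailb C1 theta (p + j).+1.
Hypothesis r_gt2 : 2 < r.
Hypothesis r_lt_q : r < q.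
(** Makes the truncation remainder [M ^ (r - q) * n ^ q] at most [n ^ (r / 2)] for
    [M = n ^ (1 / 2 + theta / (r - 2))]. Here [r] is a generic exponent, later replaced by [p] and
    by [min p 3], while [q] is [rstar]. *)
Hypothesis expo_le : q + (r - q) * (1 / 2 + theta / (r - 2)) <= r / 2.
Hypothesis Xq : integ P (fun w => `|cX X 0 w| `^ q).

Let Kq := Ex P (fun w => `|cX X 0 w| `^ q).

Let csum_meas a n : measurable_fun setT (csum X a n).
Proof. exact: (csum_sqinteg Xstat X2 a n).1. Qed.

Lemma cXq_integ i : integ P (fun w => `|cX X i w| `^ q).
Proof.
rewrite (cX_csum X i); apply: (@csum_integ _ _ _ P X Xstat X2 (fun x => `|x| `^ q) 0).
  exact: measurable_norm_powR.
by rewrite -cX_csum.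
Qed.

Lemma cXq_Ex i : Ex P (fun w => `|cX X i w| `^ q) = Kq.
Proof.
rewrite (cX_csum X i) (@csum_Ex _ _ _ P X Xstat X2 (fun x => `|x| `^ q) _ 0).
  by rewrite -cX_csum.
exact: measurable_norm_powR.
Qed.

Lemma csumq_integ a n : integ P (fun w => `|csum X a n w| `^ q).
Proof.
have r2 := r_gt2; have rq := r_lt_q.
apply: (@integ_le _ _ _ _ _
  (fun w => n%:R `^ (q - 1) * \sum_(i < n) `|cX X (a + i%:Z) w| `^ q)).
- exact: measurable_norm_powR.
- by apply: integZ; apply: integ_sum => i; exact: cXq_integ.
- move=> w; rewrite [leLHS]ger0_norm ?powR_ge0// [leRHS]ger0_norm.
    by apply: powR_sum_le; lra.
  by rewrite mulr_ge0 ?powR_ge0// sumr_ge0// => i _; exact: powR_ge0.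
Qed.

(** A crude bound without any cancellation, applied only to the part of the moment beyond the
    truncation level. *)
Lemma csumq_le a n : Ex P (fun w => `|csum X a n w| `^ q) <= n%:R `^ q * Kq.
Proof.
have r2 := r_gt2; have rq := r_lt_q.
have isum : integ P (fun w => \sum_(i < n) `|cX X (a + i%:Z) w| `^ q).
  by apply: integ_sum => i; exact: cXq_integ.
apply: (@le_trans _ _ (Ex P
  (fun w => n%:R `^ (q - 1) * \sum_(i < n) `|cX X (a + i%:Z) w| `^ q))).
  apply: Ex_le; [exact: csumq_integ|exact: integZ|].
  by move=> w; apply: powR_sum_le; lra.
rewrite ExZ// Ex_sum; last by move=> i; exact: cXq_integ.
rewrite (eq_bigr (fun=> Kq)); last by move=> i _; exact: cXq_Ex.
rewrite sumr_const card_ord -[Kq *+ n]mulr_natl mulrA mulrC [_ `^ _ * _]mulrC.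
by rewrite mulr_powRB1 ?ler0n// 1?mulrC//; lra.
Qed.

Lemma csump_integ a n p : 0 <= p -> p <= q -> integ P (fun w => `|csum X a n w| `^ p).
Proof. by move=> p0 pq; apply: integ_powR_le (csumq_integ a n). Qed.

Definition amom (n : nat) : R := Ex P (fun w => `|csum X 0 n w| `^ r).

Lemma amomE a n : Ex P (fun w => `|csum X a n w| `^ r) = amom n.
Proof.
apply: (@csum_Ex _ _ _ P X Xstat X2 (fun x => `|x| `^ r)).
exact: measurable_norm_powR.
Qed.

Lemma amom_ge0 n : 0 <= amom n.
Proof. by apply: Ex_ge0 => w; exact: powR_ge0. Qed.

Lemma Ex_norm_csum_le a n : Ex P (fun w => `|csum X a n w|) <= Num.sqrt (n%:R * s2).
Proof.
have h := Ex_sq_le (csum_meas a n) (csum_sqinteg Xstat X2 a n).2.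
rewrite (csum_sq Xstat X2) in h.
rewrite -[leLHS]ger0_norm; last by apply: Ex_ge0.
by rewrite -sqrtr_sqr; apply: ler_wsqrtr; apply: le_trans h (var_le n).
Qed.

(** The first two terms come from the product of expectations, through [E|A| <= sqrt (m s2)] and
    Young's inequality; the third is the Newman bound for [|A|] and the truncated power of [B],
    whose Lipschitz constant is [k * M ^ (r - 2)]; the last is what the truncation discards. *)
Lemma mixed_moment_le (k : nat) (eta M V : R) a b m : r - 1 <= k%:R -> 0 < eta -> 0 < M ->
  Cv P (csum X a m) (csum X b m) <= V ->
  Ex P (fun w => `|csum X a m w| * `|csum X b m w| `^ (r - 1)) <=
  eta * amom m + eta `^ (1 - r) * Num.sqrt (m%:R * s2) `^ r +
  k%:R * M `^ (r - 2) * V + M `^ (r - q) * (2 * (m%:R `^ q * Kq)).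
Proof.
have r2 := r_gt2; have rq := r_lt_q.
have r1 : 1 < r by lra.
have rm1 : 0 <= r - 1 by lra.
have rm1q : r - 1 <= q by lra.
have rpos : 0 <= r by lra.
have rleq : r <= q by lra.
move=> rk e0 M0 hV.
set A := csum X a m; set B := csum X b m.
have sA : sqinteg P A by exact: csum_sqinteg.
have sB : sqinteg P B by exact: csum_sqinteg.
have lA : lipschitz_real 1 (fun x : R => `|x|).
  by move=> x y; rewrite mul1r; exact: ler_dist_dist.
have lB := @lipschitz_trunc_powR R (r - 1) M k ltac:(lra) rk M0.
set tr := fun y : R => _ in lB.
have sA' := sqinteg_lipschitz lA sA; have sB' := sqinteg_lipschitz lB sB.
have iAT : integ P (fun w => `|A w| * tr (B w)) by exact: sqinteg_mul.
have iAq : integ P (fun w => `|A w| `^ q) by exact: csumq_integ.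
have iBq : integ P (fun w => `|B w| `^ q) by exact: csumq_integ.
have iS : integ P (fun w => M `^ (r - q) * (`|A w| `^ q + `|B w| `^ q)).
  by apply: integZ; exact: integD.
have mA : measurable_fun setT A by exact: csum_meas.
have mB : measurable_fun setT B by exact: csum_meas.
have pt w : `|A w| * `|B w| `^ (r - 1) <=
    `|A w| * tr (B w) + M `^ (r - q) * (`|A w| `^ q + `|B w| `^ q).
  by apply: powR_trunc_le => //; lra.
have iL : integ P (fun w => `|A w| * `|B w| `^ (r - 1)).
  apply: (integ_le _ (integD iAT iS)).
    by apply: measurable_funM; [exact: measurableT_comp|exact: measurable_norm_powR].
  move=> w; rewrite [leLHS]ger0_norm ?mulr_ge0 ?powR_ge0//.
  by apply: le_trans (pt w) _; exact: ler_norm.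
apply: (le_trans (Ex_le iL (integD iAT iS) pt)).
rewrite ExD// lerD//; last first.
  rewrite ExZ ?ExD//; last exact: integD.
  rewrite ler_wpM2l ?powR_ge0// [leRHS]mulr_natl mulr2n lerD//; exact: csumq_le.
have hC := newman_ineq (@csum_assoc _ _ _ P X Xassoc a m b m) sA sB lA lB.
have {}hC : Ex P (fun w => `|A w| * tr (B w)) <=
    Ex P (fun w => `|A w|) * Ex P (fun w => tr (B w)) + k%:R * M `^ (r - 2) * V.
  have h1 := le_trans (ler_norm _) hC.
  rewrite mul1r (_ : r - 1 - 1 = r - 2) in h1; last by lra.
  have h2 : k%:R * M `^ (r - 2) * Cv P A B <= k%:R * M `^ (r - 2) * V.
    by rewrite ler_wpM2l// mulr_ge0// powR_ge0.
  by rewrite /Cv in h1 h2 *; lra.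
apply: (le_trans hC); rewrite lerD2r.
set u := Num.sqrt _.
have u0 : 0 <= u by exact: sqrtr_ge0.
have iB1 : integ P (fun w => `|B w| `^ (r - 1)) by exact: csump_integ.
have itr := sqinteg_integ sB'.
have h1 : Ex P (fun w => tr (B w)) <= Ex P (fun w => `|B w| `^ (r - 1)).
  apply: Ex_le => // w; apply: le_powR; [lra| |by rewrite ge_min lexx].
  by rewrite le_min normr_ge0 ltW.
apply: (@le_trans _ _ (u * Ex P (fun w => `|B w| `^ (r - 1)))).
  apply: ler_pM; [exact: Ex_ge0|by apply: Ex_ge0 => w; exact: powR_ge0| |exact: h1].
  exact: Ex_norm_csum_le.
have iBr : integ P (fun w => `|B w| `^ r) by exact: csump_integ.
rewrite -ExZ// -(amomE b) -/B -ExZ//.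
rewrite -[X in _ <= _ + X](Ex_cst P) -ExD; [|exact: integZ|exact: integ_cst].
apply: Ex_le; [exact: integZ|by apply: integD; [exact: integZ|exact: integ_cst]|].
by move=> w; exact: young_powR r1 e0 u0 (normr_ge0 _).
Qed.

(** Only the term in [eta] keeps the moment of the half; the rest is of the target order
    [n ^ (r / 2)]. Indices of the two blocks differ by at least [p.+1], whence the form of the gap
    condition. *)
Lemma mixed_moment_block (eta eps : R) : 0 < eta -> 0 < eps ->
  exists2 C : R, 0 <= C & forall n m p : nat, (0 < n)%N -> (m <= n)%N ->
    eps * n%:R <= p.+1%:R ->
    Ex P (fun w => `|csum X 0 m w| * `|csum X (m + p)%N%:Z m w| `^ (r - 1)) +
    Ex P (fun w => `|csum X (m + p)%N%:Z m w| * `|csum X 0 m w| `^ (r - 1)) <=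
    eta * amom m + C * n%:R `^ (r / 2).
Proof.
have r2 := r_gt2; have rq := r_lt_q.
move=> e0 ep0.
have [k rk] : exists k : nat, r - 1 <= k%:R.
  by exists (Num.truncn (r - 1)).+1; rewrite ltW// truncnS_gt.
pose e2 := eta / 2; have e20 : 0 < e2 by rewrite divr_gt0.
pose D1 := e2 `^ (1 - r) * Num.sqrt s2 `^ r.
pose D2 := k%:R * (C1 * eps `^ (- theta)).
have Kq0 : 0 <= Kq by apply: Ex_ge0 => w; exact: powR_ge0.
have D10 : 0 <= D1 by rewrite mulr_ge0// powR_ge0.
have D20 : 0 <= D2 by rewrite mulr_ge0// mulr_ge0 ?powR_ge0// ltW.
exists (2 * (D1 + D2 + 2 * Kq)); first by rewrite mulr_ge0//; lra.
move=> n m p n0 mn hp.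
have N0 : 0 < n%:R :> R by rewrite ltr0n.
have N1 : 1 <= n%:R :> R by rewrite ler1n.
have mN : m%:R <= n%:R :> R by rewrite ler_nat.
(* The truncation level makes [M^(r-2) n u(eps n)] of order [n^(r/2)]. *)
pose M := n%:R `^ (1 / 2 + theta / (r - 2)) : R.
have M0 : 0 < M by rewrite powR_gt0.
pose V := n%:R * (C1 * (eps * n%:R) `^ (- theta)).
have hV : Cv P (csum X 0 m) (csum X (m + p)%N%:Z m) <= V.
  apply: (le_trans (cov_le _ _ _)).
  have p0 : 0 < (eps * n%:R) :> R by rewrite mulr_gt0.
  have tb : tailb C1 theta p.+1 <= C1 * (eps * n%:R) `^ (- theta).
    rewrite /tailb ler_wpM2l ?(ltW C1_gt0)// !powRN lef_pV2 ?posrE ?powR_gt0//.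
    by apply: le_powR; [exact: ltW..|].
  apply: (@le_trans _ _ (\sum_(j < m) (C1 * (eps * n%:R) `^ (- theta)))).
    apply: ler_sum => j _; apply: le_trans tb; apply: tailb_le => //.
    by rewrite ltnS leq_addr.
  rewrite sumr_const card_ord -[leLHS]mulr_natl ler_wpM2r//.
  by rewrite mulr_ge0 ?powR_ge0// ltW.
have hV' : Cv P (csum X (m + p)%N%:Z m) (csum X 0 m) <= V by rewrite CvC.
have b1 : e2 `^ (1 - r) * Num.sqrt (m%:R * s2) `^ r <= D1 * n%:R `^ (r / 2).
  rewrite /D1 -mulrA ler_wpM2l ?powR_ge0//.
  rewrite sqrtrM ?ler0n// powRM ?sqrtr_ge0// mulrC ler_wpM2l ?powR_ge0//.
  rewrite -powR12_sqrt ?ler0n// -powRrM (_ : 2^-1 * r = r / 2); last by rewrite mulrC.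
  by apply: le_powR; rewrite ?ler0n//; lra.
(* The exponents satisfy [(r - 2) * (1 / 2 + theta / (r - 2)) - theta + 1 = r / 2]: [M] is as large
   as the covariance term permits. *)
have b2 : k%:R * M `^ (r - 2) * V = D2 * n%:R `^ (r / 2).
  rewrite /V /D2 powRM ?(ltW ep0)// ?(ltW N0)//.
  rewrite [LHS](_ : _ = k%:R * (C1 * eps `^ (- theta)) *
     (M `^ (r - 2) * n%:R `^ (- theta) * n%:R)); last by ring.
  congr (_ * _); rewrite /M -powRrM.
  rewrite -[X in _ * X](@powRr1 _ n%:R) ?ler0n//.
  rewrite -powRD; last by rewrite (gt_eqF N0) implybT.
  rewrite -powRD; last by rewrite (gt_eqF N0) implybT.
  by congr powR; field; lra.
(* The discarded part is small enough exactly by [expo_le]. *)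
have b3 : M `^ (r - q) * (2 * (m%:R `^ q * Kq)) <= 2 * Kq * n%:R `^ (r / 2).
  have h : M `^ (r - q) * m%:R `^ q <= n%:R `^ (r / 2).
    apply: (@le_trans _ _ (M `^ (r - q) * n%:R `^ q)).
      by rewrite ler_wpM2l ?powR_ge0//; apply: le_powR; rewrite ?ler0n//; lra.
    rewrite /M -powRrM -powRD; last by rewrite (gt_eqF N0) implybT.
    apply: ler_powR => //; have := expo_le; lra.
  by have := ler_wpM2l Kq0 h; lra.
have h1 := mixed_moment_le rk e20 M0 hV.
have h2 := mixed_moment_le rk e20 M0 hV'.
have -> : eta = 2 * e2 by rewrite /e2; field.
rewrite b2 in h1 h2.
exact: mixed_combine h1 h2 b1 b3.
Qed.

(** The two halves alone would give the factor [rho0 = 2 / 2 ^ (r / 2)], below 1 because [r > 2].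
    The room [kap = 1 - rho0] is shared between [del], the mixed terms and the gap, so that the
    total stays strictly contracting. *)
Lemma recursion_step : exists C1' : R, exists C2 : R, exists eps : R, exists rho : R,
  [/\ [/\ 0 < eps, eps < 1 / 4 & 0 <= C2], [/\ rho < 1 & 0 <= rho],
     0 <= C1' /\ (C1' * (2 * eps) `^ (r / 2) + rho <= (1 + rho) / 2) &
   forall n m p : nat, (0 < n)%N -> n = (m + p + m)%N -> eps * n%:R <= p.+1%:R ->
   amom n <= rho * 2 `^ (r / 2) * amom m + C1' * amom p + C2 * n%:R `^ (r / 2)].
Proof.
have r2 := r_gt2; have rq := r_lt_q.
have r0 : 0 < r / 2 by lra.
have r1 : 1 < r by lra.
have rpos : 0 <= r by lra.
have rleq : r <= q by lra.
pose rho0 := 2 / 2 `^ (r / 2) : R.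
have two0 : 0 < 2 `^ (r / 2) :> R by rewrite powR_gt0.
have rho0_lt1 : rho0 < 1.
  rewrite /rho0 ltr_pdivrMr// mul1r.
  have : (2 : R) `^ 1 < 2 `^ (r / 2).
    by rewrite /powR gt_eqF// ltr_expR ltr_pM2r ?ln_gt0//; lra.
  by rewrite powRr1.
have rho0_gt0 : 0 < rho0 by rewrite divr_gt0.
pose kap := 1 - rho0.
have kap0 : 0 < kap by rewrite /kap; lra.
pose del := kap / 6.
have del0 : 0 < del by rewrite /del; lra.
have kap1 : kap < 1 by rewrite /kap; lra.
have [Cg Cg0 hg] := powRD_le_gap r1 del0.
have [Cm Cm0 hm] := powRD_le_mixed r1 del0.
(* Chosen so that the mixed terms, multiplied by [(1 + del) * Cm], add only [kap / 8] to the
   contraction factor. *)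
pose eta := kap * 2 `^ (r / 2) / (8 * ((1 + del) * Cm)).
have dC0 : 0 < (1 + del) * Cm by rewrite mulr_gt0//; lra.
have eta0 : 0 < eta by apply: divr_gt0; apply: mulr_gt0.
(* Since [(2 * eps) ^ (r / 2) <= 2 * eps], the gap contributes at most [kap / 32], while
   [(1 - rho) / 2] is at least [3 * kap / 16]. *)
pose eps := Num.min (1 / 8) (kap / (64 * (Cg + 1))).
have Cg1 : 0 < 64 * (Cg + 1) by lra.
have eps0 : 0 < eps by rewrite lt_min; apply/andP; split; [lra|exact: divr_gt0].
have epsb : eps <= 1 / 8 by rewrite ge_min lexx.
have epsc : eps * (64 * (Cg + 1)) <= kap.
  by rewrite -ler_pdivlMr// ge_min lexx orbT.
have [C C0 hC] := mixed_moment_block eta0 eps0.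
pose rho := (1 + del) * (1 + del) * rho0 + kap / 8.
exists Cg, ((1 + del) * Cm * C), eps, rho; split.
- by split => //; [lra|rewrite mulr_ge0// ltW].
- have : (1 + del) * (1 + del) <= 1 + 3 * del by rewrite /del; nra.
  rewrite /rho => h; split; last first.
    by rewrite addr_ge0// ?mulr_ge0//; lra.
  have : (1 + del) * (1 + del) * rho0 <= (1 + 3 * del) * rho0 by rewrite ler_wpM2r// ltW.
  by rewrite /del /kap in h *; nra.
- split; first exact: ltW.
  have h : (1 + del) * (1 + del) <= 1 + 3 * del by rewrite /del; nra.
  have h' : (1 + del) * (1 + del) * rho0 <= (1 + 3 * del) * rho0 by rewrite ler_wpM2r// ltW.
  have hr : rho <= 1 - 3 / 8 * kap by rewrite /rho /del /kap in h h' *; nra.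
  have he : (2 * eps) `^ (r / 2) <= 2 * eps.
    by apply: ge1r_powR; [apply/andP; split; lra|lra].
  have : Cg * (2 * eps) `^ (r / 2) <= Cg * (2 * eps) by rewrite ler_wpM2l// ltW.
  by nra.
move=> n m p n0 nE hp.
have mn : (m <= n)%N by rewrite nE leq_addl.
have hmix := hC n m p n0 mn hp.
set A := csum X 0 m; set B := csum X (m + p)%N%:Z m; set G := csum X m%:Z p.
rewrite -/A -/B in hmix.
have mA : measurable_fun setT A by exact: csum_meas.
have mB : measurable_fun setT B by exact: csum_meas.
have mG : measurable_fun setT G by exact: csum_meas.
have SE w : csum X 0 n w = (A w + B w) + G w.
  by rewrite nE !csumD add0r; rewrite /A /B /G; ring.
have iAr : integ P (fun w => `|A w| `^ r) by exact: csump_integ.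
have iBr : integ P (fun w => `|B w| `^ r) by exact: csump_integ.
have iGr : integ P (fun w => `|G w| `^ r) by exact: csump_integ.
have iSr : integ P (fun w => `|csum X 0 n w| `^ r) by exact: csump_integ.
have imix (U V : T -> R) : measurable_fun setT U -> measurable_fun setT V ->
    integ P (fun w => `|U w| `^ r) -> integ P (fun w => `|V w| `^ r) ->
    integ P (fun w => `|U w| * `|V w| `^ (r - 1)).
  move=> mU mV iU iV; apply: (@integ_le _ _ _ _ _ (fun w => 1 * `|V w| `^ r + 1 `^ (1 - r) * `|U w| `^ r)).
  - by apply: measurable_funM; [exact: measurableT_comp|exact: measurable_norm_powR].
  - by apply: integD; exact: integZ.
  - move=> w; rewrite [leLHS]ger0_norm ?mulr_ge0 ?powR_ge0//.
    rewrite [leRHS]ger0_norm ?addr_ge0 ?mulr_ge0 ?powR_ge0//.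
    exact: (@young_powR R r 1 `|U w| `|V w| r1 ltr01 (normr_ge0 _) (normr_ge0 _)).
have i1 := imix A B mA mB iAr iBr; have i2 := imix B A mB mA iBr iAr.
have iI : integ P (fun w => (1 + del) * (`|A w| `^ r + `|B w| `^ r) +
   Cm * (`|A w| * `|B w| `^ (r - 1) + `|B w| * `|A w| `^ (r - 1))).
  by apply: integD; apply: integZ; exact: integD.
have pt w : `|csum X 0 n w| `^ r <= (1 + del) * ((1 + del) * (`|A w| `^ r + `|B w| `^ r) +
   Cm * (`|A w| * `|B w| `^ (r - 1) + `|B w| * `|A w| `^ (r - 1))) + Cg * `|G w| `^ r.
  rewrite SE.
  apply: (@le_trans _ _ (((`|A w| + `|B w|) + `|G w|) `^ r)).
    apply: le_powR => //.
    by apply: le_trans (ler_normD _ _) _; rewrite lerD2r ler_normD.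
  have hAB : 0 <= `|A w| + `|B w| by exact: addr_ge0.
  apply: (le_trans (hg _ _ hAB (normr_ge0 _))).
  rewrite lerD2r ler_wpM2l//; last exact: hm.
  by rewrite addr_ge0// ltW.
have := Ex_le iSr (integD (integZ (1 + del) iI) (integZ Cg iGr)) pt.
rewrite ExD; [|exact: integZ|exact: integZ].
rewrite !ExZ// ExD; [|by apply: integZ; exact: integD|by apply: integZ; exact: integD].
rewrite !ExZ; [|exact: integD|exact: integD].
rewrite !ExD// /A /B /G !amomE -/A -/B -/(amom n) => h.
exact: (recursion_combine h hmix Cm0 del0 two0).
Qed.

End moment_recursion.

(** [m] is the integer part of [(1 - eps) n / 2] and the gap takes the rest, between [eps n] and
    [eps n + 2]; the condition [2 <= eps * n] absorbs the rounding. *)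
Lemma split_gap (R : realType) (eps : R) (n : nat) :
  0 < eps -> eps < 1 / 4 -> 2 <= eps * n%:R ->
  exists m p : nat, [/\ n = (m + p + m)%N, eps * n%:R <= p%:R,
    p%:R <= 2 * eps * n%:R, (m < n)%N & (p < n)%N] /\ m%:R <= n%:R / 2 :> R.
Proof.
move=> e0 e1 en2.
have N0 : 0 < n%:R :> R by rewrite -(pmulr_rgt0 _ e0); lra.
pose m := Num.truncn ((1 - eps) * n%:R / 2).
have hm0 : 0 <= (1 - eps) * n%:R / 2 by rewrite divr_ge0 ?mulr_ge0//; lra.
have hm1 : m%:R <= (1 - eps) * n%:R / 2 by rewrite /m truncn_le.
have hm2 : (1 - eps) * n%:R / 2 < m%:R + 1 by rewrite natr1 truncnS_gt.
have en0 : 0 < eps * n%:R by lra.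
have mn : (2 * m <= n)%N by rewrite -(ler_nat R) natrM; lra.
exists m, (n - 2 * m)%N.
have pE : (n - 2 * m)%N%:R = n%:R - 2 * m%:R :> R by rewrite natrB// natrM.
split; last by lra.
split.
- by rewrite addnAC addnn -mul2n subnKC.
- by rewrite pE; lra.
- by rewrite pE; lra.
- by rewrite -(ltr_nat R); lra.
- rewrite -(ltr_nat R) pE.
  have : eps * n%:R <= 1 / 4 * n%:R by rewrite ler_wpM2r; lra.
  lra.
Qed.

Lemma induction_combine (R : realType) (rho two eps C C2 K am ap z : R) :
  0 < two -> 0 <= rho -> 0 <= C -> 0 <= K -> 0 <= z ->
  am <= K * (z / two) -> ap <= K * (eps * z) ->
  C2 <= (1 - rho) / 2 * K -> C * eps + rho <= (1 + rho) / 2 ->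
  rho * two * am + C * ap + C2 * z <= K * z.
Proof.
move=> two0 rho0 C0 K0 z0 ham hap hC2 hC.
have h1 : rho * two * am <= rho * K * z.
  apply: (@le_trans _ _ (rho * two * (K * (z / two)))).
    by rewrite ler_wpM2l// mulr_ge0// ltW.
  by rewrite le_eqVlt; apply/orP; left; apply/eqP; field; rewrite gt_eqF.
have h2 : C * ap <= C * eps * (K * z).
  apply: (le_trans (ler_wpM2l C0 hap)).
  by rewrite le_eqVlt; apply/orP; left; apply/eqP; ring.
have h3 := ler_wpM2r z0 hC2.
have h4 := ler_wpM2r (mulr_ge0 K0 z0) hC.
lra.
Qed.

Section moment_bound.
Context (d : measure_display) (T : measurableType d) (R : realType).
Variables (P : probability T R) (X : int -> {RV P >-> R}).
Variables (C1 theta r q s2 : R).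
Hypothesis Xstat : stationary X.
Hypothesis Xassoc : positive_associated X.
Hypothesis X2 : sqinteg P (X 1).
Hypothesis C1_gt0 : 0 < C1.
Hypothesis theta_gt0 : 0 < theta.
Hypothesis var_le : forall l, varsum X l <= l%:R * s2.
Hypothesis cov_le : forall m p n,
  Cv P (csum X 0 m) (csum X (m + p)%N%:Z n) <= \sum_(j < n) tailb C1 theta (p + j).+1.
Hypothesis r_gt2 : 2 < r.
Hypothesis r_lt_q : r < q.
Hypothesis expo_le : q + (r - q) * (1 / 2 + theta / (r - 2)) <= r / 2.
Hypothesis Xq : integ P (fun w => `|cX X 0 w| `^ q).

Let a := amom X r.

(** Strong induction on [n]. The sum in [K] covers the [n] below [n0], where [eps * n] may be too
    small for the splitting; the other summand makes [C2] at most the fraction [(1 - rho) / 2] of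
    [K] that the contraction leaves free. *)
Lemma amom_bound : exists2 K : R, 0 <= K & forall n, a n <= K * n%:R `^ (r / 2).
Proof.
have [C [C2 [eps [rho [[e0 e1 C20] [r1 rho0] [C0 hC] step]]]]] :=
  recursion_step Xstat Xassoc X2 C1_gt0 theta_gt0 var_le cov_le r_gt2 r_lt_q expo_le Xq.
have h2r := r_gt2.
have r20 : 0 <= r / 2 by lra.
have rn0 : r != 0 by rewrite gt_eqF//; lra.
have r2n0 : r / 2 != 0 by rewrite gt_eqF//; lra.
have e1r : 0 < 1 - rho by lra.
have a0 n : 0 <= a n by exact: amom_ge0.
pose n0 := (Num.truncn (2 / eps)).+1.
pose K := \sum_(i < n0) a i + 2 * C2 / (1 - rho).
have hS : 0 <= \sum_(i < n0) a i by apply: sumr_ge0.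
have hD : 0 <= 2 * C2 / (1 - rho) by rewrite divr_ge0 ?mulr_ge0// ltW.
have K0 : 0 <= K by rewrite addr_ge0.
have KC : C2 <= (1 - rho) / 2 * K.
  have : (1 - rho) / 2 * (2 * C2 / (1 - rho)) <= (1 - rho) / 2 * K.
    by rewrite ler_wpM2l; [|lra|rewrite lerDr].
  by rewrite (_ : _ / 2 * _ = C2)//; field; lra.
exists K => //; elim/ltn_ind => n ih.
case: (posnP n) => [->|npos].
  rewrite powR0 ?mulr0//.
  rewrite /a /amom (_ : (fun w => _) = fun=> 0) ?Ex_cst//.
  by apply/funext => w; rewrite csum0 normr0 powR0.
have N0 : 0 < n%:R :> R by rewrite ltr0n.
have [nn0|nn0] := ltnP n n0.
  apply: (@le_trans _ _ K).
    rewrite /K (bigD1 (Ordinal nn0))//= -addrA lerDl addr_ge0//.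
    by apply: sumr_ge0 => i _.
  rewrite -[leLHS]mulr1 ler_wpM2l//.
  by rewrite -[leLHS](powRr0 n%:R) ler_powR ?ler1n.
have en2 : 2 <= eps * n%:R.
  rewrite mulrC -ler_pdivrMr// ltW// (lt_le_trans (truncnS_gt _))// ler_nat.
  exact: nn0.
have [m [p [[nE p1 p2 mlt pn] m2]]] := split_gap e0 e1 en2.
have p1' : eps * n%:R <= p.+1%:R by apply: (le_trans p1); rewrite ler_nat.
apply: (le_trans (step n m p npos nE p1')).
have hm : a m <= K * (n%:R `^ (r / 2) / 2 `^ (r / 2)).
  apply: (le_trans (ih _ mlt)); rewrite ler_wpM2l//.
  rewrite ler_pdivlMr ?powR_gt0// -powRM//.
  by apply: le_powR; [exact: r20|exact: mulr_ge0|rewrite -ler_pdivlMr].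
have hp : a p <= K * ((2 * eps) `^ (r / 2) * n%:R `^ (r / 2)).
  apply: (le_trans (ih _ pn)); rewrite ler_wpM2l//.
  rewrite -powRM// ?mulr_ge0 ?(ltW e0)//.
  exact: le_powR.
have T0 : 0 < 2 `^ (r / 2) :> R by rewrite powR_gt0.
by apply: induction_combine hm hp KC hC => //; exact: powR_ge0.
Qed.

Lemma csum_bound : exists2 K : R, 0 <= K & forall b n,
  Ex P (fun w => `|csum X b n w| `^ r) <= K * n%:R `^ (r / 2).
Proof.
have [K K0 hK] := amom_bound; exists K; first exact: K0.
move=> b n.
by rewrite (amomE _ Xstat X2); exact: hK.
Qed.

End moment_bound.

(** * The standard normal distribution *)

Section normal_integrals.
Context (R : realType).
Local Notation leb := (@lebesgue_measure R).
Implicit Types (m s x : R).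

(** The Radon-Nikodym derivative of the normal law agrees almost everywhere with [normal_pdf], both
    having the same integral over every measurable set. *)
Lemma ge0_integral_normal_prob m s (f : R -> \bar R) :
  measurable_fun setT f -> (forall x, 0 <= f x)%E ->
  (\int[normal_prob m s]_x f x = \int[leb]_x (f x * (normal_pdf m s x)%:E))%E.
Proof.
move=> mf f0.
have dom := normal_prob_dominates m s.
rewrite -(Radon_Nikodym_SigmaFinite.change_of_variables dom f0 measurableT mf).
have mh := measurable_int _ (Radon_Nikodym_SigmaFinite.f_integrable dom).
apply: ae_eq_integral => //.
- exact: emeasurable_funM.
- apply: emeasurable_funM => //; apply/measurable_EFinP; exact: measurable_normal_pdf.
- apply: ae_eqe_mul2l; apply: integral_ae_eq => //.
  + exact: Radon_Nikodym_SigmaFinite.f_integrable.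
  + by apply/measurable_EFinP; exact: measurable_normal_pdf.
  + by move=> E _ mE; rewrite -Radon_Nikodym_SigmaFinite.f_integral.
Qed.

Lemma normal_pdf1 m s x : s != 0 ->
  normal_pdf m s x = normal_peak s * expR (- (x - m) ^+ 2 / (s ^+ 2 *+ 2)).
Proof. by move=> s0; rewrite normal_pdfE. Qed.

Lemma normal_peakZ s : 0 < s -> s * normal_peak s = normal_peak (1 : R).
Proof.
move=> s0; rewrite /normal_peak expr1n mul1r.
rewrite -mulrnAr sqrtrM ?sqr_ge0// sqrtr_sqr gtr0_norm// invfM mulrA divff ?gt_eqF//.
by rewrite mul1r.
Qed.

Lemma normal_peakE s : 0 < s -> normal_peak s = normal_peak 1 / s.
Proof. by move=> s0; rewrite -(normal_peakZ s0) [s * _]mulrC mulfK// gt_eqF. Qed.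

Lemma ge0_integral_normal_scale m s (f : R -> R) : 0 < s -> continuous f ->
  (forall x, 0 <= f x) ->
  (\int[normal_prob m s]_x (f x)%:E = \int[normal_prob 0 1]_z (f (m + s * z)%R)%:E)%E.
Proof.
move=> s0 cf f0.
have mf : measurable_fun setT f by exact: continuous_measurable_fun.
have cF : continuous (fun z : R => m + s * z).
  by move=> z; apply: cvgD; [exact: cvg_cst|apply: cvgM; [exact: cvg_cst|exact: cvg_id]].
have cfF : continuous (fun z => f (m + s * z)).
  by move=> z; apply: continuous_comp; [exact: cF|exact: cf].
have mfE : measurable_fun setT (EFin \o f) by exact/measurable_EFinP.
have mfFE : measurable_fun setT (EFin \o (fun z => f (m + s * z))).
  by apply/measurable_EFinP; exact: continuous_measurable_fun.
rewrite (ge0_integral_normal_prob _ _ mfE); last by move=> x; rewrite lee_fin.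
rewrite (ge0_integral_normal_prob _ _ mfFE); last by move=> x; rewrite lee_fin.
pose F (z : R^o) := m + s * z.
have dF z : derivable F z 1 by [].
have F'E : F^`()%classic = cst s.
  apply/funext => z; rewrite /F derive1E deriveD// derive_cst add0r deriveM// derive_id derive_cst.
  by rewrite scaler0 addr0 scaler1.
under eq_integral do rewrite -EFinM.
rewrite (increasing_ge0_integration_by_substitutionT (F := F)
  (G := fun x => f x * normal_pdf m s x)); first last.
- by move=> x; rewrite mulr_ge0// normal_pdf_ge0.
- by move=> x; apply: cvgM; [exact: cf|apply: continuous_normal_pdf; rewrite gt_eqF].
- apply: cvg_comp (cvg_addrl m); apply: gt0_cvgMry => //; exact: cvg_id.
- apply: cvg_comp (cvg_addrl_Ny m); apply: gt0_cvgMrNy => //; exact: cvg_id.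
- exact: dF.
- by rewrite F'E; exact: is_cvg_cst.
- by rewrite F'E; exact: is_cvg_cst.
- by rewrite F'E => ?; exact: cvg_cst.
- by move=> x y xy; rewrite /F ltrD2l ltr_pM2l.
apply: eq_integral => z _; rewrite F'E -[RHS]EFinM; congr EFin.
transitivity (f (m + s * z) * normal_pdf m s (m + s * z) * s); first by [].
rewrite !normal_pdf1 ?gt_eqF ?oner_eq0//.
have -> : - (m + s * z - m) ^+ 2 / (s ^+ 2 *+ 2) = - (z - 0) ^+ 2 / (1 ^+ 2 *+ 2).
  by field; rewrite gt_eqF.
rewrite -(normal_peakZ s0); ring.
Qed.


(** Completing the square. With [Z] standard normal and [t] normal around [x + a Z], the joint
    density factors as the marginal density of [t] times the conditional density of [Z] given
    [t]. *)
Lemma normal_pdf_conv (a b x t z : R) : 0 < a -> 0 < b ->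
  let c := Num.sqrt (a ^+ 2 + b ^+ 2) in
  normal_pdf (x + a * z) b t * normal_pdf 0 1 z =
  normal_pdf x c t * normal_pdf (a * (t - x) / c ^+ 2) (b / c) z.
Proof.
move=> a0 b0 c.
have ab0 : 0 < a ^+ 2 + b ^+ 2 by rewrite addr_gt0// exprn_gt0.
have c0 : 0 < c by rewrite sqrtr_gt0.
have c2 : c ^+ 2 = a ^+ 2 + b ^+ 2 by rewrite sqr_sqrtr// ltW.
have bc0 : 0 < b / c by rewrite divr_gt0.
rewrite !normal_pdf1 ?gt_eqF//.
rewrite (normal_peakE b0) (normal_peakE c0) (normal_peakE bc0).
rewrite mulrACA -expRD [RHS]mulrACA -expRD; congr (_ * _).
  by field; rewrite !gt_eqF.
congr expR; rewrite expr_div_n c2; field.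
by rewrite !gt_eqF.
Qed.

(** Once the two integrations are exchanged, the conditional density integrates to 1 and the
    marginal, of variance [a ^ 2 + b ^ 2], remains. *)
Lemma ge0_normal_semigroup (a b x : R) (f : R -> R) : 0 < a -> 0 < b ->
  continuous f -> (forall y, 0 <= f y) ->
  (\int[normal_prob 0 1]_z \int[normal_prob 0 1]_z' (f (x + a * z + b * z')%R)%:E =
   \int[normal_prob 0 1]_w (f (x + Num.sqrt (a ^+ 2 + b ^+ 2) * w)%R)%:E)%E.
Proof.
move=> a0 b0 cf f0; set c := Num.sqrt _.
have ab0 : 0 < a ^+ 2 + b ^+ 2 by rewrite addr_gt0// exprn_gt0.
have c0 : 0 < c by rewrite sqrtr_gt0.
have mf : measurable_fun setT f by exact: continuous_measurable_fun.
have mfE : measurable_fun setT (EFin \o f) by exact/measurable_EFinP.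
have f0E y : (0 <= (EFin \o f) y)%E by rewrite lee_fin.
rewrite -(ge0_integral_normal_scale x c0 cf f0).
under eq_integral do rewrite -(ge0_integral_normal_scale _ b0 cf f0) (ge0_integral_normal_prob _ _ mfE f0E).
pose h (u : R * R) := f u.2 * normal_pdf (x + a * u.1) b u.2.
have hE : h = fun u => f u.2 * (normal_peak b *
    expR (- (u.2 - (x + a * u.1)) ^+ 2 / (b ^+ 2 *+ 2))).
  by apply/funext => u; rewrite /h normal_pdf1// gt_eqF.
have mh : measurable_fun setT h.
  rewrite hE; apply: measurable_funM; first exact: measurableT_comp.
  apply: measurable_funM => //; apply: measurableT_comp => //.
  apply: measurable_funM => //; apply: measurableT_comp => //.
  apply: measurable_funX; apply: measurable_funB => //.
  by apply: measurable_funD => //; exact: measurable_funM.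
have h0 u : 0 <= h u by rewrite /h mulr_ge0// normal_pdf_ge0.
have mhE : measurable_fun setT (EFin \o h) by exact/measurable_EFinP.
have h0E u : (0 <= (EFin \o h) u)%E by rewrite lee_fin.
rewrite [LHS]ge0_integral_normal_prob; last 2 first.
- have := @measurable_fun_fubini_tonelli_F _ _ _ _ R leb _ mhE h0E. by [].
- by move=> z; apply: integral_ge0 => t _; rewrite -EFinM lee_fin mulr_ge0// normal_pdf_ge0.
pose k (u : R * R) := (h u * normal_pdf 0 1 u.1)%:E.
have mk : measurable_fun setT k.
  apply/measurable_EFinP; apply: measurable_funM => //.
  by apply: measurableT_comp => //; exact: measurable_normal_pdf.
have k0 u : (0 <= k u)%E by rewrite lee_fin mulr_ge0// normal_pdf_ge0.
transitivity (\int[leb]_z \int[leb]_t k (z, t))%E.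
  apply: eq_integral => z _; rewrite -ge0_integralZr//.
  - by apply: emeasurable_funM => //; apply/measurable_EFinP; exact: measurable_normal_pdf.
  - by move=> t _; rewrite -EFinM lee_fin mulr_ge0// normal_pdf_ge0.
  - by rewrite lee_fin normal_pdf_ge0.
apply: (etrans (@fubini_tonelli _ _ _ _ R leb leb k mk k0)).
rewrite (ge0_integral_normal_prob _ _ mfE f0E).
apply: eq_integral => t _.
under eq_integral do rewrite /k /h /= -mulrA normal_pdf_conv// -/c mulrA EFinM.
rewrite ge0_integralZl//.
- by rewrite integral_normal_pdf mule1 EFinM.
- by apply/measurable_EFinP; exact: measurable_normal_pdf.
- by move=> z _; rewrite lee_fin normal_pdf_ge0.
- by rewrite lee_fin mulr_ge0// normal_pdf_ge0.
Qed.

End normal_integrals.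

Section normal_moments.
Context (R : realType).
Local Notation leb := (@lebesgue_measure R).
Local Notation N := (normal_prob (0 : R) 1).

Lemma ge0_integ_normal (f : R -> R) : measurable_fun setT f -> (forall x, 0 <= f x) ->
  (\int[N]_x (f x)%:E < +oo)%E -> integ N f.
Proof.
move=> mf f0 h; apply/integrableP; split; first exact/measurable_EFinP.
by under eq_integral do rewrite /= ger0_norm//.
Qed.

Let normal_mgf_int (t : R) : (\int[N]_x (expR (t * x))%:E = (expR (t ^+ 2 / 2))%:E)%E.
Proof.
have m : measurable_fun setT (fun x : R => expR (t * x)).
  by apply: measurableT_comp => //; exact: measurable_funM.
have mE : measurable_fun setT (EFin \o (fun x : R => expR (t * x))) by exact/measurable_EFinP.
rewrite (ge0_integral_normal_prob _ _ mE); last by move=> x; rewrite lee_fin expR_ge0.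
transitivity (\int[leb]_x ((expR (t ^+ 2 / 2))%:E * (normal_pdf t 1 x)%:E))%E; last first.
  rewrite ge0_integralZl//.
  - by rewrite integral_normal_pdf mule1.
  - by apply/measurable_EFinP; exact: measurable_normal_pdf.
  - by move=> z _; rewrite lee_fin normal_pdf_ge0.
apply: eq_integral => x _; rewrite /= -!EFinM; congr EFin.
rewrite !normal_pdf1 ?oner_eq0// [LHS]mulrCA [RHS]mulrCA -!expRD; congr (_ * expR _).
by field.
Qed.

Lemma normal_mgf_integ (t : R) : integ N (fun x => expR (t * x)).
Proof.
apply: ge0_integ_normal; last by rewrite normal_mgf_int ltry.
- by apply: measurableT_comp => //; exact: measurable_funM.
- by move=> x; exact: expR_ge0.
Qed.

Lemma normal_mgf (t : R) : Ex N (fun x => expR (t * x)) = expR (t ^+ 2 / 2).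
Proof. by rewrite /Ex /Rintegral normal_mgf_int. Qed.

(** Reduced to exponential moments by [|x| ^ k <= k! * (e ^ x + e ^ (- x))] for an integer
    [k >= p]. *)
Lemma normal_absmom_integ (p : R) : 0 <= p -> integ N (fun x => `|x| `^ p).
Proof.
move=> p0; pose k := (Num.truncn p).+1.
have pk : p <= k%:R by rewrite ltW// truncnS_gt.
have pw : integ N (fun x => `|x| `^ k%:R) -> integ N (fun x => `|x| `^ p).
  by move=> h; have := @integ_powR_le _ _ R N (fun x : R => x) p k%:R; apply.
apply: pw.
apply: (@integ_le _ _ R N _ (fun x : R => k`!%:R * (expR (1 * x) + expR (-1 * x)))).
- exact: measurable_norm_powR.
- by apply: integZ; apply: integD; exact: normal_mgf_integ.
- move=> x; rewrite [leLHS]ger0_norm ?powR_ge0// powR_mulrn//.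
  apply: le_trans (ler_norm _).
  have h := expR_ge1Dxn k.-1 (normr_ge0 x).
  have f0 : 0 < k`!%:R :> R by rewrite ltr0n fact_gt0.
  have {}h : `|x| ^+ k <= k`!%:R * expR `|x|.
    rewrite mulrC -ler_pdivrMr//; apply: le_trans h.
    by rewrite lerDr.
  apply: le_trans h _; rewrite ler_wpM2l ?(ltW f0)// mul1r mulN1r.
  by case: (ger0P x) => _; rewrite ?lerDl ?lerDr expR_ge0.
Qed.

Lemma normal_id_integ : integ N id.
Proof.
apply: (@integ_le _ _ R N _ (fun x : R => `|x| `^ 1)) => //.
  exact: normal_absmom_integ.
by move=> x; rewrite powRr1// normr_id.
Qed.

Lemma normal_sqr_integ : integ N (fun x => x ^+ 2).
Proof.
apply: (@integ_le _ _ R N _ (fun x : R => `|x| `^ 2)) => //.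
  exact: normal_absmom_integ.
by move=> x; rewrite powR_mulrn// [leRHS]ger0_norm ?exprn_ge0// normrX.
Qed.

Lemma expR_sqr_half_le (t : R) : `|t| <= 1 -> expR (t ^+ 2 / 2) <= 1 + t ^+ 2.
Proof.
move=> t1; have t2 : t ^+ 2 <= 1 by rewrite -(real_normK (num_real t)) exprn_ile1.
have t20 : 0 <= t ^+ 2 by exact: sqr_ge0.
have h := expR_ge1Dx (- (t ^+ 2 / 2)).
rewrite -[expR (t ^+ 2 / 2)]invrK -expRN.
have h0 : 0 < 1 - t ^+ 2 / 2 by lra.
apply: (@le_trans _ _ (1 - t ^+ 2 / 2)^-1); first by rewrite lef_pV2 ?posrE ?expR_gt0.
rewrite -div1r ler_pdivrMr//; nra.
Qed.

Lemma normal_mean : Ex N id = 0.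
Proof.
(* From [1 + t x <= e^(t x)] and [E e^(t N) = e^(t^2/2)]; let [t] tend to 0 on both sides. *)
have key (t : R) : `|t| <= 1 -> t * Ex N id <= t ^+ 2.
  move=> t1; have := expR_sqr_half_le t1; rewrite -normal_mgf => h.
  have : Ex N (fun x => 1 + t * x) <= Ex N (fun x => expR (t * x)).
    apply: Ex_le; [|exact: normal_mgf_integ|by move=> x; exact: expR_ge1Dx].
    by apply: integD; [exact: integ_cst|exact: integZ normal_id_integ].
  rewrite ExD; [|exact: integ_cst|exact: integZ normal_id_integ].
  rewrite Ex_cst (ExZ _ normal_id_integ); lra.
apply/eqP; rewrite eq_le; apply/andP; split.
  apply/ler_addgt0Pr => e e0; rewrite add0r.
  pose t := Num.min e 1; have t0 : 0 < t by rewrite lt_min e0 ltr01.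
  have := key t; rewrite gtr0_norm// ge_min lexx orbT => /(_ isT).
  rewrite expr2 ler_pM2l// => /le_trans; apply; by rewrite ge_min lexx.
rewrite -oppr_le0; apply/ler_addgt0Pr => e e0; rewrite add0r.
pose t := Num.min e 1; have t0 : 0 < t by rewrite lt_min e0 ltr01.
have := key (- t); rewrite normrN gtr0_norm// ge_min lexx orbT => /(_ isT).
rewrite sqrrN expr2 mulNr -mulrN ler_pM2l// => /le_trans; apply; by rewrite ge_min lexx.
Qed.

(** Multiplied by this exponential, the standard density becomes [s] times the centered normal
    density of variance [s ^ 2]. *)
Let normal_exp_sqr (s : R) : 0 < s ->
  (\int[N]_x (expR ((1 - s ^- 2) / 2 * x ^+ 2))%:E = s%:E)%E.
Proof.
move=> s0; set u := (1 - s ^- 2) / 2.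
have m : measurable_fun setT (fun x : R => expR (u * x ^+ 2)).
  by apply: measurableT_comp => //; apply: measurable_funM => //; exact: measurable_funX.
have mE : measurable_fun setT (EFin \o (fun x : R => expR (u * x ^+ 2))) by exact/measurable_EFinP.
rewrite (ge0_integral_normal_prob _ _ mE); last by move=> x; rewrite lee_fin expR_ge0.
transitivity (\int[leb]_x (s%:E * (normal_pdf 0 s x)%:E))%E; last first.
  rewrite ge0_integralZl//.
  - by rewrite integral_normal_pdf mule1.
  - by apply/measurable_EFinP; exact: measurable_normal_pdf.
  - by move=> z _; rewrite lee_fin normal_pdf_ge0.
  - by rewrite lee_fin ltW.
apply: eq_integral => x _; rewrite /= -!EFinM; congr EFin.
rewrite !normal_pdf1 ?oner_eq0 ?gt_eqF// [RHS]mulrA (normal_peakZ s0) [LHS]mulrCA -!expRD; congr (_ * expR _).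
by rewrite /u; field; rewrite gt_eqF.
Qed.

(** Taking expectations in [1 + u x ^ 2 <= e ^ (u x ^ 2)] with [u = (1 - s ^- 2) / 2] gives
    [u * v <= s - 1], where [v] is the second moment. Letting [s] tend to 1 from above and from
    below, where [u] changes sign, gives the two bounds on [v]. *)
Lemma normal_variance : Ex N (fun x => x ^+ 2) = 1.
Proof.
have key (s : R) : 0 < s -> (1 - s ^- 2) / 2 * Ex N (fun x => x ^+ 2) <= s - 1.
  move=> s0; set u := (1 - s ^- 2) / 2.
  have iE : integ N (fun x => expR (u * x ^+ 2)).
    apply: ge0_integ_normal; last by rewrite normal_exp_sqr// ltry.
      by apply: measurableT_comp => //; apply: measurable_funM => //; exact: measurable_funX.
    by move=> x; exact: expR_ge0.
  have : Ex N (fun x => 1 + u * x ^+ 2) <= Ex N (fun x => expR (u * x ^+ 2)).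
    apply: Ex_le; [|exact: iE|by move=> x; exact: expR_ge1Dx].
    by apply: integD; [exact: integ_cst|exact: integZ normal_sqr_integ].
  rewrite ExD; [|exact: integ_cst|exact: integZ normal_sqr_integ].
  rewrite Ex_cst (ExZ _ normal_sqr_integ) {2}/Ex /Rintegral normal_exp_sqr//=; lra.
set v := Ex _ _ in key *.
have key2 (s : R) : 0 < s -> (s ^+ 2 - 1) * v <= 2 * s ^+ 2 * (s - 1).
  move=> s0; have h := key s s0.
  have s20 : 0 <= 2 * s ^+ 2 by rewrite mulr_ge0// sqr_ge0.
  have := ler_wpM2l s20 h.
  by rewrite (_ : _ * (_ * v) = (s ^+ 2 - 1) * v)//; field; rewrite gt_eqF.
apply/eqP; rewrite eq_le; apply/andP; split.
  apply/ler_addgt0Pr => e e0.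
  pose t := Num.min (e / 4) 1; have t0 : 0 < t by rewrite lt_min ltr01 andbT; lra.
  have te : t <= e / 4 by rewrite ge_min lexx.
  have t1 : t <= 1 by rewrite ge_min lexx orbT.
  have := key2 (1 + t); rewrite (_ : 0 < 1 + t) ?addr_gt0// => /(_ isT).
  rewrite (_ : (_ - 1) * v = t * ((2 + t) * v)); last by ring.
  rewrite (_ : 2 * _ * _ = t * (2 * (1 + t) ^+ 2)); last by ring.
  rewrite ler_pM2l// => h; nra.
apply/ler_addgt0Pr => e e0.
have v0 : 0 <= v by apply: Ex_ge0 => x; exact: sqr_ge0.
pose t := Num.min (e / 4) (1 / 2); have t0 : 0 < t by rewrite lt_min; apply/andP; split; lra.
have te : t <= e / 4 by rewrite ge_min lexx.
have t1 : t <= 1 / 2 by rewrite ge_min lexx orbT.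
have := key2 (1 - t); rewrite (_ : 0 < 1 - t); last by lra.
move=> /(_ isT).
rewrite (_ : (_ - 1) * v = t * (- ((2 - t) * v))); last by ring.
rewrite (_ : 2 * _ * _ = t * (- (2 * (1 - t) ^+ 2))); last by ring.
rewrite ler_pM2l// lerN2 => h; nra.
Qed.

End normal_moments.

(** * Lindeberg replacement *)

(* [f1] and [f2] play the role of the first two derivatives of [f]; only the
   Taylor estimate of order [s] is required of them, so that the class is stable
   under convolution by a normal law without differentiating an integral. *)
Record smooth_test (R : realType) (B s : R) (f f1 f2 : R -> R) : Prop := SmoothTest {
  smooth_lip0 : lipschitz_real B f;
  smooth_lip1 : lipschitz_real B f1;
  smooth_lip2 : lipschitz_real B f2;
  smooth_bnd0 : forall x, `|f x| <= B;
  smooth_bnd1 : forall x, `|f1 x| <= B;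
  smooth_bnd2 : forall x, `|f2 x| <= B;
  smooth_taylor : forall x y,
    `|f (x + y) - f x - f1 x * y - f2 x * y ^+ 2 / 2| <= B * `|y| `^ s }.

Section average.
Context (d : measure_display) (T : measurableType d) (R : realType).
Variables (Q : probability T R) (Z : T -> R).
Hypothesis mZ : measurable_fun setT Z.

(** Convolution of [f] with the law of [c * Z]: the effect of adding an independent copy of [c * Z],
    expressed on the test function alone. *)
Definition avg (c : R) (f : R -> R) (x : R) : R := Ex Q (fun w => f (x + c * Z w)).

Lemma avg_integ L B c f x : lipschitz_real L f -> (forall x, `|f x| <= B) ->
  integ Q (fun w => f (x + c * Z w)).
Proof.
move=> lf bf; apply: (@integ_bounded _ _ _ _ _ B) => //.
apply: measurableT_comp; first exact: lipschitz_measurable lf.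
by apply: measurable_funD => //; exact: measurable_funM.
Qed.

Lemma avg_bnd L B c f : lipschitz_real L f -> (forall x, `|f x| <= B) ->
  forall x, `|avg c f x| <= B.
Proof. by move=> lf bf x; apply: Ex_norm_cst => //; exact: avg_integ lf bf. Qed.

Lemma avg_lipschitz L B c f : lipschitz_real L f -> (forall x, `|f x| <= B) ->
  lipschitz_real L (avg c f).
Proof.
move=> lf bf x y; have ix := avg_integ c x lf bf; have iy := avg_integ c y lf bf.
rewrite /avg -ExB//; apply: Ex_norm_cst; first exact: integB.
move=> w; apply: le_trans (lf _ _) _.
by rewrite opprD addrACA subrr addr0.
Qed.

Lemma avg0 f : avg 0 f = f.
Proof.
apply/funext => x; rewrite /avg -[RHS](Ex_cst Q).
by congr Ex; apply/funext => w; rewrite mul0r addr0.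
Qed.

(** Every condition is uniform in the base point, so averaging over translates keeps the same
    constant [B]. *)
Lemma smooth_avg B s c f f1 f2 : smooth_test B s f f1 f2 ->
  smooth_test B s (avg c f) (avg c f1) (avg c f2).
Proof.
move=> [l0 l1 l2 b0 b1 b2 ht]; split; try by [apply: avg_lipschitz; eassumption|apply: avg_bnd; eassumption].
move=> x y.
have i0 := avg_integ c x l0 b0; have i0' := avg_integ c (x + y) l0 b0.
have i1 := avg_integ c x l1 b1; have i2 := avg_integ c x l2 b2.
have -> : avg c f (x + y) - avg c f x - avg c f1 x * y - avg c f2 x * y ^+ 2 / 2 =
   Ex Q (fun w => f (x + y + c * Z w) - f (x + c * Z w) -
       y * f1 (x + c * Z w) - y ^+ 2 / 2 * f2 (x + c * Z w)).
  rewrite ExB; [|by apply: integB; [exact: integB|exact: integZ]|exact: integZ].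
  rewrite ExB; [|exact: integB|exact: integZ].
  rewrite ExB// !ExZ// /avg; ring.
apply: Ex_norm_cst.
  by apply: integB; [apply: integB; [exact: integB|exact: integZ]|exact: integZ].
move=> w; have := ht (x + c * Z w) y.
rewrite (_ : x + c * Z w + y = x + y + c * Z w); last by ring.
by rewrite (mulrC _ y) -mulrA (mulrC (f2 _)).
Qed.

Hypothesis Z2 : integ Q (fun w => Z w ^+ 2).
Hypothesis Z_mean : Ex Q Z = 0.
Hypothesis Z_var : Ex Q (fun w => Z w ^+ 2) = 1.

(** As [Z] has mean 0 and variance 1, the Taylor polynomial averages to [f x + h / 2 * f2 x]; only
    the remainder is left. *)
Lemma avg_taylor B s f f1 f2 (h x : R) : integ Q (fun w => `|Z w| `^ s) ->
  smooth_test B s f f1 f2 -> 0 <= h ->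
  `|avg (Num.sqrt h) f x - f x - h / 2 * f2 x| <=
  B * (h `^ (s / 2) * Ex Q (fun w => `|Z w| `^ s)).
Proof.
move=> iZs [l0 l1 l2 b0 b1 b2 ht] h0.
set c := Num.sqrt h; have c0 : 0 <= c by exact: sqrtr_ge0.
have c2 : c ^+ 2 = h by rewrite sqr_sqrtr.
have sZ : sqinteg Q Z by [].
have iZ := sqinteg_integ sZ.
have i0 := avg_integ c x l0 b0.
have i0' := integB i0 (integ_cst Q (f x)).
have i1 := integZ (c * f1 x) iZ; have i2 := integZ (h / 2 * f2 x) Z2.
have -> : avg c f x - f x - h / 2 * f2 x =
   Ex Q (fun w => f (x + c * Z w) - f x - c * f1 x * Z w - h / 2 * f2 x * Z w ^+ 2).
  rewrite ExB; [|exact: integB|by []].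
  rewrite ExB// ExB//; last exact: integ_cst.
  by rewrite !ExZ// Z_mean Z_var Ex_cst mulr0 mulr1 subr0.
rewrite -!ExZ//; last exact: integZ.
apply: Ex_norm_le.
- by apply: integB => //; exact: integB.
- by apply: integZ; exact: integZ.
- move=> w; have := ht x (c * Z w).
  have cs : c `^ s = h `^ (s / 2) by rewrite /c -powR12_sqrt// -powRrM mulrC.
  rewrite exprMn c2 normrM powRM// (ger0_norm c0) cs.
  rewrite (_ : f2 x * (h * Z w ^+ 2) / 2 = h / 2 * f2 x * Z w ^+ 2); last by ring.
  by rewrite (_ : f1 x * (c * Z w) = c * f1 x * Z w)//; ring.
Qed.

End average.

Lemma lindeberg_arith (R : realType) (B h Ef' Ef a b c e g t V M : R) : 0 <= B ->
  `|Ef' - Ef - a - 1 / 2 * (b + c)| <= B * M -> `|a| <= B * V ->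
  `|b - e * t| <= B * 2 * V -> `|c| <= B * M -> 0 <= g <= M -> `|e| <= B ->
  `|Ef' - Ef - h / 2 * e| <= 2 * B * V + 2 * B * M + B / 2 * `|t + g - h|.
Proof.
move=> B0 h1 h2 h3 h4 /andP[g0 gM] h6.
have h7 : `|e * g| <= B * M.
  by rewrite normrM (ger0_norm g0); apply: ler_pM.
have h8 : `|e * (t + g - h)| <= B * `|t + g - h|.
  by rewrite normrM ler_wpM2r.
have -> : Ef' - Ef - h / 2 * e = (Ef' - Ef - a - 1 / 2 * (b + c)) + a +
    (b - e * t) / 2 + c / 2 - (e * g) / 2 + (e * (t + g - h)) / 2 by field.
move: h1 h2 h3 h4 h7 h8; move: (Ef' - _ - _ - _) (b - _) (e * g) (e * (_ - _)) `|t + g - h|.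
move=> u1 u2 u3 u4 u5.
rewrite !ler_norml => /andP[? ?] /andP[? ?] /andP[? ?] /andP[? ?] /andP[? ?] /andP[? ?].
by apply/andP; split; lra.
Qed.

Section lindeberg_step.
Context (d : measure_display) (T : measurableType d) (R : realType).
Variables (P : probability T R) (A Y : T -> R).
Hypothesis AY : assoc_pair P A Y.
Hypothesis sA : sqinteg P A.
Hypothesis sY : sqinteg P Y.
Hypothesis Y0 : Ex P Y = 0.

(** Newman's inequality controls both Taylor terms. The first is a covariance because [Y] is
    centered. In the second, [Y ^ 2] is not Lipschitz and is replaced by the 2-Lipschitz
    [(min |Y| 1) ^ 2]; the difference is at most [|Y| ^ s] since [s >= 2]. *)
Lemma process_taylor B s f f1 f2 (h : R) : 2 <= s ->
  integ P (fun w => `|Y w| `^ s) -> smooth_test B s f f1 f2 ->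
  `|Ex P (fun w => f (A w + Y w)) - Ex P (fun w => f (A w)) -
    h / 2 * Ex P (fun w => f2 (A w))| <=
  2 * B * Cv P A Y + 2 * B * Ex P (fun w => `|Y w| `^ s) +
  B / 2 * `|Ex P (fun w => Y w ^+ 2) - h|.
Proof.
move=> s2 iYs [l0 l1 l2 b0 b1 b2 ht].
have B0 := lipschitz_ge0 l0.
have mf (g : R -> R) (V : T -> R) : lipschitz_real B g -> measurable_fun setT V ->
    measurable_fun setT (fun w => g (V w)).
  by move=> lg mV; apply: measurableT_comp => //; exact: lipschitz_measurable lg.
have mA := sA.1; have mY := sY.1.
have i0 : integ P (fun w => f (A w)) by apply: (@integ_bounded _ _ _ _ _ B) => //; exact: mf.
have i2 : integ P (fun w => f2 (A w)) by apply: (@integ_bounded _ _ _ _ _ B) => //; exact: mf.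
have i0' : integ P (fun w => f (A w + Y w)).
  by apply: (@integ_bounded _ _ _ _ _ B) => //; apply: mf => //; exact: measurable_funD.
have iY := sqinteg_integ sY.
have i1Y : integ P (fun w => f1 (A w) * Y w) by apply: (@integ_mulb _ _ _ _ _ _ B) => //; exact: mf.
have i2Y : integ P (fun w => f2 (A w) * Y w ^+ 2).
  by apply: (@integ_mulb _ _ _ _ _ _ B) => //; [exact: mf|exact: sY.2].
have lT := @lipschitz_trunc_powR R 2 1 2 ltac:(lra) ltac:(lra) ltr01.
set tr := fun y : R => _ in lT.
rewrite powR1 mulr1 in lT.
have sT := sqinteg_lipschitz lT sY; have iT := sqinteg_integ sT.
pose rest w := Y w ^+ 2 - tr (Y w).
have irest : integ P rest by apply: integB => //; exact: sY.2.
have rest_bnd w : 0 <= rest w <= `|Y w| `^ s.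
  rewrite /rest /tr -(real_normK (num_real (Y w))) -powR_mulrn//.
  case: (leP `|Y w| 1) => [h1|h1]; first by rewrite subrr lexx powR_ge0.
  rewrite powR1 subr_ge0; apply/andP; split.
    by have := ler_powR (ltW h1) (ler0n R 2); rewrite powRr0.
  by have := ler_powR (ltW h1) s2; lra.
have i2r : integ P (fun w => f2 (A w) * rest w) by apply: (@integ_mulb _ _ _ _ _ _ B) => //; exact: mf.
have lid : lipschitz_real 1 (fun y : R => y) by move=> x y; rewrite mul1r.
have hC1 := newman_ineq AY sA sY l1 lid.
have eC : Cv P (fun w => f1 (A w)) (fun w => Y w) = Ex P (fun w => f1 (A w) * Y w).
  by rewrite /Cv Y0 mulr0 subr0.
rewrite {}eC mulr1 in hC1.
have hC2 := newman_ineq AY sA sY l2 lT.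
have i2T : integ P (fun w => f2 (A w) * tr (Y w)) by apply: (@integ_mulb _ _ _ _ _ _ B) => //; exact: mf.
have e1 : Ex P (fun w => f2 (A w) * Y w ^+ 2) =
    Ex P (fun w => f2 (A w) * tr (Y w)) + Ex P (fun w => f2 (A w) * rest w).
  by rewrite -ExD//; congr Ex; apply/funext => w; rewrite /rest; ring.
have e2 : Ex P (fun w => Y w ^+ 2) = Ex P (fun w => tr (Y w)) + Ex P rest.
  by rewrite -ExD//; congr Ex; apply/funext => w; rewrite /rest; ring.
set M := Ex P (fun w => `|Y w| `^ s).
have rM : 0 <= Ex P rest <= M.
  apply/andP; split; first by apply: Ex_ge0 => w; case/andP: (rest_bnd w).
  by apply: Ex_le => // w; case/andP: (rest_bnd w).
have r2M : `|Ex P (fun w => f2 (A w) * rest w)| <= B * M.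
  rewrite /M -ExZ//; apply: Ex_norm_le => //; first exact: integZ.
  move=> w; have /andP[h1 h2] := rest_bnd w.
  by rewrite normrM (ger0_norm h1); apply: ler_pM.
have b2A : `|Ex P (fun w => f2 (A w))| <= B by exact: Ex_norm_cst.
have taylor : `|Ex P (fun w => f (A w + Y w)) - Ex P (fun w => f (A w)) -
    Ex P (fun w => f1 (A w) * Y w) - 1 / 2 * Ex P (fun w => f2 (A w) * Y w ^+ 2)| <= B * M.
  rewrite -ExZ// -ExB// -ExB//; last exact: integB.
  rewrite -ExB; [|by apply: integB => //; exact: integB|exact: integZ].
  rewrite /M -ExZ//; apply: Ex_norm_le.
  - by apply: integB; [apply: integB => //; exact: integB|exact: integZ].
  - exact: integZ.
  - move=> w; apply: le_trans (ht (A w) (Y w)).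
    by rewrite (_ : 1 / 2 * _ = f2 (A w) * Y w ^+ 2 / 2)//; field.
move: taylor hC1 hC2 r2M rM b2A; rewrite e1 e2 [Cv P (fun w => f2 (A w)) _]/Cv.
move: (Ex P (fun w => f (A w + Y w))) (Ex P (fun w => f (A w))) => Ef' Ef.
move: (Ex P (fun w => f1 (A w) * Y w)) (Ex P (fun w => f2 (A w) * tr (Y w))) => a b.
move: (Ex P (fun w => f2 (A w) * rest w)) (Ex P (fun w => f2 (A w))) (Ex P rest) => c e g.
move: (Ex P (fun w => tr (Y w))) (Cv P A Y) M => t V M.
exact: lindeberg_arith.
Qed.

End lindeberg_step.

Lemma lipschitz_continuous (R : realType) (L : R) (f : R -> R) :
  lipschitz_real L f -> continuous f.
Proof.
move=> lf x; apply/cvgrPdist_le => /= e e0.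
have L0 := lipschitz_ge0 lf.
near=> y; apply: (le_trans (lf x y)).
apply: (@le_trans _ _ ((L + 1) * `|x - y|)).
  by rewrite ler_wpM2r// lerDl.
rewrite mulrC -ler_pdivlMr; last by rewrite ltr_wpDl.
near: y; apply: cvgr_dist_le; first exact: cvg_id.
by rewrite divr_gt0// ltr_wpDl.
Unshelve. all: by end_near. Qed.

Section standard_normal.
Context (d : measure_display) (T : measurableType d) (R : realType).
Variables (Q : probability T R) (Z : {RV Q >-> R}).
Hypothesis Z_normal : forall A : set R, measurable A ->
    distribution Q Z A = normal_prob 0 1 A.
Local Notation N := (normal_prob (0 : R) 1).

Let mZ : measurable_fun setT Z. Proof. exact: measurable_funP. Qed.

Let ZN A : measurable A -> N (idfun @^-1` A) = Q (Z @^-1` A).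
Proof. by move=> mA; rewrite preimage_id -Z_normal. Qed.

Lemma standard_normal_Ex (h : R -> R) : measurable_fun setT h ->
  Ex Q (fun w => h (Z w)) = Ex N h.
Proof.
by move=> mh; exact: esym (@eq_dist_Ex _ _ _ _ _ _ _ N Q idfun Z (@measurable_id _ _ setT) mZ ZN h mh).
Qed.

Lemma standard_normal_integ (h : R -> R) : measurable_fun setT h ->
  integ N h -> integ Q (fun w => h (Z w)).
Proof.
by move=> mh; exact: (@eq_dist_integ _ _ _ _ _ _ _ N Q idfun Z (@measurable_id _ _ setT) mZ ZN h mh).
Qed.

Lemma standard_normal_mean : Ex Q Z = 0.
Proof. by rewrite (@standard_normal_Ex id)// normal_mean. Qed.

Lemma standard_normal_var : Ex Q (fun w => Z w ^+ 2) = 1.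
Proof. by rewrite (@standard_normal_Ex (fun x => x ^+ 2))// normal_variance. Qed.

Lemma standard_normal_absmom p : 0 <= p -> integ Q (fun w => `|Z w| `^ p).
Proof.
move=> p0; apply: (@standard_normal_integ (fun x => `|x| `^ p)).
  exact: measurable_norm_powR.
exact: normal_absmom_integ.
Qed.

Lemma standard_normal_sq : integ Q (fun w => Z w ^+ 2).
Proof. by apply: (@standard_normal_integ (fun x => x ^+ 2)) => //; exact: normal_sqr_integ. Qed.

(** The case [b = 0] arises when the last replacement uses up the whole variance. *)
Lemma normal_semigroup L B a b f x : lipschitz_real L f -> (forall y, 0 <= f y <= B) ->
  0 < a -> 0 <= b ->
  avg Q Z a (avg Q Z b f) x = avg Q Z (Num.sqrt (a ^+ 2 + b ^+ 2)) f x.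
Proof.
move=> lf f0B a0; rewrite le_eqVlt => /predU1P[<-|b0].
  by rewrite avg0 expr0n addr0 sqrtr_sqr gtr0_norm.
have f0 y : 0 <= f y by case/andP: (f0B y).
have fB y : `|f y| <= B by rewrite ger0_norm//; case/andP: (f0B y).
have aff c y : measurable_fun setT (fun z : R => f (y + c * z)).
  apply: (measurableT_comp (lipschitz_measurable lf)).
  by apply: measurable_funD => //; exact: measurable_funM.
have E c y : avg Q Z c f y = Ex N (fun z => f (y + c * z)).
  exact: (standard_normal_Ex (aff c y)).
have iN c y : integ N (fun z => f (y + c * z)) by exact: (@integ_bounded _ _ R N _ B (aff c y) (fun z => fB (y + c * z))).
have lb := avg_lipschitz Q mZ b lf fB.
have mavg : measurable_fun setT (fun z => avg Q Z b f (x + a * z)).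
  apply: (measurableT_comp (lipschitz_measurable lb)).
  by apply: measurable_funD => //; exact: measurable_funM.
rewrite E /avg (standard_normal_Ex mavg) /Ex /Rintegral; congr fine.
rewrite -(ge0_normal_semigroup x a0 b0 (lipschitz_continuous lf) f0).
apply: eq_integral => z _; rewrite E /Ex /Rintegral fineK//.
exact: (integrable_fin_num measurableT (iN _ _)).
Qed.

End standard_normal.

Lemma lindeberg_combine (R : realType) (B x y z g c u v t1 t2 t3 : R) :
  `|x - y - z| <= 2 * B * c + 2 * B * u + B / 2 * v -> `|g - y - z| <= t3 ->
  B * c <= B * t1 -> B * u <= B * t2 -> B * v <= B * (2 * t1) ->
  `|x - g| <= 3 * B * t1 + 2 * B * t2 + t3.
Proof.
rewrite !ler_norml => /andP[? ?] /andP[? ?] ? ? ?.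
by apply/andP; split; lra.
Qed.

Lemma clt_combine (R : realType) (x y z g b D E h : R) :
  `|x - y| <= b * h -> `|z - y| <= b * h -> `|z - g| <= D -> D <= E ->
  `|x - g| <= E + 2 * b * h.
Proof.
rewrite !ler_norml => /andP[? ?] /andP[? ?] /andP[? ?] ?.
by apply/andP; split; lra.
Qed.

Lemma telescope_combine (R : realType) (x y z D j : R) :
  `|y - z| <= j * D -> `|x - y| <= D -> `|x - z| <= (j + 1) * D.
Proof.
rewrite !ler_norml => /andP[? ?] /andP[? ?].
by apply/andP; split; lra.
Qed.

Lemma powR_small (R : realType) (C p eps : R) : 0 < p -> 0 < eps ->
  exists2 h0 : R, 0 < h0 & forall h, 0 < h -> h <= h0 -> C * h `^ p <= eps.
Proof.
move=> p0 e0; pose c := `|C| + 1; have c0 : 0 < c by rewrite ltr_wpDl.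
have ec : 0 < eps / c by rewrite divr_gt0.
exists ((eps / c) `^ p^-1); first exact: powR_gt0.
move=> h h0 hh.
have : h `^ p <= eps / c.
  apply: (@le_trans _ _ (((eps / c) `^ p^-1) `^ p)).
    by apply: le_powR => //; exact: ltW.
  by rewrite -powRrM mulVf ?gt_eqF// powRr1// ltW.
rewrite ler_pdivlMr// mulrC; apply: le_trans.
by rewrite ler_wpM2r ?powR_ge0//; have := ler_norm C; rewrite /c; lra.
Qed.

(** * The central limit theorem for smooth test functions *)

Section clt.
Context (d : measure_display) (T : measurableType d) (R : realType).
Variables (P : probability T R) (X : int -> {RV P >-> R}).
Context (d' : measure_display) (T' : measurableType d').
Variables (Q : probability T' R) (Z : {RV Q >-> R}).
Hypothesis Z_normal : forall A : set R, measurable A ->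
    distribution Q Z A = normal_prob 0 1 A.
Variables (C1 theta s K s2 : R).
Hypothesis Xstat : stationary X.
Hypothesis Xassoc : positive_associated X.
Hypothesis X2 : sqinteg P (X 1).
Hypothesis s2_gt0 : 0 < s2.
Hypothesis var_le : forall l, varsum X l <= l%:R * s2.
Hypothesis var_ge : forall l, l%:R * s2 - 2 * tailsum C1 theta l <= varsum X l.
Hypothesis cov_le : forall m l,
  Cv P (csum X 0 m) (csum X m%:Z l) <= tailsum C1 theta l.
Hypothesis tail_small : forall eps : R, 0 < eps ->
  exists l0 : nat, forall l, (l0 <= l)%N -> tailsum C1 theta l <= eps * l%:R.
Hypothesis s_gt2 : 2 < s.
Hypothesis mom_int : forall a n, integ P (fun w => `|csum X a n w| `^ s).
Hypothesis mom_le : forall a n, Ex P (fun w => `|csum X a n w| `^ s) <= K * n%:R `^ (s / 2).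

Let mZ : measurable_fun setT Z. Proof. exact: measurable_funP. Qed.
Let Ms := Ex Q (fun w => `|Z w| `^ s).

(** The block and its normal substitute have Taylor expansions with the same term
    [h / 2 * E (f2 A)], which cancels. What remains is the covariance with the past and the variance
    defect, both measured by [tailsum], and the two moments of order [s]. *)
Lemma lindeberg_block B f f1 f2 (kap h : R) (l m : nat) : 0 <= kap -> 0 < h ->
  h = kap ^+ 2 * (l%:R * s2) -> smooth_test B s f f1 f2 ->
  `|Ex P (fun w => f (kap * csum X 0 (m + l) w)) -
    Ex P (fun w => avg Q Z (Num.sqrt h) f (kap * csum X 0 m w))| <=
  3 * B * (kap ^+ 2 * tailsum C1 theta l) + 2 * B * (kap `^ s * (K * l%:R `^ (s / 2))) +
  B * (h `^ (s / 2) * Ms).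
Proof.
move=> kap0 h0 hE sm; have s2' := s_gt2.
have B0 : 0 <= B by exact: lipschitz_ge0 (smooth_lip0 sm).
set A := fun w => kap * csum X 0 m w.
set Y := fun w => kap * csum X m%:Z l w.
have sS a n : sqinteg P (csum X a n) by exact: csum_sqinteg.
have sA : sqinteg P A by exact: sqintegZ.
have sY : sqinteg P Y by exact: sqintegZ.
have AY : assoc_pair P A Y.
  by apply: assoc_pair_scale => //; exact: csum_assoc.
have Y0 : Ex P Y = 0 by rewrite ExZ ?Ex_csum ?mulr0//; exact: sqinteg_integ.
have Yp w : `|Y w| `^ s = kap `^ s * `|csum X m%:Z l w| `^ s.
  by rewrite /Y normrM (ger0_norm kap0) powRM.
have iYs : integ P (fun w => `|Y w| `^ s).
  by rewrite (_ : (fun w => _) = fun w => kap `^ s * `|csum X m%:Z l w| `^ s); [exact: integZ|exact/funext].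
have EYs : Ex P (fun w => `|Y w| `^ s) <= kap `^ s * (K * l%:R `^ (s / 2)).
  rewrite (_ : (fun w => _) = fun w => kap `^ s * `|csum X m%:Z l w| `^ s); last exact/funext.
  by rewrite ExZ// ler_wpM2l ?powR_ge0.
have EY2 : Ex P (fun w => Y w ^+ 2) = kap ^+ 2 * varsum X l.
  rewrite (_ : (fun w => _) = fun w => kap ^+ 2 * csum X m%:Z l w ^+ 2); last first.
    by apply/funext => w; rewrite exprMn.
  by rewrite ExZ ?(csum_sq Xstat X2)//; exact: (sS _ _).2.
have k20 : 0 <= kap ^+ 2 by exact: sqr_ge0.
have dEY2 : `|Ex P (fun w => Y w ^+ 2) - h| <= 2 * (kap ^+ 2 * tailsum C1 theta l).
  rewrite mulrCA EY2 hE -mulrBr normrM (ger0_norm k20) ler_wpM2l//.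
  by have := var_le l; have := var_ge l; rewrite ler_norml => *; apply/andP; split; lra.
have hCv : Cv P A Y <= kap ^+ 2 * tailsum C1 theta l.
  by rewrite CvZl// CvZr// mulrA -expr2 ler_wpM2l.
have st := process_taylor AY sA sY Y0 h (ltW s2') iYs sm.
have iZs : integ Q (fun w => `|Z w| `^ s) by apply: (standard_normal_absmom Z_normal); lra.
have sm' := smooth_avg Q mZ (Num.sqrt h) sm.
have mlip (g : R -> R) : lipschitz_real B g -> measurable_fun setT (fun w => g (A w)).
  by move=> lg; apply: measurableT_comp; [exact: lipschitz_measurable lg|exact: sA.1].
have ia : integ P (fun w => avg Q Z (Num.sqrt h) f (A w)).
  by apply: (@integ_bounded _ _ _ _ _ B); [exact: mlip (smooth_lip0 sm')|move=> w; exact: (smooth_bnd0 sm')].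
have i0 : integ P (fun w => f (A w)).
  by apply: (@integ_bounded _ _ _ _ _ B); [exact: mlip (smooth_lip0 sm)|move=> w; exact: (smooth_bnd0 sm)].
have i2 : integ P (fun w => f2 (A w)).
  by apply: (@integ_bounded _ _ _ _ _ B); [exact: mlip (smooth_lip2 sm)|move=> w; exact: (smooth_bnd2 sm)].
have gt : `|Ex P (fun w => avg Q Z (Num.sqrt h) f (A w)) - Ex P (fun w => f (A w)) -
    h / 2 * Ex P (fun w => f2 (A w))| <= B * (h `^ (s / 2) * Ms).
  rewrite -ExZ// -ExB// -ExB//; [|exact: integB|exact: integZ].
  apply: Ex_norm_cst; first by apply: integB; [exact: integB|exact: integZ].
  move=> w; apply: (avg_taylor mZ (standard_normal_sq Z_normal)
    (standard_normal_mean Z_normal) (standard_normal_var Z_normal) _ iZs sm).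
  exact: ltW.
have -> : (fun w => f (kap * csum X 0 (m + l) w)) = fun w => f (A w + Y w).
  by apply/funext => w; rewrite csumD add0r mulrDr.
have b1 := ler_wpM2l B0 hCv; have b2 := ler_wpM2l B0 EYs; have b3 := ler_wpM2l B0 dEY2.
exact: lindeberg_combine st gt b1 b2 b3.
Qed.

Lemma csum_L1_le a n : Ex P (fun w => `|csum X a n w|) <= Num.sqrt (n%:R * s2).
Proof.
have h := Ex_sq_le (csum_sqinteg Xstat X2 a n).1 (csum_sqinteg Xstat X2 a n).2.
rewrite (csum_sq Xstat X2) in h.
rewrite -[leLHS]ger0_norm; last by apply: Ex_ge0.
by rewrite -sqrtr_sqr; apply: ler_wsqrtr; apply: le_trans h (var_le n).
Qed.

(** After [j] blocks the normal part still has variance [1 - j h]. By the semigroup property that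
    average is the [sqrt h] average of the next one, which is again a smooth test function with the
    same [B], so all steps have the same error. *)
Lemma lindeberg_telescope B f f1 f2 (kap h : R) (l j : nat) : 0 <= kap -> 0 < h ->
  h = kap ^+ 2 * (l%:R * s2) -> smooth_test B s f f1 f2 -> (forall y, 0 <= f y) ->
  j%:R * h <= 1 ->
  `|Ex P (fun w => avg Q Z (Num.sqrt (1 - j%:R * h)) f (kap * csum X 0 (j * l) w)) -
    avg Q Z 1 f 0| <=
  j%:R * (3 * B * (kap ^+ 2 * tailsum C1 theta l) + 2 * B * (kap `^ s * (K * l%:R `^ (s / 2))) +
  B * (h `^ (s / 2) * Ms)).
Proof.
move=> kap0 h0 hE sm f0.
elim: j => [|j ih] jh.
  rewrite !mul0r subr0 sqrtr1 mul0n (_ : (fun w => _) = fun=> avg Q Z 1 f 0).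
    by rewrite Ex_cst subrr normr0.
  by apply/funext => w; rewrite csum0 mulr0.
rewrite -natr1 in jh *.
have jh' : j%:R * h <= 1 by lra.
set c := Num.sqrt (1 - (j%:R + 1) * h).
have c0 : 0 <= c by exact: sqrtr_ge0.
have smc := smooth_avg Q mZ c sm.
have := lindeberg_block (j * l)%N kap0 h0 hE smc.
rewrite -mulSnr.
have -> : avg Q Z (Num.sqrt h) (avg Q Z c f) = avg Q Z (Num.sqrt (1 - j%:R * h)) f.
  apply/funext => x.
  have sh0 : 0 < Num.sqrt h by rewrite sqrtr_gt0.
  rewrite (@normal_semigroup _ _ _ Q Z Z_normal B B _ _ _ _ (smooth_lip0 sm) _ sh0 c0); last first.
    by move=> y; rewrite f0; have := smooth_bnd0 sm y; rewrite ger0_norm.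
  rewrite !sqr_sqrtr ?(ltW h0)//; last by lra.
  by congr (avg Q Z (Num.sqrt _) f x); ring.
have {}ih := ih jh'.
by move=> st; exact: telescope_combine ih st.
Qed.

(** [h = l / n] is the share of variance of one block, so there are at most [1 / h] blocks and the
    block errors add up to at most [h^-1] times one of them. The [q < l] leftover variables and the
    normal part of variance [q / n] still present each cost at most [B * sqrt h]. *)
Lemma clt_error B f f1 f2 (l n : nat) (h : R) : (0 < l)%N -> (0 < n)%N ->
  smooth_test B s f f1 f2 -> (forall y, 0 <= f y) ->
  h = l%:R / n%:R ->
  `|Ex P (fun w => f ((Num.sqrt n%:R * Num.sqrt s2)^-1 * csum X 0 n w)) -
    Ex Q (fun w => f (Z w))| <=
  3 * B / s2 * (tailsum C1 theta l / l%:R) +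
  B * (2 * s2 `^ (- (s / 2)) * K + Ms) * h `^ (s / 2 - 1) + 2 * B * Num.sqrt h.
Proof.
move=> l0 n0 sm f0 hdef; have s2' := s_gt2.
have B0 : 0 <= B by exact: lipschitz_ge0 (smooth_lip0 sm).
have N0 : 0 < n%:R :> R by rewrite ltr0n.
have L0 : 0 < l%:R :> R by rewrite ltr0n.
have h0 : 0 < h by rewrite hdef divr_gt0.
set kap := (_ * _)^-1.
have kap0 : 0 <= kap by rewrite invr_ge0 mulr_ge0 ?sqrtr_ge0.
have k2 : kap ^+ 2 = (n%:R * s2)^-1.
  by rewrite exprVn exprMn !sqr_sqrtr// ltW.
have hE : h = kap ^+ 2 * (l%:R * s2).
  by rewrite k2 hdef; field; rewrite (gt_eqF N0) gt_eqF.
pose m := (n %/ l)%N; pose q := (n %% l)%N.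
have nE : n = (m * l + q)%N by exact: divn_eq.
have ql : q%:R <= l%:R :> R by rewrite ler_nat ltnW// ltn_mod.
have nER : n%:R = m%:R * l%:R + q%:R :> R by rewrite [in LHS]nE natrD natrM.
have mh : 1 - m%:R * h = q%:R / n%:R.
  by rewrite hdef [X in _ * (_ / X)]nER [in RHS]nER; field; rewrite -nER gt_eqF.
have qn0 : 0 <= q%:R / n%:R :> R by rewrite divr_ge0.
have qh : q%:R / n%:R <= h by rewrite hdef ler_wpM2r// invr_ge0.
have mh1 : m%:R * h <= 1 by lra.
have tel := lindeberg_telescope kap0 h0 hE sm f0 mh1.
set D := (X in _ <= _ * X) in tel.
have mD : m%:R * D <= 3 * B / s2 * (tailsum C1 theta l / l%:R) +
    B * (2 * s2 `^ (- (s / 2)) * K + Ms) * h `^ (s / 2 - 1).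
  have D0 : 0 <= D.
    have K0 : 0 <= K * l%:R `^ (s / 2).
      by apply: le_trans (mom_le 0 l); apply: Ex_ge0 => w; exact: powR_ge0.
    have Ms0 : 0 <= Ms by apply: Ex_ge0 => w; exact: powR_ge0.
    have t0 : 0 <= tailsum C1 theta l.
      apply: le_trans (cov_le 0 l).
      have := @csum_assoc _ _ _ P X Xassoc 0 0 0%N%:Z l id id.
      by apply => //; exact: csum_sqinteg.
    have B2 : 0 <= 2 * B by exact: mulr_ge0.
    have B3 : 0 <= 3 * B by exact: mulr_ge0.
    rewrite /D; apply: addr_ge0; [apply: addr_ge0|].
    - by apply: mulr_ge0 => //; apply: mulr_ge0 => //; exact: sqr_ge0.
    - by apply: mulr_ge0 => //; apply: mulr_ge0 => //; exact: powR_ge0.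
    - by apply: mulr_ge0 => //; apply: mulr_ge0 => //; exact: powR_ge0.
  apply: (@le_trans _ _ (h^-1 * D)).
    by rewrite ler_wpM2r// -[leRHS]mul1r ler_pdivlMr.
  have hs : h `^ (s / 2) = h * h `^ (s / 2 - 1) by rewrite mulr_powRB1 ?(ltW h0)//; lra.
  have ks : kap `^ s * l%:R `^ (s / 2) = s2 `^ (- (s / 2)) * h `^ (s / 2).
    have -> : kap = ((n%:R * s2)^-1) `^ 2^-1.
      by rewrite -k2 powR12_sqrt ?sqr_ge0// sqrtr_sqr ger0_norm.
    rewrite -powRrM [2^-1 * s]mulrC -powRM ?invr_ge0 ?mulr_ge0 ?(ltW s2_gt0)//.
    have -> : s2 `^ (- (s / 2)) = s2^-1 `^ (s / 2).
      have -> : s2^-1 = s2 `^ (-1) by rewrite powR_inv1// ltW.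
      by rewrite -powRrM mulN1r.
    rewrite -powRM ?invr_ge0 ?(ltW s2_gt0) ?(ltW h0)//.
    by congr powR; rewrite hdef; field; rewrite !gt_eqF.
  have -> : D = 3 * B * (kap ^+ 2 * tailsum C1 theta l) +
     2 * B * K * (kap `^ s * l%:R `^ (s / 2)) + B * (h `^ (s / 2) * Ms).
    by rewrite /D; ring.
  rewrite ks hs k2 le_eqVlt; apply/orP; left; apply/eqP.
  move: (s2 `^ _) (_ `^ (s / 2 - 1)) => x y.
  by rewrite hdef; field; rewrite !gt_eqF.
have e0 : avg Q Z 1 f 0 = Ex Q (fun w => f (Z w)).
  by rewrite /avg; congr Ex; apply/funext => w; rewrite add0r mul1r.
rewrite {}e0 mh in tel.
set A := fun w => kap * csum X 0 (m * l) w.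
have sA : sqinteg P A by apply: sqintegZ; exact: csum_sqinteg.
set V := fun w => kap * csum X (m * l)%N%:Z q w.
have sV : sqinteg P V by apply: sqintegZ; exact: csum_sqinteg.
have SE : (fun w => f (kap * csum X 0 n w)) = fun w => f (A w + V w).
  by apply/funext => w; rewrite {1}nE csumD add0r mulrDr.
rewrite SE.
have iAV : integ P (fun w => f (A w + V w)).
  apply: (@integ_bounded _ _ _ _ _ B); last by move=> w; exact: (smooth_bnd0 sm).
  apply: measurableT_comp; first exact: lipschitz_measurable (smooth_lip0 sm).
  by apply: measurable_funD; [exact: sA.1|exact: sV.1].
have iA : integ P (fun w => f (A w)).
  apply: (@integ_bounded _ _ _ _ _ B); last by move=> w; exact: (smooth_bnd0 sm).
  by apply: measurableT_comp; [exact: lipschitz_measurable (smooth_lip0 sm)|exact: sA.1].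
set c := Num.sqrt (q%:R / n%:R) in tel.
have cle : c <= Num.sqrt h by exact: ler_wsqrtr.
have c0 : 0 <= c by exact: sqrtr_ge0.
have smc := smooth_avg Q mZ c sm.
have icA : integ P (fun w => avg Q Z c f (A w)).
  apply: (@integ_bounded _ _ _ _ _ B); last by move=> w; exact: (smooth_bnd0 smc).
  by apply: measurableT_comp; [exact: lipschitz_measurable (smooth_lip0 smc)|exact: sA.1].
have r1 : `|Ex P (fun w => f (A w + V w)) - Ex P (fun w => f (A w))| <= B * Num.sqrt h.
  rewrite -ExB//; apply: (@le_trans _ _ (Ex P (fun w => B * `|V w|))).
    apply: Ex_norm_le; [exact: integB|by apply: integZ; apply: integ_norm; exact: sqinteg_integ|].
    move=> w; apply: le_trans (smooth_lip0 sm _ _) _.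
    by rewrite addrC addKr.
  rewrite ExZ; last by apply: integ_norm; exact: sqinteg_integ.
  rewrite ler_wpM2l//; apply: le_trans cle.
  have -> : (fun w => `|V w|) = fun w => kap * `|csum X (m * l)%N%:Z q w|.
    by apply/funext => w; rewrite /V normrM (ger0_norm kap0).
  rewrite ExZ; last by apply: integ_norm; apply: sqinteg_integ; exact: csum_sqinteg.
  apply: (le_trans (ler_wpM2l kap0 (csum_L1_le _ _))).
  rewrite -{1}(ger0_norm kap0) -sqrtr_sqr -sqrtrM ?sqr_ge0// k2 /c.
  apply: ler_wsqrtr; rewrite le_eqVlt; apply/orP; left; apply/eqP.
  by field; rewrite !gt_eqF.
have r2 : `|Ex P (fun w => avg Q Z c f (A w)) - Ex P (fun w => f (A w))| <= B * Num.sqrt h.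
  rewrite -ExB//; apply: Ex_norm_cst; first exact: integB.
  move=> w.
  have iZ : sqinteg Q Z by split; [exact: mZ|exact: standard_normal_sq Z_normal].
  have iaf := avg_integ Q mZ c (A w) (smooth_lip0 sm) (smooth_bnd0 sm).
  rewrite /avg -[X in _ - X](Ex_cst Q) -ExB//; last exact: integ_cst.
  apply: (@le_trans _ _ (Ex Q (fun u => (B * c) * `|Z u|))).
    apply: Ex_norm_le.
    - by apply: integB => //; exact: integ_cst.
    - by apply: integZ; apply: integ_norm; exact: sqinteg_integ.
    - move=> u; apply: le_trans (smooth_lip0 sm _ _) _.
      by rewrite (addrC (A w)) addrK normrM (ger0_norm c0) mulrA.
  rewrite ExZ; last by apply: integ_norm; exact: sqinteg_integ.
  have EZ1 : Ex Q (fun u => `|Z u|) <= 1.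
    have := Ex_sq_le mZ iZ.2; rewrite (standard_normal_var Z_normal) => H.
    have H0 : 0 <= Ex Q (fun u => `|Z u|) by apply: Ex_ge0.
    by rewrite -(@ler_pXn2r _ 2) ?nnegrE// expr1n.
  apply: (@le_trans _ _ (B * c)); first by rewrite ler_piMr// mulr_ge0.
  by rewrite ler_wpM2l.
move: r1 r2 tel mD.
exact: clt_combine.
Qed.

(** The order of the choices matters: [l] makes [tailsum l / l] small, and only then is [n] taken
    large, so that [h = l / n] is small for this fixed [l]. *)
Lemma clt_limit B f f1 f2 (eps : R) : smooth_test B s f f1 f2 ->
  (forall y, 0 <= f y) -> 0 < eps -> exists n0 : nat, forall n, (n0 <= n)%N ->
  `|Ex P (fun w => f ((Num.sqrt n%:R * Num.sqrt s2)^-1 * csum X 0 n w)) -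
    Ex Q (fun w => f (Z w))| <= eps.
Proof.
move=> sm f0 e0; have s2' := s_gt2.
have B0 : 0 <= B by exact: lipschitz_ge0 (smooth_lip0 sm).
have e30 : 0 < eps / 3 by rewrite divr_gt0.
pose D := 3 * B / s2.
have D0 : 0 <= D by rewrite divr_ge0 ?mulr_ge0// ltW.
have e1 : 0 < eps / 3 / (D + 1) by rewrite divr_gt0// ltr_wpDl.
have [l1 hl1] := tail_small e1.
pose l := maxn l1 1.
have l0 : (0 < l)%N by rewrite leq_max orbT.
have L0 : 0 < l%:R :> R by rewrite ltr0n.
have hl : D * (tailsum C1 theta l / l%:R) <= eps / 3.
  have h : tailsum C1 theta l / l%:R <= eps / 3 / (D + 1).
    by rewrite ler_pdivrMr//; apply: hl1; rewrite leq_max leqnn.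
  apply: (le_trans (ler_wpM2l D0 h)).
  rewrite mulrA ler_pdivrMr; last by rewrite ltr_wpDl.
  by rewrite mulrC ler_wpM2l ?(ltW e30)// lerDl.
pose Cc := B * (2 * s2 `^ (- (s / 2)) * K + Ms).
have [h1 h10 hh1] : exists2 h1 : R, 0 < h1 & forall h, 0 < h -> h <= h1 ->
    Cc * h `^ (s / 2 - 1) <= eps / 3.
  by apply: powR_small => //; lra.
have [h2 h20 hh2] : exists2 h2 : R, 0 < h2 & forall h, 0 < h -> h <= h2 ->
    2 * B * h `^ 2^-1 <= eps / 3.
  by apply: powR_small.
pose h0 := Num.min h1 h2.
have h00 : 0 < h0 by rewrite lt_min h10.
pose n0 := (Num.truncn (l%:R / h0)).+1.
exists n0 => n n0n.
have npos : (0 < n)%N by apply: leq_trans n0n.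
have N0 : 0 < n%:R :> R by rewrite ltr0n.
have hpos : 0 < l%:R / n%:R :> R by rewrite divr_gt0.
have hle : l%:R / n%:R <= h0.
  rewrite ler_pdivrMr// mulrC -ler_pdivrMr// ltW// (lt_le_trans (truncnS_gt _))//.
  by rewrite ler_nat.
have hle1 : l%:R / n%:R <= h1 by apply: le_trans hle _; rewrite ge_min lexx.
have hle2 : l%:R / n%:R <= h2 by apply: le_trans hle _; rewrite ge_min lexx orbT.
apply: (le_trans (clt_error l0 npos sm f0 erefl)).
have := hh1 _ hpos hle1; have := hh2 _ hpos hle2.
rewrite powR12_sqrt ?(ltW hpos)// => H2 H1.
have -> : eps = eps / 3 + eps / 3 + eps / 3 by field.
by apply: lerD => //; apply: lerD.
Qed.

End clt.

(** * Convergence of distribution functions *)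

Section test_functions.
Context (R : realType).
Implicit Types (f g : R -> R).

Definition has_deriv f (t a : R) : Prop := is_derive (t : R^o) 1 (f : R^o -> R^o) a.

Lemma has_deriv_eq f t a b : has_deriv f t a -> a = b -> has_deriv f t b.
Proof. by move=> h <-. Qed.

Lemma has_deriv_cst c t : has_deriv (fun=> c) t 0.
Proof. exact: is_derive_cst. Qed.

Lemma has_deriv_id t : has_deriv (fun u => u) t 1.
Proof. exact: is_derive_id. Qed.

Lemma has_derivD f g t a b : has_deriv f t a -> has_deriv g t b ->
  has_deriv (fun u => f u + g u) t (a + b).
Proof. exact: is_deriveD. Qed.

Lemma has_derivN f t a : has_deriv f t a -> has_deriv (fun u => - f u) t (- a).
Proof. exact: is_deriveN. Qed.

Lemma has_derivB f g t a b : has_deriv f t a -> has_deriv g t b ->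
  has_deriv (fun u => f u - g u) t (a - b).
Proof. exact: is_deriveB. Qed.

Lemma has_derivM f g t a b : has_deriv f t a -> has_deriv g t b ->
  has_deriv (fun u => f u * g u) t (f t * b + g t * a).
Proof. exact: is_deriveM. Qed.

Lemma has_deriv_comp f g t a b : has_deriv f (g t) a -> has_deriv g t b ->
  has_deriv (fun u => f (g u)) t (a * b).
Proof. exact: is_derive1_comp. Qed.

Lemma mean_value_bound (f df : R -> R) (C x y : R) :
  (forall t : R, has_deriv f t (df t)) ->
  (forall t, `|t - x| <= `|y - x| -> `|df t| <= C) ->
  `|f y - f x| <= C * `|y - x|.
Proof.
move=> fd hC.
have cf a b : {within `[a, b], continuous f}.
  apply: continuous_subspaceT => t; apply: differentiable_continuous.
  by apply/derivable1_diffP; exact: (@ex_derive _ _ _ _ _ _ _ (fd t)).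
have [xy|yx|->] := ltgtP x y; last by rewrite !subrr normr0 mulr0.
- have [c /[!in_itv]/= /andP[c1 c2] ->] := MVT xy (fun t _ => fd t) (@cf x y).
  rewrite normrM ler_wpM2r//; apply: hC.
  by rewrite !gtr0_norm ?subr_gt0//; lra.
- have [c /[!in_itv]/= /andP[c1 c2] e] := MVT yx (fun t _ => fd t) (@cf y x).
  rewrite distrC e normrM (distrC x y) ler_wpM2r//; apply: hC.
  by rewrite !ltr0_norm ?subr_lt0//; lra.
Qed.

(** Two applications of the mean value bound, to the Taylor remainder [T0] and its derivative [T1],
    bound the remainder by [min (B |y|) (2 B) * y ^ 2]. Using the first value for [|y| <= 1] and the
    second beyond gives every order [s] between 2 and 3. *)
Lemma smooth_of_derivatives (B s : R) (g g1 g2 g3 : R -> R) : 2 <= s <= 3 ->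
  (forall t : R, has_deriv g t (g1 t)) ->
  (forall t : R, has_deriv g1 t (g2 t)) ->
  (forall t : R, has_deriv g2 t (g3 t)) ->
  (forall t, `|g t| <= B) -> (forall t, `|g1 t| <= B) ->
  (forall t, `|g2 t| <= B) -> (forall t, `|g3 t| <= B) ->
  smooth_test (2 * B) s g g1 g2.
Proof.
move=> /andP[s2 s3] d0 d1 d2 b0 b1 b2 b3.
have B0 : 0 <= B by exact: le_trans (b0 0).
have lip (h h' : R -> R) : (forall t : R, has_deriv h t (h' t)) ->
    (forall t, `|h' t| <= B) -> lipschitz_real B h.
  by move=> dh bh x y; rewrite distrC (distrC x); exact: mean_value_bound dh _.
have le2 t : t <= B -> t <= 2 * B by move=> ?; lra.
have lip2 (h : R -> R) : lipschitz_real B h -> lipschitz_real (2 * B) h.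
  by move=> lh x y; apply: le_trans (lh x y) _; rewrite ler_wpM2r//; exact: le2.
have l2 := lip _ _ d2 b3.
split; [exact: lip2 (lip _ _ d0 b1)|exact: lip2 (lip _ _ d1 b2)|exact: lip2|
  by move=> ?; exact: le2|by move=> ?; exact: le2|by move=> ?; exact: le2|].
move=> x y.
pose C := Num.min (B * `|y|) (2 * B).
have C0 : 0 <= C by rewrite le_min !mulr_ge0.
have h2 t : `|t - 0| <= `|y - 0| -> `|g2 (x + t) - g2 x| <= C.
  rewrite !subr0 => ty; rewrite le_min; apply/andP; split.
    apply: le_trans (l2 _ _) _; rewrite ler_wpM2l//.
    by rewrite addrC addKr.
  by apply: le_trans (ler_normB _ _) _; have := b2 (x + t); have := b2 x; lra.
have shift (h h' : R -> R) : (forall t : R, has_deriv h t (h' t)) ->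
    forall t : R, has_deriv (fun u : R => h (x + u)) t (h' (x + t)).
  move=> dh t; apply: has_deriv_eq.
    by apply: has_deriv_comp (dh _) (has_derivD (has_deriv_cst _ _) (has_deriv_id _)).
  by ring.
pose T1 (t : R) := g1 (x + t) - g1 x - g2 x * t.
have dT1 (t : R) : has_deriv T1 t (g2 (x + t) - g2 x).
  apply: has_deriv_eq.
    apply: has_derivB; first by apply: has_derivB (shift _ _ d1 t) (has_deriv_cst _ _).
    exact: has_derivM (has_deriv_cst _ _) (has_deriv_id _).
  by rewrite /=; ring.
pose T0 (t : R) := g (x + t) - g x - g1 x * t - g2 x * (t * t) / 2.
have dT0 (t : R) : has_deriv T0 t (T1 t).
  apply: has_deriv_eq.
    apply: has_derivB.
      apply: has_derivB; first by apply: has_derivB (shift _ _ d0 t) (has_deriv_cst _ _).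
      exact: has_derivM (has_deriv_cst _ _) (has_deriv_id _).
    apply: has_derivM (has_deriv_cst _ _).
    by apply: has_derivM (has_deriv_cst _ _) (has_derivM (has_deriv_id _) (has_deriv_id _)).
  by rewrite /T1 /=; field.
have T1C t : `|t - 0| <= `|y - 0| -> `|T1 t| <= C * `|y|.
  move=> ty.
  have := mean_value_bound (x := 0) (y := t) (C := C) dT1.
  rewrite {2}/T1 addr0 subrr mulr0 !subr0 => h.
  have : `|T1 t| <= C * `|t|.
    by apply: h => u ut; apply: h2; apply: (le_trans ut); rewrite -[t]subr0.
  by move/le_trans; apply; rewrite ler_wpM2l//; rewrite !subr0 in ty.
have := mean_value_bound (x := 0) (y := y) (C := C * `|y|) dT0 T1C.
rewrite {2}/T0 addr0 subrr !mulr0 mul0r !subr0 /T0 -expr2 => h.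
apply: (le_trans h); rewrite /C.
have [->|y0] := eqVneq y 0; first by rewrite normr0 !mulr0 mulr_ge0 ?powR_ge0 ?mulr_ge0.
have yp : 0 < `|y| by rewrite normr_gt0.
rewrite -[leLHS]mulrA -expr2.
case: (leP `|y| 1) => y1.
  apply: (@le_trans _ _ (B * `|y| * `|y| ^+ 2)).
    by rewrite ler_wpM2r// ge_min lexx.
  rewrite -mulrA -exprS -powR_mulrn//.
  apply: (@le_trans _ _ (B * `|y| `^ s)); last by rewrite ler_wpM2r ?powR_ge0//; lra.
  by rewrite ler_wpM2l//; apply: ger_powR => //; rewrite yp.
apply: (@le_trans _ _ (2 * B * `|y| ^+ 2)).
  by rewrite ler_wpM2r// ge_min lexx orbT.
rewrite -powR_mulrn// ler_wpM2l ?mulr_ge0//.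
by apply: ler_powR => //; exact: ltW.
Qed.


(** The decreasing logistic function, a smooth step between 1 and 0. Its derivatives are polynomials
    in itself, hence bounded. *)
Definition sigmoid (x : R) : R := (1 + expR x)^-1.

Lemma sigmoid_den (x : R) : 0 < 1 + expR x.
Proof. by rewrite addr_gt0// expR_gt0. Qed.

Lemma sigmoid_gt0 (x : R) : 0 < sigmoid x.
Proof. by rewrite invr_gt0 sigmoid_den. Qed.

Lemma sigmoid_le1 (x : R) : sigmoid x <= 1.
Proof. by rewrite invf_le1 ?sigmoid_den// lerDl expR_ge0. Qed.

Lemma sigmoid_le (x : R) : sigmoid x <= expR (- x).
Proof.
by rewrite expRN lef_pV2 ?posrE ?expR_gt0 ?sigmoid_den// lerDr.
Qed.

Lemma sigmoid_ge (x : R) : 1 - expR x <= sigmoid x.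
Proof.
rewrite /sigmoid -div1r ler_pdivlMr ?sigmoid_den//.
by have := sqr_ge0 (expR x); lra.
Qed.

Lemma sigmoid_deriv (t : R) : has_deriv sigmoid t (- (sigmoid t * (1 - sigmoid t))).
Proof.
have h : has_deriv (fun u : R => 1 + expR u) t (expR t).
  apply: has_deriv_eq; first by apply: has_derivD (has_deriv_cst _ _) (is_derive_expR t).
  by rewrite add0r.
have n0 : 1 + expR t != 0 by rewrite gt_eqF// sigmoid_den.
apply: has_deriv_eq; first exact: (@is_deriveV R (fun u : R => 1 + expR u) t (expR t) 1 n0 h).
by rewrite /sigmoid /GRing.scale/=; field.
Qed.

Lemma sigmoid_smooth (s : R) : 2 <= s <= 3 -> exists f1 f2, smooth_test 2 s sigmoid f1 f2.
Proof.
move=> s23; pose p := sigmoid.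
pose g1 t := - (p t * (1 - p t)).
pose g2 t := p t * (1 - p t) * (1 - (p t + p t)).
pose g3 t := - (p t * (1 - p t)) * (1 - 6 * p t + 6 * p t ^+ 2).
exists g1, g2; have -> : (2 : R) = 2 * 1 by rewrite mulr1.
have dp := sigmoid_deriv.
have d1 t : has_deriv (fun u => 1 - p u) t (p t * (1 - p t)).
  apply: has_deriv_eq; first exact: has_derivB (has_deriv_cst _ _) (dp t).
  by rewrite sub0r opprK.
have dm t : has_deriv (fun u => p u * (1 - p u)) t (g1 t * (1 - (p t + p t))).
  apply: has_deriv_eq; first exact: has_derivM (dp t) (d1 t).
  by rewrite /g1 /p /=; ring.
have pb t : 0 <= p t * (1 - p t) <= 1 / 4.
  have := sigmoid_gt0 t; have := sigmoid_le1 t; rewrite -/(p t) => h1 h2.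
  have h3 := sqr_ge0 (p t - 1 / 2); apply/andP; split; nra.
have p1 t : 0 <= p t <= 1 by rewrite ltW ?sigmoid_gt0//= sigmoid_le1.
have nb (u v : R) : 0 <= u <= 1 / 4 -> `|v| <= 1 -> `|u * v| <= 1.
  move=> /andP[u0 u1] v1; rewrite normrM (ger0_norm u0).
  by rewrite mulr_ile1//; lra.
apply: (@smooth_of_derivatives _ _ _ _ _ g3) => //.
- move=> t; apply: has_deriv_eq.
    exact: has_derivN (dm t).
  by rewrite /g2 /g1 /=; ring.
- move=> t; apply: has_deriv_eq.
    apply: has_derivM (dm t) _.
    exact: has_derivB (has_deriv_cst 1 t) (has_derivD (dp t) (dp t)).
  by rewrite /g3 /g1 /p /=; ring.
- by move=> t; rewrite ger0_norm; [case/andP: (p1 t)|case/andP: (p1 t)].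
- move=> t; rewrite normrN -[_ * _]mulr1; apply: nb; [exact: pb|by rewrite normr1].
- move=> t; apply: nb; first exact: pb.
  by rewrite ler_norml; case/andP: (p1 t) => *; apply/andP; split; lra.
- move=> t; rewrite /g3 mulNr normrN; apply: nb; first exact: pb.
  by rewrite ler_norml; case/andP: (p1 t) => *; apply/andP; split; nra.
Qed.

Lemma smooth_affine B s f f1 f2 (lam a : R) : 0 < lam -> smooth_test B s f f1 f2 ->
  exists B' f1' f2', smooth_test B' s (fun x => f (lam * (x - a))) f1' f2'.
Proof.
move=> l0 [h0 h1 h2 b0 b1 b2 ht].
have B0 : 0 <= B by exact: lipschitz_ge0 h0.
(* Dominates every power of [lam] that the rescaling brings into the seven conditions. *)
pose S := 1 + lam + lam ^+ 2 + lam ^+ 3 + lam `^ s.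
have l2 : 0 < lam ^+ 2 by rewrite exprn_gt0.
have l3 : 0 < lam ^+ 3 by rewrite exprn_gt0.
have ls : 0 < lam `^ s by rewrite powR_gt0.
have B'le c : c <= S -> B * c <= B * S by move=> ?; rewrite ler_wpM2l.
have lip (g : R -> R) c : 0 <= c -> c * lam <= S -> lipschitz_real B g ->
    lipschitz_real (B * S) (fun x => c * g (lam * (x - a))).
  move=> c0 cS lg x y; rewrite -mulrBr normrM (ger0_norm c0).
  apply: (@le_trans _ _ (c * (B * (lam * `|x - y|)))).
    rewrite ler_wpM2l//; apply: le_trans (lg _ _) _; rewrite ler_wpM2l//.
    by rewrite -mulrBr normrM (gtr0_norm l0) opprB addrA subrK.
  rewrite (_ : c * _ = B * (c * lam) * `|x - y|); last by ring.
  by rewrite ler_wpM2r// B'le.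
have bnd (g : R -> R) c : 0 <= c -> c <= S -> (forall x, `|g x| <= B) ->
    forall x, `|c * g (lam * (x - a))| <= B * S.
  move=> c0 cS bg x; rewrite normrM (ger0_norm c0).
  apply: (@le_trans _ _ (B * c)); last exact: B'le.
  by rewrite mulrC ler_wpM2r.
have c1 : (fun x => f (lam * (x - a))) = fun x => 1 * f (lam * (x - a)).
  by apply/funext => x; rewrite mul1r.
exists (B * S), (fun x => lam * f1 (lam * (x - a))), (fun x => lam ^+ 2 * f2 (lam * (x - a))).
split.
- by rewrite c1; apply: lip => //; rewrite /S; lra.
- by apply: lip => //; [exact: ltW|rewrite -expr2 /S; lra].
- by apply: lip => //; [exact: ltW|rewrite -exprSr /S; lra].
- by move=> x; rewrite -[f _]mul1r; apply: bnd => //; rewrite /S; lra.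
- by apply: bnd => //; [exact: ltW|rewrite /S; lra].
- by apply: bnd => //; [exact: ltW|rewrite /S; lra].
- move=> x y; have := ht (lam * (x - a)) (lam * y).
  rewrite (_ : lam * (x - a) + lam * y = lam * (x + y - a)); last by ring.
  rewrite normrM (gtr0_norm l0) powRM ?(ltW l0)// => h.
  rewrite (_ : f (lam * (x + y - a)) - f (lam * (x - a)) - lam * f1 (lam * (x - a)) * y -
     lam ^+ 2 * f2 (lam * (x - a)) * y ^+ 2 / 2 = f (lam * (x + y - a)) - f (lam * (x - a)) -
     f1 (lam * (x - a)) * (lam * y) - f2 (lam * (x - a)) * (lam * y) ^+ 2 / 2); last by ring.
  apply: (le_trans h); rewrite mulrA ler_wpM2r ?powR_ge0// B'le// /S; lra.
Qed.

End test_functions.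

Lemma sandwich_arith (R : realType) (p1 q1 p2 q2 F G1 G2 G eta : R) :
  `|p1 - q1| <= eta -> `|p2 - q2| <= eta ->
  F <= p1 + eta -> p2 <= F + eta -> q1 <= G1 + eta -> G2 <= q2 + eta ->
  `|G1 - G| <= 2 * eta -> `|G - G2| <= 2 * eta -> `|F - G| <= 5 * eta.
Proof.
rewrite !ler_norml => /andP[? ?] /andP[? ?] ? ? ? ? /andP[? ?] /andP[? ?].
by apply/andP; split; lra.
Qed.

Section real_cdf.
Context (d : measure_display) (T : measurableType d) (R : realType).
Variable (P : probability T R).

Definition below (V : T -> R) (x : R) (w : T) : R := ((V w <= x)%R : nat)%:R.

Definition rcdf (V : T -> R) (x : R) : R := Ex P (below V x).

Lemma below_integ (V : T -> R) (x : R) : measurable_fun setT V -> integ P (below V x).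
Proof.
move=> mV; apply: (@integ_bounded _ _ _ _ _ 1); last first.
  by move=> w; rewrite /below; case: (V w <= x) => /=; rewrite ?normr1 ?normr0.
rewrite (_ : below V x = \1_(V @^-1` `]-oo, x])).
  by apply: measurable_indic; rewrite -[X in measurable X]setTI; exact: mV.
apply/funext => w; rewrite indicE /below; congr (nat_of_bool _)%:R.
by apply/idP/idP; rewrite inE /= in_itv/=.
Qed.

Lemma rcdfE (V : T -> R) (x : R) : measurable_fun setT V ->
  P (V @^-1` `]-oo, x]) = (rcdf V x)%:E.
Proof.
move=> mV; have mA : measurable (V @^-1` `]-oo, x]).
  by rewrite -[X in measurable X]setTI; exact: mV.
rewrite /rcdf -(Ex_EFin (below_integ x mV)) -(expectation_indic P mA).
congr expectation; apply/funext => w; rewrite indicE /below; congr (nat_of_bool _)%:R.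
by apply/idP/idP; rewrite inE /= in_itv/=.
Qed.

End real_cdf.

Section weak_convergence.
Context (d d' : measure_display) (T : measurableType d) (T' : measurableType d') (R : realType).
Variables (P : probability T R) (Q : probability T' R) (V : nat -> T -> R) (Z : T' -> R).
Variable (s : R).
Hypothesis mV : forall n, measurable_fun setT (V n).
Hypothesis mZ : measurable_fun setT Z.
Hypothesis s23 : 2 <= s <= 3.
Hypothesis cvg_smooth : forall B f f1 f2, smooth_test B s f f1 f2 -> (forall y, 0 <= f y) ->
  forall eps : R, 0 < eps -> exists n0 : nat, forall n, (n0 <= n)%N ->
  `|Ex P (fun w => f (V n w)) - Ex Q (fun w => f (Z w))| <= eps.
Hypothesis lipZ : lipschitz_real 1 (rcdf Q Z).

(** Steep sigmoids centered at [x + eta] and [x - eta] sandwich the indicator of the half-line up to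
    [eta]. On each side the two sandwiches and the convergence cost [3 * eta], and moving the
    argument of the Lipschitz limit by [2 * eta] costs the rest of [5 * eta]. *)
Lemma rcdf_cvg (x eps : R) : 0 < eps -> exists n0 : nat, forall n, (n0 <= n)%N ->
  `|rcdf P (V n) x - rcdf Q Z x| <= eps.
Proof.
move=> e0; pose eta := eps / 5; have eta0 : 0 < eta by rewrite divr_gt0.
(* With slope [lam = U / eta], the sigmoid is within [expR (- U) <= eta] of the indicator at
   distance [eta] or more from its center. *)
pose U := Num.max 1 (- ln eta).
have U0 : 0 < U by rewrite lt_max ltr01.
have hU : expR (- U) <= eta.
  rewrite -[leRHS]lnK ?posrE// ler_expR lerNl le_max lexx orbT//.
pose lam := U / eta; have lam0 : 0 < lam by rewrite divr_gt0.
have lamU : lam * eta = U by rewrite divfK// gt_eqF.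
have [f1 [f2 sm]] := sigmoid_smooth s23.
pose f (a y : R) := sigmoid (lam * (y - a)).
have f0 a y : 0 <= f a y by exact/ltW/sigmoid_gt0.
have f1' a y : f a y <= 1 by exact: sigmoid_le1.
have flo a y : y <= a - eta -> 1 - eta <= f a y.
  move=> h; apply: le_trans (sigmoid_ge _).
  rewrite lerD2l lerN2; apply: le_trans hU; rewrite ler_expR -lamU -mulrN ler_wpM2l ?(ltW lam0)//.
  by lra.
have fhi a y : a + eta <= y -> f a y <= eta.
  move=> h; apply: le_trans (sigmoid_le _) _; apply: le_trans hU.
  rewrite ler_expR lerN2 -lamU ler_wpM2l ?(ltW lam0)//; lra.
have up a y : ((y <= a - eta)%R : nat)%:R <= f a y + eta.
  case: (leP y (a - eta)) => h /=; first by have := flo a y h; lra.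
  by have := f0 a y; lra.
have dn a y : f a y <= ((y <= a + eta)%R : nat)%:R + eta.
  case: (leP y (a + eta)) => h /=; first by have := f1' a y; lra.
  by have := fhi a y (ltW h); lra.
have mf (a : R) : measurable_fun setT (f a).
  have [B [g1 [g2 smf]]] := smooth_affine a lam0 sm.
  exact: lipschitz_measurable (smooth_lip0 smf).
have ineq d0 (T0 : measurableType d0) (P0 : probability T0 R) (W : T0 -> R) a :
    measurable_fun setT W ->
    rcdf P0 W (a - eta) <= Ex P0 (fun w => f a (W w)) + eta /\
    Ex P0 (fun w => f a (W w)) <= rcdf P0 W (a + eta) + eta.
  move=> mW.
  have iF : integ P0 (fun w => f a (W w)).
    apply: (@integ_bounded _ _ _ _ _ 1); first exact: measurableT_comp.
    by move=> w; rewrite ger0_norm.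
  have ib y := below_integ P0 y mW; have ic := integ_cst P0 eta.
  have e u : Ex P0 u + eta = Ex P0 u + Ex P0 (fun=> eta) by rewrite Ex_cst.
  split.
    rewrite e -ExD//.
    by apply: Ex_le; [exact: ib|exact: integD|move=> w; exact: up].
  rewrite /rcdf e -ExD//.
  by apply: Ex_le; [exact: iF|exact: integD|move=> w; exact: dn].
have cv a : exists n0 : nat, forall n, (n0 <= n)%N ->
    `|Ex P (fun w => f a (V n w)) - Ex Q (fun w => f a (Z w))| <= eta.
  have [B [g1 [g2 smf]]] := smooth_affine a lam0 sm.
  exact: (cvg_smooth smf (f0 a) eta0).
have [n1 h1] := cv (x + eta); have [n2 h2] := cv (x - eta).
exists (maxn n1 n2) => n; rewrite geq_max => /andP[/h1 {}h1 /h2 {}h2].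
have [a1 a2] := ineq _ _ P (V n) (x + eta) (mV n).
have [a3 a4] := ineq _ _ P (V n) (x - eta) (mV n).
have [b1 b2] := ineq _ _ Q Z (x + eta) mZ.
have [b3 b4] := ineq _ _ Q Z (x - eta) mZ.
have z1 := lipZ (x + eta + eta) x; have z2 := lipZ x (x - eta - eta).
rewrite addrK in a1; rewrite subrK in a4.
rewrite mul1r (_ : x + eta + eta - x = 2 * eta) in z1; last by ring.
rewrite mul1r (_ : x - (x - eta - eta) = 2 * eta) in z2; last by ring.
have e20 : `|2 * eta| = 2 * eta by rewrite gtr0_norm// mulr_gt0.
rewrite e20 in z1; rewrite e20 in z2.
have e5 : eps = 5 * eta by rewrite /eta; field.
rewrite e5; exact: sandwich_arith h1 h2 a1 a4 b2 b3 z1 z2.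
Qed.

End weak_convergence.

Section cdf_determines.
Context (d1 d2 : measure_display) (T1 : measurableType d1)
  (T2 : measurableType d2) (R : realType).
Variables (P1 : probability T1 R) (P2 : probability T2 R).
Variables (f : {RV P1 >-> R}) (g : {RV P2 >-> R}).
Hypothesis fg : forall x, P1 (f @^-1` `]-oo, x]) = P2 (g @^-1` `]-oo, x]).

Lemma eq_cdf_eq_dist A : measurable A -> P1 (f @^-1` A) = P2 (g @^-1` A).
Proof.
pose G : set (set R) := @RGenOInfty.G R.
apply: (@measure_unique _ R _ G (fun k => `]- k%:R, +oo[%classic)
  _ _ _ _ (distribution P1 f) (distribution P2 g)).
- exact: RGenOInfty.measurableE.
- move=> _ _ [x ->] [y ->]; exists (Num.max x y).
  by apply/seteqP; split => z /=; rewrite !in_itv/= !andbT gt_max => /andP.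
- by move=> k; exists (- k%:R).
- apply/seteqP; split => // x _; exists (Num.truncn `|x|).+1 => //=.
  by rewrite in_itv/= andbT ltrNl (le_lt_trans _ (truncnS_gt _))// -normrN ler_norm.
- move=> _ [x ->].
  have mf : measurable (f @^-1` `]-oo, x]) by exact: measurable_funPTI.
  have mg : measurable (g @^-1` `]-oo, x]) by exact: measurable_funPTI.
  change (P1 (f @^-1` `]x, +oo[) = P2 (g @^-1` `]x, +oo[)).
  have e : `]x, +oo[%classic = ~` `]-oo, x]%classic by rewrite setCitvl.
  have e1 : f @^-1` `]x, +oo[ = ~` (f @^-1` `]-oo, x]) by rewrite e.
  have e2 : g @^-1` `]x, +oo[ = ~` (g @^-1` `]-oo, x]) by rewrite e.
  by rewrite e1 e2 !probability_setC// fg.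
- by move=> k; rewrite (le_lt_trans (probability_le1 _ _)) ?ltry.
Qed.

End cdf_determines.

Section bounded_convergence.
Context (d : measure_display) (T : measurableType d) (R : realType).
Variable P : probability T R.

Lemma bounded_convergence_Ex (g : nat -> T -> R) (B : R) :
  (forall n, measurable_fun setT (g n)) -> (forall n x, `|g n x| <= B) ->
  (forall x, g ^~ x @ \oo --> 0) ->
  Ex P (g n) @[n --> \oo] --> 0.
Proof.
move=> mg gB g0.
have [] := @dominated_convergence _ T R P setT measurableT
  (fun n => EFin \o g n) (EFin \o (fun=> 0)) (EFin \o (fun=> B)).
- by move=> n; exact/measurable_EFinP.
- exact: measurable_cst.
- by apply: aeW => x _; apply: cvg_EFin; [exact: nearW|exact: g0].
- exact: integ_cst.
- by apply: aeW => x n _; rewrite /= lee_fin.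
move=> _ _.
rewrite /= (_ : (\int[P]_x (0 : R)%:E)%E = 0%E); last by rewrite integral0.
by move/fine_cvg; exact.
Qed.

End bounded_convergence.

Section rcdf_properties.
Context (d : measure_display) (T : measurableType d) (R : realType).
Variables (P : probability T R) (V : {RV P >-> R}).
Local Notation F := (rcdf P V).

Lemma rcdf_cdf x : cdf V x = (F x)%:E.
Proof. by rewrite -rcdfE. Qed.

Lemma rcdf_homo : {homo F : x y / x <= y}.
Proof. by move=> x y xy; rewrite -lee_fin -!rcdf_cdf cdf_nondecreasing. Qed.

Lemma rcdf_ge0 x : 0 <= F x.
Proof. by rewrite -lee_fin -rcdf_cdf cdf_ge0. Qed.

Lemma rcdf_le1 x : F x <= 1.
Proof. by rewrite -lee_fin -rcdf_cdf cdf_le1. Qed.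

Let cdfE : cdf V = EFin \o F.
Proof. by apply/funext => x; rewrite rcdf_cdf. Qed.

Lemma rcdf_right x c : (forall y, x < y -> c <= F y) -> c <= F x.
Proof.
move=> h; have := @cdf_right_continuous _ _ _ P V x; rewrite /= cdfE => /fine_cvg hc.
apply: (cvgr_to_ge hc); near=> y; apply: h.
by near: y; exact: nbhs_right_gt.
Unshelve. all: by end_near. Qed.

Lemma rcdf_top c : c < 1 -> exists x, c <= F x.
Proof.
move=> c1; have := @cvg_cdfy1 _ _ _ P V; rewrite cdfE => /fine_cvg hc.
have {}hc : F y @[y --> +oo] --> (1 : R) by exact: hc.
have [M [_ hM]] : \forall y \near +oo, c <= F y by exact: (cvgr_ge _ hc _ c1).
by exists (M + 1); apply: hM; rewrite ltrDl.
Qed.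

Lemma rcdf_bot c : 0 < c -> exists x, F x < c.
Proof.
move=> c1; have := @cvg_cdfNy0 _ _ _ P V; rewrite cdfE => /fine_cvg hc.
have {}hc : F y @[y --> -oo] --> (0 : R) by exact: hc.
have [M [_ hM]] : \forall y \near -oo, F y < c by exact: (cvgr_lt _ hc _ c1).
by exists (M - 1); apply: hM; rewrite gtrDl ltrN10.
Qed.

End rcdf_properties.

(** * The normal distribution function *)

Section normal_cdf.
Context (d : measure_display) (T : measurableType d) (R : realType).
Variables (Q : probability T R) (Z : {RV Q >-> R}).
Hypothesis Z_normal : forall A : set R, measurable A ->
    distribution Q Z A = normal_prob 0 1 A.
Local Notation Phi := (rcdf Q Z).
Local Notation leb := (@lebesgue_measure R).

Let ocitv_eq x y : x <= y -> ((Phi y - Phi x)%:E = \int[leb]_(z in `]x, y]) (normal_pdf 0 1 z)%:E)%E.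
Proof.
move=> xy; rewrite EFinB -!rcdfE; [|exact: measurable_funP..].
have e z : Q (Z @^-1` `]-oo, z]) = normal_prob 0 1 `]-oo, z] by rewrite -Z_normal.
rewrite !e.
have U : `]-oo, y]%classic = `]-oo, x] `|` `]x, y].
  apply/seteqP; split => z /=; rewrite !in_itv/=.
    by move=> zy; case: (leP z x) => h; [left|right; apply/andP].
  by move=> [zx|/andP[]//]; exact: le_trans zx xy.
rewrite U measureU//; last first.
  rewrite -subset0 => z []/=; rewrite !in_itv/= => zx /andP[xz _].
  by move: xz; rewrite ltNge zx.
rewrite addeAC subee ?add0e//.
by rewrite ge0_fin_numE// (le_lt_trans (probability_le1 _ _)) ?ltry.
Qed.

(** The density is bounded by its peak, which is at most 1. *)
Lemma normal_cdf_lipschitz : lipschitz_real 1 Phi.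
Proof.
have pk : normal_peak (1 : R) <= 1.
  rewrite /normal_peak invf_le1 ?sqrtr_gt0; last first.
    by rewrite expr1n mul1r mulrn_wgt0// pi_gt0.
  rewrite -[leLHS]sqrtr1 ler_wsqrtr// expr1n mul1r.
  by have := pi_ge2 R; rewrite -mulr_natr; lra.
have key x y : x <= y -> 0 <= Phi y - Phi x <= y - x.
  move=> xy; rewrite subr_ge0 rcdf_homo//= -lee_fin ocitv_eq//.
  apply: (@le_trans _ _ (\int[leb]_(z in `]x, y]) (1%:E : \bar R))%E).
    apply: ge0_le_integral => //.
    - by move=> z _; rewrite lee_fin normal_pdf_ge0.
    - apply/measurable_EFinP; apply: measurable_funTS; exact: measurable_normal_pdf.
    - move=> z _; rewrite lee_fin; apply: le_trans pk.
      by apply: normal_pdf_ub; rewrite oner_eq0.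
  rewrite integral_cst//= mul1e lebesgue_measure_itv/= lte_fin.
  by case: ltP => h; rewrite ?EFinB// lee_fin subr_ge0.
move=> x y; rewrite mul1r; have [xy|/ltW yx] := leP x y.
  by have /andP[h1 h2] := key _ _ xy; rewrite distrC (distrC x) !ger0_norm// subr_ge0.
by have /andP[h1 h2] := key _ _ yx; rewrite !ger0_norm// subr_ge0.
Qed.

(** Between [x] and [y] the density is at least its value [c > 0] at [|x| + |y|]. *)
Lemma normal_cdf_strict x y : x < y -> Phi x < Phi y.
Proof.
move=> xy; rewrite -subr_gt0 -lte_fin ocitv_eq ?(ltW xy)//.
pose M := `|x| + `|y|.
pose c := normal_peak (1 : R) * expR (- M ^+ 2 / (1 ^+ 2 *+ 2)).
have c0 : 0 < c by rewrite mulr_gt0 ?expR_gt0// normal_peak_gt0// oner_eq0.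
apply: (@lt_le_trans _ _ (\int[leb]_(z in `]x, y]) (c%:E : \bar R))%E).
  rewrite integral_cst//= lebesgue_measure_itv/= lte_fin xy -EFinB -EFinM lte_fin.
  by rewrite mulr_gt0// subr_gt0.
apply: ge0_le_integral => //.
- by move=> z _; rewrite lee_fin ltW.
- apply/measurable_EFinP; apply: measurable_funTS; exact: measurable_normal_pdf.
- move=> z /=; rewrite in_itv/= => /andP[xz zy].
  rewrite lee_fin normal_pdf1 ?oner_eq0// /c ler_wpM2l ?normal_peak_ge0//.
  rewrite ler_expR ler_wpM2r ?invr_ge0//.
  rewrite lerN2 subr0 -(real_normK (num_real z)) lerXn2r ?nnegrE ?addr_ge0//.
  have := ler_norm y; have := ler_norm (- x); rewrite normrN => h1 h2.
  have := normr_ge0 x; have := normr_ge0 y.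
  by rewrite ler_norml /M => *; apply/andP; split; lra.
Qed.

Lemma normal_cdf_mono x y : (Phi x <= Phi y) = (x <= y).
Proof.
apply/idP/idP => [|h]; last exact: rcdf_homo.
by apply: contraTT; rewrite -!ltNge; exact: normal_cdf_strict.
Qed.

Lemma normal_cdf_gt0 x : 0 < Phi x.
Proof.
by apply: le_lt_trans (@normal_cdf_strict (x - 1) x _); [exact: rcdf_ge0|rewrite gtrDl ltrN10].
Qed.

Lemma normal_cdf_lt1 x : Phi x < 1.
Proof.
by apply: lt_le_trans (@normal_cdf_strict x (x + 1) _) _; [rewrite ltrDl|exact: rcdf_le1].
Qed.

(** For [p] strictly between 0 and 1 the intermediate value theorem gives [z] with [Phi z = p], and
    strict monotonicity turns the event into [Z <= z]. *)
Lemma normal_cdf_uniform p : 0 <= p <= 1 ->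
  Q [set w | Phi (Z w) <= p] = p%:E.
Proof.
move=> /andP[p0 p1].
have [->|pn1] := eqVneq p 1.
  rewrite (_ : [set w | _] = setT) ?probability_setT//.
  by apply/seteqP; split => // w _ /=; exact/ltW/normal_cdf_lt1.
have [->|pn0] := eqVneq p 0.
  rewrite (_ : [set w | _] = set0) ?measure0//.
  by apply/seteqP; split => // w /=; rewrite leNgt normal_cdf_gt0.
have {}p0 : 0 < p by rewrite lt_neqAle eq_sym pn0.
have {}p1 : p < 1 by rewrite lt_neqAle pn1.
have [a ha] := rcdf_bot Z p0; have [b hb] := rcdf_top Z p1.
have ab : a <= b by rewrite -normal_cdf_mono; lra.
have cPhi : {within `[a, b], continuous Phi}.
  by apply: continuous_subspaceT; exact: lipschitz_continuous normal_cdf_lipschitz.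
have [|z _ hz] := @IVT R Phi a b p ab cPhi.
  by rewrite ge_min le_max (ltW ha) hb orbT.
rewrite -hz -rcdfE; last exact: measurable_funP.
by congr (Q _); apply/seteqP; split => w /=; rewrite in_itv/= normal_cdf_mono.
Qed.

End normal_cdf.

(** * Quantile coupling and convergence in mean of order r *)

Section quantile_coupling.
Context (d d' : measure_display) (T : measurableType d) (T' : measurableType d') (R : realType).
Variables (P : probability T R) (Q : probability T' R).
Variables (Z : {RV Q >-> R}).
Hypothesis Z_normal : forall A : set R, measurable A ->
    distribution Q Z A = normal_prob 0 1 A.
Local Notation Phi := (rcdf Q Z).

Definition quantile (V : {RV P >-> R}) (z : R) : R := inf [set x | Phi z <= rcdf P V x].

(** As [0 < Phi z < 1], the set defining the quantile is nonempty and bounded below, and right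
    continuity puts its infimum in it. This equivalence carries monotonicity, law and convergence of
    the coupling. *)
Lemma quantileP (V : {RV P >-> R}) z x : (quantile V z <= x) = (Phi z <= rcdf P V x).
Proof.
set A := [set x | Phi z <= rcdf P V x].
have [b hb] := rcdf_bot V (normal_cdf_gt0 Z_normal z).
have [t ht] := rcdf_top V (normal_cdf_lt1 Z_normal z).
have lbA : lbound A b.
  move=> y /= Ay; rewrite leNgt; apply/negP => /ltW yb.
  by have := le_lt_trans (le_trans Ay (rcdf_homo V yb)) hb; rewrite ltxx.
have infA : has_inf A by split; [exists t|exists b].
have Ainf : A (inf A).
  apply: rcdf_right => y; rewrite -subr_gt0 => h.
  have [e Ae] := inf_adherent h infA.
  rewrite subrKC => /ltW ey; apply: le_trans Ae _; exact: rcdf_homo.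
apply/idP/idP => [h|h]; first by apply: le_trans Ainf _; exact: rcdf_homo.
by apply: ge_inf => //; exists b.
Qed.

Lemma quantile_homo V : {homo quantile V : x y / x <= y}.
Proof.
move=> x y xy; rewrite quantileP.
have : quantile V y <= quantile V y by [].
by rewrite quantileP; apply: le_trans; exact: rcdf_homo.
Qed.

Lemma measurable_quantile V : measurable_fun setT (fun w => quantile V (Z w)).
Proof.
apply: (@measurableT_comp _ _ _ _ _ _ (quantile V)) => //.
by apply: nondecreasing_measurable => //; exact: quantile_homo.
Qed.

Lemma quantile_cdf V x :
  Q ((fun w => quantile V (Z w)) @^-1` `]-oo, x]) = P (V @^-1` `]-oo, x]).
Proof.
rewrite (rcdfE P)//.
rewrite -(@normal_cdf_uniform _ _ _ Q Z Z_normal (rcdf P V x)); last by rewrite rcdf_ge0 rcdf_le1.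
by congr (Q _); apply/seteqP; split => w /=; rewrite in_itv/= quantileP.
Qed.

Lemma quantile_cvg (V : nat -> {RV P >-> R}) :
  (forall x eps : R, 0 < eps -> exists n0 : nat, forall n, (n0 <= n)%N ->
    `|rcdf P (V n) x - Phi x| <= eps) ->
  forall z, quantile (V n) z @[n --> \oo] --> z.
Proof.
move=> h z; apply/cvgrPdist_le => /= e e0.
(* Halved because the lower bound is proved by contradiction from a non-strict comparison. *)
have lo : 0 < (Phi z - Phi (z - e)) / 2.
  by rewrite divr_gt0// subr_gt0 normal_cdf_strict// gtrDl oppr_lt0.
have hi : 0 < Phi (z + e) - Phi z by rewrite subr_gt0 normal_cdf_strict// ltrDl.
have [n1 h1] := h (z - e) _ lo; have [n2 h2] := h (z + e) _ hi.
exists (maxn n1 n2) => // n /=; rewrite geq_max => /andP[/h1 {}h1 /h2 {}h2].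
rewrite distrC ler_norml; apply/andP; split.
  rewrite lerBrDl leNgt; apply/negP => /ltW; rewrite quantileP.
  by move: h1; rewrite ler_norml => /andP[_]; move: lo; lra.
rewrite lerBlDl quantileP.
by move: h2; rewrite ler_norml => /andP[]; lra.
Qed.

End quantile_coupling.

Lemma powR_normB_le (R : realType) (p x y : R) : 0 <= p ->
  `|x - y| `^ p <= 2 `^ p * (`|x| `^ p + `|y| `^ p).
Proof.
move=> p0; pose m := Num.max `|x| `|y|.
have m0 : 0 <= m by rewrite le_max normr_ge0.
apply: (@le_trans _ _ ((2 * m) `^ p)).
  apply: le_powR => //; apply: le_trans (ler_normB _ _) _.
  by rewrite mulr_natl mulr2n lerD// le_max lexx ?orbT.
rewrite powRM// ler_wpM2l ?powR_ge0// /m.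
by case: (leP `|x| `|y|) => _; rewrite ?lerDr ?lerDl powR_ge0.
Qed.

(** * Convergence in mean of order r *)

Section Lr_convergence.
Context (d : measure_display) (T : measurableType d) (R : realType).
Variables (Q : probability T R) (U : nat -> T -> R) (Z : T -> R) (r p K : R).
Hypothesis r_gt1 : 1 < r.
Hypothesis r_lt_p : r < p.
Hypothesis mU : forall n, measurable_fun setT (U n).
Hypothesis mZ : measurable_fun setT Z.
Hypothesis UZ : forall w, U n w @[n --> \oo] --> Z w.
Hypothesis iU : forall n, integ Q (fun w => `|U n w| `^ p).
Hypothesis iZ : integ Q (fun w => `|Z w| `^ p).
Hypothesis U_le : forall n, Ex Q (fun w => `|U n w| `^ p) <= K.

Let mD n : measurable_fun setT (fun w => U n w - Z w).
Proof. exact: measurable_funB. Qed.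

Lemma Lr_diff_integ_p n : integ Q (fun w => `|U n w - Z w| `^ p).
Proof.
have r1 := r_gt1; have rp := r_lt_p.
apply: (integ_le _ (integZ (2 `^ p) (integD (iU n) iZ))).
  exact: measurable_norm_powR.
move=> w; rewrite [leLHS]ger0_norm ?powR_ge0//.
by apply: le_trans (ler_norm _); apply: powR_normB_le; lra.
Qed.

Lemma Lr_diff_integ n : integ Q (fun w => `|U n w - Z w| `^ r).
Proof.
have r1 := r_gt1; have rp := r_lt_p.
by apply: (@integ_powR_le _ _ _ _ (fun w => U n w - Z w) r p) => //;
  [lra|exact: ltW|exact: Lr_diff_integ_p].
Qed.

(** Truncate [|U - Z|] at [L]: the truncated power converges boundedly, and above [L] one has
    [|U - Z| ^ r <= L ^ (r - p) * |U - Z| ^ p]. The choice of [L] brings the latter below [e / 2]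
    uniformly in [n]. *)
Lemma Lr_cvg : Ex Q (fun w => `|U n w - Z w| `^ r) @[n --> \oo] --> 0.
Proof.
have r1 := r_gt1; have rp := r_lt_p; have r0 : 0 <= r by lra.
pose M := 2 `^ p * (K + Ex Q (fun w => `|Z w| `^ p)).
have hM n : Ex Q (fun w => `|U n w - Z w| `^ p) <= M.
  rewrite /M; apply: (@le_trans _ _ (Ex Q (fun w => 2 `^ p * (`|U n w| `^ p + `|Z w| `^ p)))).
    apply: Ex_le; [exact: Lr_diff_integ_p|by apply: integZ; exact: integD|].
    by move=> w; apply: powR_normB_le; lra.
  rewrite ExZ; last exact: integD.
  by rewrite ExD// ler_wpM2l ?powR_ge0// lerD2r.
have M0 : 0 <= M by apply: le_trans (hM 0%N); apply: Ex_ge0 => w; exact: powR_ge0.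
apply/cvgrPdist_le => /= e e0.
have e20 : 0 < e / 2 by rewrite divr_gt0.
pose L := ((2 * (M + 1)) / e) `^ (p - r)^-1.
have M1 : 0 < 2 * (M + 1) / e by rewrite divr_gt0// mulr_gt0// ltr_wpDl.
have L0 : 0 < L by rewrite powR_gt0.
have LM : L `^ (r - p) * M <= e / 2.
  have -> : L `^ (r - p) = e / (2 * (M + 1)).
    rewrite /L -powRrM (_ : (p - r)^-1 * (r - p) = -1); last by field; lra.
    by rewrite powR_inv1 ?(ltW M1)// invf_div.
  rewrite mulrAC ler_pdivrMr; last by rewrite mulr_gt0// ltr_wpDl.
  have -> : e / 2 * (2 * (M + 1)) = e * (M + 1) by field.
  by rewrite (ler_pM2l e0) lerDl.
pose g n w := Num.min `|U n w - Z w| L `^ r.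
have mg n : measurable_fun setT (g n).
  apply: (@measurableT_comp _ _ _ _ _ _ (@powR R ^~ r)); first exact: measurable_powR.
  by apply: measurable_minr => //; apply: measurableT_comp => //; exact: mD.
have g0 n w : 0 <= g n w by exact: powR_ge0.
have gB n w : `|g n w| <= L `^ r.
  rewrite ger0_norm//; apply: le_powR => //; first by rewrite le_min normr_ge0 ltW.
  by rewrite ge_min lexx orbT.
have gc w : g ^~ w @ \oo --> 0.
  apply/cvgrPdist_le => /= eps eps0.
  have /cvgrPdist_le h := @UZ w.
  have [n0 _ hn0] := h _ (powR_gt0 r^-1 eps0); exists n0 => // n n0n.
  rewrite sub0r normrN ger0_norm//.
  have -> : eps = (eps `^ r^-1) `^ r by rewrite -powRrM mulVf ?powRr1 ?(ltW eps0)// gt_eqF//; lra.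
  apply: le_powR => //; first by rewrite le_min normr_ge0 ltW.
  by rewrite ge_min distrC hn0.
have /cvgrPdist_le/(_ _ e20) [n0 _ hn0] := @bounded_convergence_Ex _ _ _ Q g _ mg gB gc.
exists n0 => // n n0n; rewrite sub0r normrN ger0_norm; last first.
  by apply: Ex_ge0 => w; exact: powR_ge0.
have ig : integ Q (g n) by exact: (@integ_bounded _ _ _ _ _ (L `^ r)).
have ip := Lr_diff_integ_p n.
have h1 : Ex Q (g n) <= e / 2.
  have := hn0 n n0n; rewrite sub0r normrN ger0_norm//.
  by apply: Ex_ge0.
apply: (@le_trans _ _ (Ex Q (fun w => g n w + L `^ (r - p) * `|U n w - Z w| `^ p))).
  apply: Ex_le; [exact: Lr_diff_integ|by apply: integD => //; exact: integZ|].
  move=> w; rewrite /g; case: (leP `|U n w - Z w| L) => h.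
    by rewrite lerDl mulr_ge0// powR_ge0.
  have D0 : 0 < `|U n w - Z w| by exact: lt_trans h.
  rewrite -[leLHS]add0r lerD ?powR_ge0//.
  rewrite -ler_pdivrMr ?powR_gt0// -powRB; last by rewrite (gt_eqF D0) implybT.
  rewrite -[r - p]opprB !powRN lef_pV2 ?posrE ?powR_gt0//.
  by apply: le_powR; [lra|exact: ltW|exact: ltW].
rewrite ExD//; last exact: integZ.
rewrite ExZ//.
have h2 : L `^ (r - p) * Ex Q (fun w => `|U n w - Z w| `^ p) <= L `^ (r - p) * M.
  by rewrite ler_wpM2l ?powR_ge0.
have -> : e = e / 2 + e / 2 by field.
by apply: lerD => //; apply: le_trans h2 _.
Qed.

(** [powRD_le_gap] compares the moments of [U n] and [Z] in both directions, with [U n - Z] in the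
    role of the gap; [del] is small against the uniform bound [B] and the limit [m]. *)
Lemma Lr_moment_cvg :
  Ex Q (fun w => `|U n w| `^ r) @[n --> \oo] --> Ex Q (fun w => `|Z w| `^ r).
Proof.
have r1 := r_gt1; have rp := r_lt_p; have r0 : 0 <= r by lra.
have iUr n : integ Q (fun w => `|U n w| `^ r).
  by apply: integ_powR_le (iU n) => //; exact: ltW.
have iZr : integ Q (fun w => `|Z w| `^ r).
  by apply: integ_powR_le iZ => //; exact: ltW.
pose B := 1 + K.
have UB n : Ex Q (fun w => `|U n w| `^ r) <= B.
  apply: (@le_trans _ _ (Ex Q (fun w => 1 + `|U n w| `^ p))).
    apply: Ex_le => //; first by apply: integD => //; exact: integ_cst.
    by move=> w; apply: powR_le_1D => //; exact: ltW.
  by rewrite ExD ?Ex_cst ?lerD2l//; exact: integ_cst.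
have B0 : 0 <= B by apply: le_trans (UB 0%N); apply: Ex_ge0 => w; exact: powR_ge0.
set m := Ex Q (fun w => `|Z w| `^ r).
have m0 : 0 <= m by apply: Ex_ge0 => w; exact: powR_ge0.
apply/cvgrPdist_le => /= e e0.
pose del := e / (2 * (B + m + 1)).
have S0 : 0 < 2 * (B + m + 1) by rewrite mulr_gt0// ltr_wpDl// addr_ge0.
have del0 : 0 < del by rewrite divr_gt0.
have dS : del * (2 * (B + m + 1)) = e by rewrite /del divfK// gt_eqF.
have [C C0 hC] := powRD_le_gap r1 del0.
have eC : 0 < e / 2 / C by rewrite !divr_gt0.
have /cvgrPdist_le/(_ _ eC) [n0 _ hn0] := Lr_cvg.
exists n0 => // n n0n.
have := hn0 n n0n; rewrite sub0r normrN ger0_norm; last first.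
  by apply: Ex_ge0 => w; exact: powR_ge0.
rewrite ler_pdivlMr// => hE.
have iD := Lr_diff_integ n.
have pt1 w : `|U n w| `^ r <= (1 + del) * `|Z w| `^ r + C * `|U n w - Z w| `^ r.
  apply: le_trans (hC _ _ (normr_ge0 _) (normr_ge0 _)); apply: le_powR => //.
  by apply: le_trans (ler_normD _ _); rewrite subrKC.
have pt2 w : `|Z w| `^ r <= (1 + del) * `|U n w| `^ r + C * `|U n w - Z w| `^ r.
  apply: le_trans (hC _ _ (normr_ge0 _) (normr_ge0 _)); apply: le_powR => //.
  by rewrite distrC; apply: le_trans (ler_normD _ _); rewrite subrKC.
have := Ex_le (iUr n) (integD (integZ _ iZr) (integZ _ iD)) pt1.
have := Ex_le iZr (integD (integZ _ (iUr n)) (integZ _ iD)) pt2.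
rewrite !ExD ?ExZ//; try exact: integZ.
rewrite -/m; move: (UB n) hE.
move: (Ex Q _) (Ex Q _) => u v uB hE h1 h2.
rewrite ler_norml; apply/andP; split; nra.
Qed.

End Lr_convergence.

Section normal_limit.
Context (d d' : measure_display) (T : measurableType d) (T' : measurableType d') (R : realType).
Variables (P : probability T R) (Q : probability T' R).
Variables (V : nat -> {RV P >-> R}) (Z : {RV Q >-> R}) (r p K : R).
Hypothesis Z_normal : forall A : set R, measurable A ->
    distribution Q Z A = normal_prob 0 1 A.
Hypothesis cdf_cvg : forall x eps : R, 0 < eps -> exists n0 : nat, forall n, (n0 <= n)%N ->
    `|rcdf P (V n) x - rcdf Q Z x| <= eps.
Hypothesis r_gt1 : 1 < r.
Hypothesis r_lt_p : r < p.
Hypothesis iV : forall n, integ P (fun w => `|V n w| `^ p).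
Hypothesis V_le : forall n, Ex P (fun w => `|V n w| `^ p) <= K.

Let U n w := quantile Z (V n) (Z w).

Let mU n : measurable_fun setT (U n).
Proof. exact: measurable_quantile. Qed.

Let URV n : {RV Q >-> R} := HB.pack (U n) (isMeasurableFun.Build _ _ _ _ (U n) (mU n)).

Let U_dist n A : measurable A -> P (V n @^-1` A) = Q (U n @^-1` A).
Proof.
apply: (@eq_cdf_eq_dist _ _ _ _ _ P Q (V n) (URV n)) => x.
by rewrite -(quantile_cdf Z_normal).
Qed.

Let U_integ (h : R -> R) n : measurable_fun setT h ->
  integ P (fun w => h (V n w)) -> integ Q (fun w => h (U n w)).
Proof.
move=> mh; apply: (@eq_dist_integ _ _ _ _ _ _ _ P Q) => //; exact: U_dist.
Qed.

Let U_Ex (h : R -> R) n : measurable_fun setT h ->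
  Ex P (fun w => h (V n w)) = Ex Q (fun w => h (U n w)).
Proof.
by move=> mh; apply: (@eq_dist_Ex _ _ _ _ _ _ _ P Q) => //; exact: U_dist.
Qed.

Let mabs (s : R) : measurable_fun setT (fun x : R => `|x| `^ s).
Proof. exact: measurable_norm_powR. Qed.

Let UZ w : U n w @[n --> \oo] --> Z w.
Proof. exact: quantile_cvg. Qed.

Let iU n : integ Q (fun w => `|U n w| `^ p).
Proof. by apply: (@U_integ (fun x => `|x| `^ p)). Qed.

Let iZ : integ Q (fun w => `|Z w| `^ p).
Proof. by have r1 := r_gt1; have rp := r_lt_p; apply: (standard_normal_absmom Z_normal); lra. Qed.

Let U_le n : Ex Q (fun w => `|U n w| `^ p) <= K.
Proof. by rewrite -(@U_Ex (fun x => `|x| `^ p)). Qed.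

(** The coupling [(U n, Z)] is one competitor in the infimum, so the distance lies between 0 and the
    L^r norm of [U n - Z]. *)
Lemma normal_limit_mallows : mallows_distance r (cdf (V n)) (cdf Z) @[n --> \oo] --> 0%E.
Proof.
have r1 := r_gt1; have rp := r_lt_p; have r0 : 0 < r^-1 by rewrite invr_gt0; lra.
have mZ : measurable_fun setT Z by exact: measurable_funP.
pose c n := Ex Q (fun w => `|U n w - Z w| `^ r).
have hc : c n @[n --> \oo] --> 0 := Lr_cvg r1 rp mU mZ UZ iU iZ U_le.
have c0 n : 0 <= c n by apply: Ex_ge0 => w; exact: powR_ge0.
apply: (@squeeze_cvge _ _ _ _ (fun=> 0%E) _ (fun n => (c n `^ r^-1)%:E)).
- near=> n; apply/andP; split.
    apply/ereal_infP => _ [d0 [T0 [Q0 [A [B [_ _ ->]]]]]].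
    exact: poweR_ge0.
  apply: ge_ereal_inf; eexists; last exact: lexx.
  exists d', T', Q, (URV n), Z; split => //.
    by apply/funext => x; exact: esym (U_dist n (measurable_itv _)).
  rewrite Ex_EFin ?poweR_EFin//.
  exact: Lr_diff_integ r1 rp mU mZ iU iZ n.
- exact: cvg_cst.
- apply/fine_cvgP; split; first by near=> n.
  apply/cvgrPdist_le => /= e e0.
  move/cvgrPdist_le : hc => /(_ _ (powR_gt0 r e0)) [n0 _ h].
  exists n0 => // n /h; rewrite !sub0r !normrN !ger0_norm ?powR_ge0// => h'.
  have -> : e = (e `^ r) `^ r^-1 by rewrite -powRrM mulfV ?powRr1 ?(ltW e0)// gt_eqF//; lra.
  by apply: le_powR => //; exact: ltW.
Unshelve. all: by end_near. Qed.

Lemma normal_limit_moment :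
  ('E_P[(fun w => `|V n w| `^ r)%R] @[n --> \oo] --> 'E_Q[(fun w => `|Z w| `^ r)%R])%E.
Proof.
have r1 := r_gt1; have rp := r_lt_p; have r0 : 0 <= r by lra.
have mZ : measurable_fun setT Z by exact: measurable_funP.
have h := Lr_moment_cvg r1 rp mU mZ UZ iU iZ U_le.
rewrite Ex_EFin; last exact: (standard_normal_absmom Z_normal).
have -> : (fun n => 'E_P[(fun w => `|V n w| `^ r)%R])%E =
    (fun n => (Ex Q (fun w => `|U n w| `^ r))%:E).
  apply/funext => n; rewrite Ex_EFin; first by rewrite (@U_Ex (fun x => `|x| `^ r)).
  by apply: integ_powR_le (iV n) => //; exact: ltW.
by apply: cvg_EFin => //; near=> n.
Unshelve. all: by end_near. Qed.

End normal_limit.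

(* [p] solves [q (p - 2) = 2 theta (q - p)], the equality case of the condition
   on [theta]. *)
Lemma moment_exponent (R : realType) (q r theta : R) : 2 < r -> r < q ->
  q * (r - 2) / (2 * (q - r)) < theta ->
  exists p, [/\ r < p, p < q & forall s, 2 < s -> s <= p ->
    q + (s - q) * (1 / 2 + theta / (s - 2)) <= s / 2].
Proof.
move=> r2 rq; rewrite ltr_pdivrMr; last by rewrite mulr_gt0// subr_gt0.
move=> h; have q2 : 2 < q by exact: lt_trans rq.
have th : 0 < theta.
  have qr : 0 < 2 * (q - r) by rewrite mulr_gt0// subr_gt0.
  by rewrite -(pmulr_lgt0 _ qr); apply: lt_trans h; rewrite mulr_gt0//; lra.
have D0 : 0 < q + 2 * theta by lra.
exists (2 * q * (theta + 1) / (q + 2 * theta)); split.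
- by rewrite ltr_pdivlMr//; lra.
- by rewrite ltr_pdivrMr//; have := mulr_gt0 th (lt_trans (ltr0n _ 2) q2); nra.
move=> s s2; rewrite ler_pdivlMr// => hs.
have s20 : 0 < s - 2 by lra.
have -> : q + (s - q) * (1 / 2 + theta / (s - 2)) =
  s / 2 + (q * (s - 2) - 2 * theta * (q - s)) / (2 * (s - 2)).
  by field; rewrite gt_eqF.
by rewrite gerDl mulr_le0_ge0 ?invr_ge0 ?mulr_ge0//; lra.
Qed.

Lemma integ_of_moment d (T : measurableType d) (R : realType) (P : probability T R)
  (f : {RV P >-> R}) (p : R) :
  ('E_P[(fun w => `|f w| `^ p)%R] < +oo)%E -> integ P (fun w => `|f w| `^ p).
Proof.
have mf : measurable_fun setT (fun w => `|f w| `^ p).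
  by apply: measurable_norm_powR; exact: measurable_funP.
rewrite unlock => h; apply/integrableP; split; first exact/measurable_EFinP.
by under eq_integral => w _ do rewrite /= ger0_norm ?powR_ge0//.
Qed.

Theorem theorem5
  (R : realType) (d : measure_display) (T : measurableType d)
  (P : probability T R) (X : int -> {RV P >-> R})
  (r rstar C1 theta : R)
  (d' : measure_display) (T' : measurableType d') (P' : probability T' R)
  (Z : {RV P' >-> R})
  (r_gt2 : 2 < r) (r_lt_rstar : r < rstar)
  (X_stationary : stationary X)
  (X_associated : positive_associated X)
  (X_moment : ('E_P[(fun w => `|X 1 w| `^ rstar)%R] < +oo)%E)
  (C1_gt0 : 0 < C1)
  (theta_gt : rstar * (r - 2) / (2 * (rstar - r)) < theta)
  (u_le : forall n : nat, (1 <= n)%N ->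
    (cov_tail X n <= (C1 * n%:R `^ (- theta))%:E)%E)
  (sigma2_gt0 : (0 < long_run_variance X)%E)
  (sigma2_fin : (long_run_variance X < +oo)%E)
  (Z_normal : forall A : set R, measurable A ->
    distribution P' Z A = normal_prob 0 1 A) :
  forall k : int,
    (mallows_distance r (cdf (normalized_block_sum X k n : {RV P >-> R})) (cdf Z)
       @[n --> \oo] --> 0%E) /\
    ('E_P[(fun w => `|normalized_block_sum X k n w| `^ r)%R]
       @[n --> \oo] --> 'E_P'[(fun w => `|Z w| `^ r)%R])%E.
Proof.
move=> k.
have [p [rp pq expo]] := moment_exponent r_gt2 r_lt_rstar theta_gt.
have r1 : 1 < r by lra.
have q2 : 2 <= rstar by lra.
have mX i : measurable_fun setT (X i) by exact: measurable_funP.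
have Xr1 : integ P (fun w => `|X 1 w| `^ rstar) by exact: integ_of_moment.
have X2 : sqinteg P (X 1).
  split=> //; have := integ_powR_le (mX 1) (ler0n R 2) q2 Xr1.
  by congr integ; apply/funext => w; rewrite powR_mulrn// real_normK ?num_real.
have Xq : integ P (fun w => `|cX X 0 w| `^ rstar).
  have h0 : integ P (fun w => `|X 0 w| `^ rstar).
    apply: (@X_integ _ _ _ P X X_stationary (fun x => `|x| `^ rstar) 1 0 _ Xr1).
    exact: measurable_norm_powR.
  apply: (integ_le _ (integZ (2 `^ rstar) (integD h0 (integ_cst P (`|Ex P (X 1)| `^ rstar))))).
    by apply: measurable_norm_powR; exact: measurable_funB.
  move=> w; rewrite [leLHS]ger0_norm ?powR_ge0//; apply: le_trans (ler_norm _).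
  by apply: powR_normB_le; lra.
have theta_gt0 : 0 < theta.
  apply: le_lt_trans theta_gt; rewrite divr_ge0 ?mulr_ge0//; lra.
pose s2 := fine (long_run_variance X).
have lrvE := long_run_varianceE X_stationary X_associated X2 sigma2_fin.
have s20 : 0 < s2 by move: sigma2_gt0; rewrite lrvE lte_fin.
have var_le := varsum_le X_stationary X_associated X2 C1_gt0 theta_gt0 sigma2_fin.
have var_ge := varsum_ge X_stationary X_associated X2 C1_gt0 theta_gt0 u_le sigma2_fin.
have cov_le m g n : Cv P (csum X 0 m) (csum X (m + g)%N%:Z n) <=
    \sum_(j < n) tailb C1 theta (g + j).+1.
  have := cov_blocks X_stationary X_associated X2 C1_gt0 theta_gt0 u_le 0 m g n.
  by rewrite add0r.
have cov_le0 m n : Cv P (csum X 0 m) (csum X m%:Z n) <= tailsum C1 theta n.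
  by have := cov_le m 0%N n; rewrite addn0.
have tail_small := tailsum_small C1_gt0 theta_gt0.
have p2 : 2 < p by lra.
(* Smooth test functions only have a Taylor estimate of order at most 3. *)
pose s := Num.min p 3.
have s_gt2 : 2 < s by rewrite lt_min p2; lra.
have s_le_p : s <= p by rewrite ge_min lexx.
have s_le3 : s <= 3 by rewrite ge_min lexx orbT.
have s_lt_q : s < rstar by lra.
(* The bound of order [p > r] serves the passage to convergence in L^r; the one of order [s]
   controls the Taylor remainders in the central limit theorem. *)
have [Kp Kp0 hKp] := csum_bound X_stationary X_associated X2 C1_gt0 theta_gt0 var_le cov_le
  p2 pq (expo p p2 (lexx _)) Xq.
have [Ks Ks0 hKs] := csum_bound X_stationary X_associated X2 C1_gt0 theta_gt0 var_le cov_le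
  s_gt2 s_lt_q (expo s s_gt2 s_le_p) Xq.
have iS a n (e : R) : 0 <= e -> e <= rstar -> integ P (fun w => `|csum X a n w| `^ e).
  move=> e0 eq; apply: integ_powR_le e0 eq _; first exact: (csum_sqinteg X_stationary X2 a n).1.
  exact: csumq_integ X_stationary X2 r_gt2 r_lt_rstar Xq a n.
pose c n : R := (Num.sqrt n%:R * Num.sqrt s2)^-1.
have VE n w : normalized_block_sum X k n w = c n * csum X k n w.
  rewrite /normalized_block_sum (Ex_EFin (sqinteg_integ X2)) mulrC /csum /block_sum.
  by congr (_ * _); rewrite /cX sumrB sumr_const card_ord mulr_natl.
have c0 n : 0 <= c n by rewrite invr_ge0 mulr_ge0 ?sqrtr_ge0.
pose V n : {RV P >-> R} := normalized_block_sum X k n.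
have VpE n w : `|V n w| `^ p = c n `^ p * `|csum X k n w| `^ p.
  by rewrite (VE n w : V n w = _) normrM (ger0_norm (c0 n)) powRM.
have iV n : integ P (fun w => `|V n w| `^ p).
  rewrite (_ : (fun w => _) = fun w => c n `^ p * `|csum X k n w| `^ p); last exact/funext/VpE.
  by apply: integZ; apply: iS; lra.
have V_le n : Ex P (fun w => `|V n w| `^ p) <= Kp * s2 `^ (- (p / 2)).
  rewrite (_ : (fun w => _) = fun w => c n `^ p * `|csum X k n w| `^ p); last exact/funext/VpE.
  rewrite ExZ; last by apply: iS; lra.
  apply: le_trans (ler_wpM2l (powR_ge0 _ _) (hKp k n)) _.
  (* At [n = 0] the normalizing factor is the inverse of 0, which is 0 by convention. *)
  case: (posnP n) => [->|n0].
    rewrite /c sqrtr0 mul0r invr0 powR0 ?gt_eqF//; last by lra.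
    by rewrite mul0r mulr_ge0 ?powR_ge0.
  have n0' : 0 < n%:R :> R by rewrite ltr0n.
  have -> : c n `^ p = n%:R `^ (- (p / 2)) * s2 `^ (- (p / 2)).
    have -> : c n = ((n%:R * s2) `^ 2^-1) `^ (-1).
      by rewrite powR_inv1 ?powR_ge0// powR12_sqrt ?mulr_ge0 ?(ltW s20)// sqrtrM.
    rewrite -!powRrM powRM ?(ltW s20)//.
    by congr (_ `^ _ * _ `^ _); field.
  rewrite [leLHS](_ : _ = (n%:R `^ (- (p / 2)) * n%:R `^ (p / 2)) *
    (Kp * s2 `^ (- (p / 2)))); last by ring.
  by rewrite -powRD ?(gt_eqF n0') ?implybT// addNr powRr0 mul1r.
have V_cvg (x eps : R) : 0 < eps -> exists n0 : nat, forall n, (n0 <= n)%N ->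
    `|rcdf P (V n) x - rcdf P' Z x| <= eps.
  apply: (@rcdf_cvg _ _ _ _ _ P P' V Z s) => //.
  - by rewrite (ltW s_gt2).
  - move=> B f f1 f2 sm f0 e e0.
    have iSs a n : integ P (fun w => `|csum X a n w| `^ s) by apply: iS; lra.
    have [n0 h] := clt_limit Z_normal X_stationary X_associated X2 s20 var_le var_ge cov_le0
      tail_small s_gt2 iSs hKs sm f0 e0.
    exists n0 => n /h; congr (`|_ - _| <= _).
    have -> : (fun w => f (V n w)) = fun w => f (c n * csum X k n w).
      by apply/funext => w; rewrite (VE n w : V n w = _).
    (* The central limit theorem was proved for blocks starting at 0; stationarity moves it to
       [k]. *)
    apply: (@csum_Ex _ _ _ P X X_stationary X2 (fun x => f (c n * x))).
    apply: measurableT_comp; first exact: lipschitz_measurable (smooth_lip0 sm).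
    exact: measurable_funM.
  - exact: normal_cdf_lipschitz.
split.
  exact: (normal_limit_mallows Z_normal V_cvg r1 rp iV V_le).
exact: (normal_limit_moment Z_normal V_cvg r1 rp iV V_le).
Qed.
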